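(* Let $f:\mathbb{R}^d\to\mathbb{R}$, $f(x)=\mathbb{E}_{\xi\sim\Xi(x)}[F(x;\xi)]$, be $L$-Lipschitz continuous, and suppose $\mathbb{E}_{\xi\sim\Xi(x)}[F(x;\xi)]=f(x)$ and $\mathbb{E}_{\xi\sim\Xi(x)}[|F(x;\xi)-f(x)|^2]\le\sigma^2$ for all $x\in\mathbb{R}^d$. Let $\delta>0$ and define the one-point residual estimator $$g_{\rm 1pt}(y_t,u_t,\xi_t;y_{t-1},u_{t-1},\xi_{t-1})=\frac{d}{\delta}\big(F(y_t+\delta u_t;\xi_t)-F(y_{t-1}+\delta u_{t-1};\xi_{t-1})\big)u_t,$$ where $u_t,u_{t-1}\sim\mathrm{Unif}(\mathbb{S}^{d-1})$, $\xi_t\sim\Xi(y_t+\delta u_t)$ and $\xi_{t-1}\sim\Xi(y_{t-1}+\delta u_{t-1})$. Then $$\mathbb{E}[g_{\rm 1pt}(y_t,u_t,\xi_t;y_{t-1},u_{t-1},\xi_{t-1})\mid\mathcal{F}_{t-1}]=\nabla f_\delta(y_t)$$ and $$\mathbb{E}\big[\|g_{\rm 1pt}(y_t,u_t,\xi_t;y_{t-1},u_{t-1},\xi_{t-1})\|^2\big]\le\frac{6d^2\sigma^2}{\delta^2}+144\sqrt{2\pi}\,dL^2+\frac{6d^2L^2}{\delta^2}\,\mathbb{E}[\|y_t-y_{t-1}\|^2].$$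
   Context: $\|\cdot\|$ is the Euclidean norm, $\mathbb{S}^{d-1}$ the unit sphere and $\mathbb{B}^d$ the closed unit ball of $\mathbb{R}^d$. For each $x\in\mathbb{R}^d$, $\Xi(x)$ is a probability distribution depending on $x$, and $F(x;\xi)$ with $\xi\sim\Xi(x)$ is the noisy value returned by a stochastic zeroth-order oracle queried at $x$. The smoothed surrogate is $f_\delta(x)=\mathbb{E}_{u\sim\mathrm{Unif}(\mathbb{B}^d)}[f(x+\delta u)]$, which is differentiable. $\mathcal{F}_{t-1}$ is the $\sigma$-algebra of all randomness revealed before sampling $u_t$ and $\xi_t$: $y_t,y_{t-1},u_{t-1},\xi_{t-1}$ are $\mathcal{F}_{t-1}$-measurable, $u_t$ is uniform on $\mathbb{S}^{d-1}$ independently of $\mathcal{F}_{t-1}$, and conditionally on $(\mathcal{F}_{t-1},u_t)$, $\xi_t\sim\Xi(y_t+\delta u_t)$. Likewise at the previous iteration $u_{t-1}$ is uniform on $\mathbb{S}^{d-1}$ independently of $y_{t-1}$ (and of everything revealed before it), and conditionally on these, $\xi_{t-1}\sim\Xi(y_{t-1}+\delta u_{t-1})$. The point $y_t$ may depend on $u_{t-1},\xi_{t-1}$. *)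

(* Defs.v *)
From HB Require Import structures.
From mathcomp Require Import all_boot all_order all_algebra.
From mathcomp Require Import all_classical all_reals all_analysis.
From mathcomp Require Import measurable_realfun lra.

Set Implicit Arguments.
Unset Strict Implicit.
Unset Printing Implicit Defensive.

Import Order.TTheory GRing.Theory Num.Theory.
Import numFieldTopology.Exports numFieldNormedType.Exports.

Local Open Scope classical_set_scope.
Local Open Scope ring_scope.

(* The product sigma-algebra on row vectors, generated by the coordinates, as
   the library does for n.-tuple; over the reals it is the Borel one. *)

Definition measure_rV_display : measure_display -> measure_display.
Proof. exact. Qed.

Section measurable_rV.
Context {d} {T : sigmaRingType d}.
Variable n : nat.

Let coors : 'I_n -> 'rV[T]_n -> T := fun i x => x ord0 i.

Let rV_set0 : g_sigma_preimage coors set0.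
Proof. exact: sigma_algebra0. Qed.

Let rV_setC A : g_sigma_preimage coors A -> g_sigma_preimage coors (~` A).
Proof. exact: sigma_algebraC. Qed.

Let rV_bigcup (F : _^nat) : (forall i, g_sigma_preimage coors (F i)) ->
  g_sigma_preimage coors (\bigcup_i (F i)).
Proof. exact: sigma_algebra_bigcup. Qed.

HB.instance Definition _ := @isMeasurable.Build (measure_rV_display d)
  'rV[T]_n (g_sigma_preimage coors) rV_set0 rV_setC rV_bigcup.

End measurable_rV.

Lemma measurable_coord d (T : sigmaRingType d) n (i : 'I_n) :
  measurable_fun [set: 'rV[T]_n] (fun x : 'rV[T]_n => x ord0 i).
Proof.
move=> _ Y mY; rewrite setTI; apply: sub_sigma_algebra => /=.
rewrite -bigcup_seq/=; exists i => /=; first by rewrite mem_index_enum.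
by exists Y => //; rewrite setTI.
Qed.

Lemma measurable_fun_rVP d1 d2 (T1 : measurableType d1) (T2 : measurableType d2)
    n (f : T1 -> 'rV[T2]_n) :
  measurable_fun setT f <->
  forall i, measurable_fun setT (fun x => f x ord0 i).
Proof.
split=> [mf i|mf].
  exact: (measurableT_comp (measurable_coord (T := T2) i) mf).
move=> _; apply: (@measurability _ _ _ _ setT f
  (\big[setU/set0]_(i < n) preimage_set_system setT
     (fun x : 'rV[T2]_n => x ord0 i) measurable)) => //.
move=> _ [B + <-].
rewrite -bigcup_seq => -[i _ [C mC <-]].
rewrite setTI; exact: (mf i).
Qed.

(* n-dimensional Lebesgue measure, as an iterated product. *)

Section lebesgue_rV.
Context {R : realType}.

Definition cons_rV n (p : R * 'rV[R]_n) : 'rV[R]_n.+1 := row_mx p.1%:M p.2.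

Definition uncons_rV n (x : 'rV[R]_n.+1) : R * 'rV[R]_n :=
  (x ord0 ord0, \row_j x ord0 (lift ord0 j)).

Lemma cons_rV0 n (p : R * 'rV[R]_n) : cons_rV p ord0 ord0 = p.1.
Proof.
rewrite /cons_rV mxE; case: splitP => // j _.
by rewrite mxE (ord1 j) eqxx mulr1n.
Qed.

Lemma cons_rVS n (p : R * 'rV[R]_n) (j : 'I_n) :
  cons_rV p ord0 (lift ord0 j) = p.2 ord0 j.
Proof.
rewrite /cons_rV mxE; case: splitP => [[[|//] i]//|k /= /eqP].
by rewrite /bump/= !add1n eqSS => /eqP jk; congr (p.2 _ _); exact: val_inj.
Qed.

Lemma cons_rVK n : cancel (@cons_rV n) (@uncons_rV n).
Proof.
case=> a v; congr pair; first exact: cons_rV0.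
by apply/rowP => j; rewrite mxE cons_rVS.
Qed.

Lemma measurable_cons_rV n : measurable_fun setT (@cons_rV n).
Proof.
apply/measurable_fun_rVP => i; have [j ->|->] := unliftP ord0 i.
- rewrite (_ : (fun p => _) = fun p : R * 'rV[R]_n => p.2 ord0 j); last first.
    by apply/funext => p; rewrite cons_rVS.
  exact: (measurableT_comp (measurable_coord (T := R) j) measurable_snd).
- rewrite (_ : (fun p => _) = @fst R 'rV[R]_n) //.
  by apply/funext => p; rewrite cons_rV0.
Qed.

Lemma measurable_uncons_rV n : measurable_fun setT (@uncons_rV n).
Proof.
apply/measurable_fun_pair; first exact: measurable_coord.
apply/measurable_fun_rVP => i.
rewrite (_ : (fun x => _) = fun x : 'rV[R]_n.+1 => x ord0 (lift ord0 i)).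
  exact: measurable_coord.
by apply/funext => x; rewrite mxE.
Qed.

Section lebesgue_cons.
Variables (n : nat) (m : {sigma_finite_measure set 'rV[R]_n -> \bar R}).

Definition lebesgue_cons : set 'rV[R]_n.+1 -> \bar R :=
  pushforward (lebesgue_measure \x m)%E (@cons_rV n).

Let lebesgue_cons0 : lebesgue_cons set0 = 0%E.
Proof. by rewrite /lebesgue_cons /pushforward preimage_set0 measure0. Qed.

Let lebesgue_cons_ge0 A : (0 <= lebesgue_cons A)%E.
Proof. by rewrite /lebesgue_cons /pushforward measure_ge0. Qed.

Let lebesgue_cons_sigma_additive : semi_sigma_additive lebesgue_cons.
Proof.
rewrite /lebesgue_cons; apply: measure_semi_sigma_additive.
exact: measurable_cons_rV.
Qed.

HB.instance Definition _ := isMeasure.Build _ _ _ lebesgue_cons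
  lebesgue_cons0 lebesgue_cons_ge0 lebesgue_cons_sigma_additive.

Let lebesgue_cons_sigma_finite : sigma_finite setT lebesgue_cons.
Proof.
have /sigma_finiteP[F [TF ndF Foo]] := sigma_finiteT (@lebesgue_measure R).
have /sigma_finiteP[G [TG ndG Goo]] := sigma_finiteT m.
exists (fun k => @uncons_rV n @^-1` (F k `*` G k)) => [|k].
  rewrite predeqE => x; split=> // _.
  have [i _ Fi] : (\bigcup_i F i) (uncons_rV x).1 by rewrite -TF.
  have [j _ Gj] : (\bigcup_i G i) (uncons_rV x).2 by rewrite -TG.
  exists (maxn i j) => //; split.
  - by move: Fi; exact/subsetPset/ndF/leq_maxl.
  - by move: Gj; exact/subsetPset/ndG/leq_maxr.
have [mF Fk] := Foo k; have [mG Gk] := Goo k.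
split.
  rewrite -[X in measurable X]setTI.
  by apply: measurable_uncons_rV => //; exact: measurableX.
rewrite /lebesgue_cons /pushforward -comp_preimage.
rewrite (_ : _ \o _ = id); last by apply/funext; exact: cons_rVK.
by rewrite product_measure1E// lte_mul_pinfty// ge0_fin_numE.
Qed.

HB.instance Definition _ := Measure_isSigmaFinite.Build _ _ _ lebesgue_cons
  lebesgue_cons_sigma_finite.

End lebesgue_cons.

Fixpoint lebesgue_rV n : {sigma_finite_measure set 'rV[R]_n -> \bar R} :=
  if n is n'.+1 then lebesgue_cons (lebesgue_rV n')
  else @dirac _ 'rV[R]_0 0 R.

Definition box n (a b : 'I_n -> R) : set 'rV[R]_n :=
  [set x | forall i, a i <= x ord0 i <= b i].

Lemma measurable_box n (a b : 'I_n -> R) : measurable (box a b).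
Proof.
rewrite (_ : box a b = \bigcap_(i in [set: 'I_n])
    (setT `&` (fun x : 'rV[R]_n => x ord0 i) @^-1` `[a i, b i])); last first.
  apply/seteqP; split => x /= H i.
    by move=> _; split => //=; rewrite in_itv/=; exact: H.
  by have [_ /=] := H i Logic.I; rewrite in_itv.
apply: fin_bigcap_measurable => // i _.
by apply: measurable_coord => //; exact: measurable_itv.
Qed.

Lemma lebesgue_rV_box n (a b : 'I_n -> R) : (forall i, a i <= b i) ->
  lebesgue_rV n (box a b) = (\prod_(i < n) (b i - a i))%:E.
Proof.
elim: n a b => [|n IH] a b ab /=.
  by rewrite big_ord0 diracE mem_set// => -[].
rewrite /lebesgue_cons /pushforward.
rewrite (_ : _ @^-1` _ = `[a ord0, b ord0] `*`
    box (a \o lift ord0) (b \o lift ord0)); last first.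
  apply/seteqP; split => [p /= H|p [/= H0 H1] i].
    split => /=; first by rewrite in_itv/= -(cons_rV0 p); exact: H.
    by move=> j; rewrite -cons_rVS; exact: H.
  have [j ->|->] := unliftP ord0 i; first by rewrite cons_rVS; exact: H1.
  by rewrite cons_rV0; move: H0; rewrite in_itv.
rewrite product_measure1E//; last exact: measurable_box.
have E : lebesgue_measure `[a ord0, b ord0]%classic =
    (b ord0 - a ord0)%:E :> \bar R.
  rewrite lebesgue_measure_itv/= lte_fin.
  have := ab ord0; rewrite le_eqVlt => /predU1P[->|->//].
  by rewrite ltxx subrr.
rewrite IH => [|i]; last exact: ab.
by rewrite big_ord_recl EFinM; congr (_ * _)%E.
Qed.

End lebesgue_rV.

Section uniform.
Context {R : realType} {n : nat}.
Implicit Types x : 'rV[R]_n.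

(* The norm the library puts on 'rV[R]_n is the sup norm. *)
Definition enorm x : R := Num.sqrt (\sum_i x ord0 i ^+ 2).

Definition euclidean_lipschitz (L : R) (f : 'rV[R]_n -> R) : Prop :=
  forall x y, `|f x - f y| <= L * enorm (x - y).

Definition eball : set 'rV[R]_n := [set x | enorm x <= 1].

Definition sphere_proj x : 'rV[R]_n := (enorm x)^-1 *: x.

Lemma measurable_enorm : measurable_fun setT enorm.
Proof.
have -> : enorm = fun x => (\sum_i x ord0 i ^+ 2) `^ 2^-1.
  apply/funext => x; rewrite powR12_sqrt// sumr_ge0// => i _.
  exact: sqr_ge0.
apply: (measurableT_comp (measurable_powR _)); apply: measurable_sum => i.
by apply: measurable_funX; exact: measurable_coord.
Qed.

Lemma measurable_eball : measurable eball.
Proof.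
rewrite (_ : eball = setT `&` enorm @^-1` `]-oo, 1]).
  by apply: measurable_enorm => //; exact: measurable_itv.
by rewrite setTI; apply/seteqP; split => x; rewrite /eball/= in_itv.
Qed.

Lemma measurable_sphere_proj : measurable_fun setT sphere_proj.
Proof.
apply/measurable_fun_rVP => i.
rewrite (_ : (fun x => _) = fun x => enorm x `^ (-1) * x ord0 i); last first.
  by apply/funext => x; rewrite mxE powR_inv1// sqrtr_ge0.
apply: measurable_funM; last exact: measurable_coord.
exact: (measurableT_comp (measurable_powR _) measurable_enorm).
Qed.

HB.instance Definition _ :=
  isMeasurableFun.Build _ _ _ _ sphere_proj measurable_sphere_proj.

Lemma lebesgue_eball : (0 < lebesgue_rV n eball < +oo)%E.
Proof.
apply/andP; split.
  pose c : R := n.+1%:R^-1.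
  have c0 : 0 < c by rewrite invr_gt0.
  apply: (@lt_le_trans _ _ (lebesgue_rV n (box (fun=> - c) (fun=> c)))).
    rewrite lebesgue_rV_box => [|i]; last by lra.
    by rewrite lte_fin prodr_gt0// => i _; lra.
  apply: le_measure; rewrite ?inE; first exact: measurable_box.
    exact: measurable_eball.
  move=> x H; rewrite /eball /= /enorm -sqrtr1 ler_wsqrtr//.
  apply: (@le_trans _ _ (\sum_(i < n) c ^+ 2)).
    by apply: ler_sum => i _; have /andP[] := H i; nra.
  have cn : n%:R * c + c = 1.
    by rewrite -[X in _ + X]mul1r -mulrDl natr1 mulfV.
  have n0 : 0 <= n%:R :> R by [].
  rewrite sumr_const card_ord -mulr_natl.
  have : 0 <= n%:R * c by rewrite mulr_ge0// ltW.
  nra.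
apply: (@le_lt_trans _ _ (lebesgue_rV n (box (fun=> - 1) (fun=> 1)))).
  apply: le_measure; rewrite ?inE; first exact: measurable_eball.
    exact: measurable_box.
  move=> x; rewrite /eball /= => H i.
  rewrite -ler_norml -sqrtr_sqr; apply: le_trans H.
  rewrite ler_wsqrtr// (bigD1 i)//= lerDl sumr_ge0// => j _.
  exact: sqr_ge0.
rewrite lebesgue_rV_box => [|i]; last by lra.
by rewrite ltry.
Qed.

(* The last argument of mnormalize is an unused default, see unif_ballE. *)
Definition unif_ball : probability 'rV[R]_n R :=
  mnormalize (mrestr (@lebesgue_rV R n) measurable_eball)
    (@dirac _ 'rV[R]_n 0 R).

Lemma unif_ballE A :
  unif_ball A =
  (lebesgue_rV n (A `&` eball) * (fine (lebesgue_rV n eball))^-1%:E)%E.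
Proof.
have /andP[v0 voo] := lebesgue_eball.
by rewrite /unif_ball /= /mnormalize /= /mrestr setTI gt_eqF// lt_eqF.
Qed.

(* Normalized surface measure: the surface measure of a Borel set A of the
   sphere is n times the volume of the cone of the x in the ball such that
   x / |x| is in A (polar coordinates). *)
Definition unif_sphere : probability 'rV[R]_n R :=
  distribution unif_ball sphere_proj.

Definition smoothed (delta : R) (f : 'rV[R]_n -> R) x : R :=
  fine 'E_unif_ball[fun u => (f (x + delta *: u))%R]%E.

Definition gradient (f : 'rV[R]_n -> R) x : 'rV[R]_n :=
  \row_i 'D_(delta_mx ord0 i) f x.

Definition g_1pt (Z : Type) (delta : R) (F : 'rV[R]_n -> Z -> R)
    (y u : 'rV[R]_n) (xi : Z) (y' u' : 'rV[R]_n) (xi' : Z) : 'rV[R]_n :=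
  (n%:R / delta * (F (y + delta *: u) xi - F (y' + delta *: u') xi')) *: u.

End uniform.

Section conditioning.
Context {R : realType} {d d' : measure_display}.
Context {T : measurableType d} {T' : measurableType d'}.
Variables (P : probability T R) (G : set (set T)).
Local Open Scope ereal_scope.

Definition sub_sigma_algebra_of : Prop :=
  sigma_algebra setT G /\ G `<=` measurable.

Definition measurable_wrt d1 (T1 : measurableType d1) (X : T -> T1) : Prop :=
  forall B, measurable B -> G (X @^-1` B).

Definition sigma_join (X : T -> T') : set (set T) :=
  <<s G `|` preimage_set_system setT X measurable >>.

Definition indep_of (X : T -> T') : Prop :=
  forall A B, G A -> measurable B ->
    P (A `&` X @^-1` B) = P A * P (X @^-1` B).

Definition has_law (X : T -> T') (mu : probability T' R) : Prop :=
  forall B, measurable B -> P (X @^-1` B) = mu B.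

Definition has_cond_law (X : T -> T') (kappa : T -> set T' -> \bar R) : Prop :=
  forall A B, G A -> measurable B ->
    P (A `&` X @^-1` B) = \int[P]_(w in A) kappa w B.

(* Y is a version of E[X | G], without assuming X integrable: E[X | G] is
   E[X^+ | G] - E[X^- | G], where both terms, which are defined for any
   nonnegative X, have to be finite. *)
Definition is_cond_exp (X Y : T -> R) : Prop :=
  measurable_wrt Y /\
  exists Yp Yn : T -> R, [/\ measurable_wrt Yp, measurable_wrt Yn,
    forall w, (0 <= Yp w)%R /\ (0 <= Yn w)%R,
    forall A, G A ->
      \int[P]_(w in A) (Yp w)%:E = \int[P]_(w in A) (EFin \o X)^\+ w /\
      \int[P]_(w in A) (Yn w)%:E = \int[P]_(w in A) (EFin \o X)^\- w &
    {ae P, forall w, Y w = (Yp w - Yn w)%R}].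

(* For integrable X this is the usual conditional expectation. *)
Lemma is_cond_exp_integral (X Y : T -> R) : sub_sigma_algebra_of ->
  P.-integrable setT (EFin \o X) -> is_cond_exp X Y ->
  forall A, G A -> \int[P]_(w in A) (Y w)%:E = \int[P]_(w in A) (X w)%:E.
Proof.
move=> [sG GT] iX [mY [Yp [Yn [mYp mYn Y0 YE YD]]]] A GA.
have mA := GT _ GA.
have mG (f : T -> R) : measurable_wrt f -> measurable_fun A f.
  by move=> mf _ B mB; apply: measurableI => //; exact/GT/mf.
have [YpE YnE] := YE A GA.
have iXA : P.-integrable A (EFin \o X) by exact: integrableS iX.
rewrite (ae_eq_integral (fun w => (Yp w)%:E - (Yn w)%:E))//; first last.
- by apply: filterS YD => w /= -> _; rewrite EFinB.
- by apply: emeasurable_funB; apply/measurable_EFinP; exact: mG.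
- by apply/measurable_EFinP; exact: mG.
rewrite integralB//.
- by rewrite YpE YnE [in RHS]integralE.
- apply/integrableP; split; first by apply/measurable_EFinP; exact: mG.
  under eq_integral do rewrite gee0_abs ?lee_fin ?(Y0 _).1//.
  by rewrite YpE; exact: integral_funepos_lt_pinfty.
- apply/integrableP; split; first by apply/measurable_EFinP; exact: mG.
  under eq_integral do rewrite gee0_abs ?lee_fin ?(Y0 _).2//.
  by rewrite YnE; exact: integral_funeneg_lt_pinfty.
Qed.

End conditioning.

(* Main.v *)
Require Import Defs.
From HB Require Import structures.
From mathcomp Require Import all_boot all_order all_algebra.
From mathcomp Require Import all_classical all_reals all_analysis.
From mathcomp Require Import perm measurable_realfun ring lra.
Import Order.TTheory GRing.Theory Num.Theory.
Import numFieldTopology.Exports numFieldNormedType.Exports.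
Local Open Scope classical_set_scope.
Local Open Scope ring_scope.

(** Write |x| for the Euclidean norm, dir(x) for the direction x / |x|, n for the
    dimension and S for the uniform law of directions.

    Conditional mean.  Given the past and the direction v, the oracle averages
    to f (y + delta v), and the previous oracle value is a constant that the
    mean zero of v annihilates.  Hence the conditional mean of the estimator is
    (n / delta) times the S-mean of f (y + delta v) v.  This is the gradient of
    the smoothed function by the divergence theorem, for which a substitute is
    proved here, [ball_taylor]: if h is Lipschitz, the mean of h over the unit
    ball of centre v has a first order expansion in v whose linear term is
    n times the S-mean of h (t) (t . v), with an error O(|v|^2).  The ball of
    centre v differs from the star-shaped region |w| <= 1 + v . dir(w) by a set of
    volume O(|v|^2), and what either of them gains or loses with respect to the
    ball of centre 0 lies in a shell of width O(|v|), where h (w) is h (dir(w)) up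
    to O(|v|).  In polar coordinates the integral of h (dir(w)) over the star-shaped
    region is the S-mean of h (t) (1 + v . t)^n, up to the volume of the ball.
    The error being uniform in the base point, the smoothed function is
    differentiable ([smoothed_differentiable]).

    The estimator need not be integrable, since nothing bounds y, but the
    conditional means of its positive and negative parts are finite
    ([conditional_gradient]).

    Second moment.  As |u| <= 1 almost surely, it is enough to bound the mean
    square of F - F', which is the sum of the two noises and of
    f (y + delta u) - f (y' + delta u').  The last term splits at the point
    y' + delta u into a difference of size L |y - y'| and the difference of
    the values of one delta L-Lipschitz function at two independent uniform
    directions.  The mean square of the latter is at most 48 (delta L)^2 / n
    ([sphere_poincare]), which produces a term 288 n L^2 in the bound, and
    288 <= 144 sqrt (2 pi) since pi >= 2.

    Variance of a Lipschitz function of a direction.  The argument is the one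
    that Maurey and Pisier use for Gaussian vectors, for a pair (x, y) uniform
    in a thin shell around the unit sphere of R^n x R^n: the law is invariant
    under the rotations that mix x and y, and the directions of x and y are
    independent and uniform.  Let D (a) be the mean square of
    phi (cos a x + sin a y) - phi (x), for phi smooth enough.  Rotation
    invariance gives D (2 a) <= 4 D (a), and for small a the increment is close
    to a (grad phi (x) . y), of mean square at most a^2 l^2 / (2 n) by isotropy
    of y.  Halving the angle pi / 2 repeatedly bounds the mean square of
    phi (y) - phi (x) by 4 l^2 / n ([shell_smooth]).  The passage from vectors
    to directions costs the fluctuation of |x|, which is O(1 / n) because a
    rotation by 45 degrees turns |x|^2 - |y|^2 into 2 x . y
    ([shell_radius]). *)

Set Implicit Arguments.
Unset Strict Implicit.
Unset Printing Implicit Defensive.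

(** * Invariance of Lebesgue measure on row vectors *)

Section Lebesgue.
Context {R : realType}.

(** Boxes are stable under intersection, as uniqueness of measures requires of
    a generator. *)
Lemma measurable_rVE n : @measurable _ 'rV[R]_n = <<s [set A | exists a b, A = box a b] >>.
Proof.
apply/seteqP; split; last first.
  apply: smallest_sub; first exact: sigma_algebra_measurable.
  by move=> A1 [a [b ->]]; exact: measurable_box.
set G := [set A | exists a b, A = box a b].
have coor (i : 'I_n) : measurable_fun setT
    (fun x : g_sigma_algebraType G => (x : 'rV[R]_n) ord0 i).
  apply: (measurability _ (RGenCInfty.measurableE R)) => _ [B [a ->] <-].
  rewrite setTI.
  rewrite (_ : _ @^-1` _ = \bigcup_k box (fun j => if j == i then a else - k%:R)
      (fun=> k%:R)).
    by apply: bigcup_measurable => k _; apply: sub_sigma_algebra;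
      exists (fun j => if j == i then a else - k%:R), (fun=> k%:R).
  apply/seteqP; split => [x /=|x [k _ /(_ i)]] /=; last first.
    by rewrite eqxx in_itv/= andbT => /andP[].
  rewrite in_itv/= andbT => ax.
  pose m := (\sum_j `|x ord0 j|).
  have [k mk] : exists k : nat, m <= k%:R.
    by exists (Num.trunc m).+1; rewrite ltW// truncnS_gt.
  exists k => // j.
  have : `|x ord0 j| <= k%:R.
    by apply: le_trans mk; rewrite /m (bigD1 j)//= lerDl sumr_ge0.
  rewrite ler_norml => /andP[kx ->].
  by case: ifPn => [/eqP ->|_]; rewrite ?ax ?kx.
move=> A; apply: smallest_sub; first exact: smallest_sigma_algebra.
rewrite -bigcup_seq => B [i _ [C mC <-]].
exact: (coor i measurableT C mC).
Qed.

(** All symmetries of Lebesgue measure below come from this criterion: only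
    images of boxes have to be computed. *)
Lemma lebesgue_rV_unique n (m : {measure set 'rV[R]_n -> \bar R}) :
  (forall a b, (forall i, a i <= b i) ->
    m (box a b) = (\prod_(i < n) (b i - a i))%:E) ->
  forall A, measurable A -> lebesgue_rV n A = m A.
Proof.
move=> mbox A mA.
pose g k : set 'rV[R]_n := box (fun=> - k%:R) (fun=> k%:R).
have gle k : forall i : 'I_n, - k%:R <= k%:R :> R.
  by move=> _; rewrite (@le_trans _ _ 0)// oppr_le0.
apply: (measure_unique _ g (@measurable_rVE n)) => //.
- move=> ? ? [a [b ->]] [a' [b' ->]].
  exists (fun i => Num.max (a i) (a' i)), (fun i => Num.min (b i) (b' i)).
  apply/seteqP; split => x /=.
    by move=> [H H'] i; rewrite ge_max le_min;
      have /andP[-> ->] := H i; have /andP[-> ->] := H' i.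
  move=> H; split => i; have := H i; rewrite ge_max le_min;
    by move=> /andP[/andP[p q] /andP[r t]]; apply/andP; split.
- by move=> k; exists (fun=> - k%:R), (fun=> k%:R).
- apply/seteqP; split => // x _.
  exists (Num.trunc (\sum_j `|x ord0 j|)).+1 => // i.
  rewrite -ler_norml ltW// (le_lt_trans _ (truncnS_gt _))//.
  by rewrite (bigD1 i)//= lerDl sumr_ge0.
- move=> A1 [a [b ->]].
  have [ab|/existsNP[i /negP]] := pselect (forall i, a i <= b i).
    exact: etrans (lebesgue_rV_box ab) (esym (mbox _ _ ab)).
  rewrite -ltNge => ba; suff -> : box a b = set0 by rewrite !measure0.
  apply/seteqP; split => // x /(_ i) /andP[ax xb].
  by move: (le_lt_trans (le_trans ax xb) ba); rewrite ltxx.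
- by move=> k; apply: (eq_ind_r (fun e => (e < +oo)%E) (ltry _) (lebesgue_rV_box (gle k))).
Qed.

Definition diag_affine n (s c x : 'rV[R]_n) : 'rV[R]_n :=
  \row_i (s ord0 i * x ord0 i + c ord0 i).

Lemma measurable_diag_affine n (s c : 'rV[R]_n) :
  measurable_fun setT (diag_affine s c).
Proof.
apply/measurable_fun_rVP => i.
rewrite (_ : (fun x => _) = fun x : 'rV[R]_n => s ord0 i * x ord0 i + c ord0 i).
  by apply: measurable_funD => //; apply: measurable_funM => //;
    exact: measurable_coord.
by apply/funext => x; rewrite mxE.
Qed.

HB.instance Definition _ n (s c : 'rV[R]_n) :=
  isMeasurableFun.Build _ _ _ _ (diag_affine s c) (measurable_diag_affine s c).

(** The preimage of a box is a box, a negative factor exchanging the two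
    bounds of its coordinate. *)
Lemma lebesgue_rV_affine n (s c : 'rV[R]_n) A : (forall i, s ord0 i != 0) ->
  measurable A ->
  lebesgue_rV n A =
  ((\prod_(i < n) `|s ord0 i|)%:E * lebesgue_rV n (diag_affine s c @^-1` A))%E.
Proof.
move=> s0 mA.
have p0 : 0 <= \prod_(i < n) `|s ord0 i| by apply: prodr_ge0.
apply: (lebesgue_rV_unique (m := mscale (NngNum p0)
  (pushforward (lebesgue_rV n) (diag_affine s c)))) => // a b ab.
change ((\prod_(i < n) `|s ord0 i|)%:E *
  lebesgue_rV n (diag_affine s c @^-1` box a b) = (\prod_(i < n) (b i - a i))%:E)%E.
pose lo i := if 0 < s ord0 i then a i else b i.
pose hi i := if 0 < s ord0 i then b i else a i.
rewrite (_ : _ @^-1` _ = box (fun i => (lo i - c ord0 i) / s ord0 i)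
   (fun i => (hi i - c ord0 i) / s ord0 i)).
  rewrite lebesgue_rV_box => [|i]; last first.
    rewrite /lo /hi; case: ltrgt0P (s0 i) => // si _.
      by rewrite ler_pM2r ?invr_gt0// lerD2r ab.
    by rewrite ler_nM2r ?invr_lt0// lerD2r ab.
  rewrite -EFinM -big_split/=; congr EFin; apply: eq_bigr => i _.
  rewrite /lo /hi; case: ltrgt0P (s0 i) => // si _.
    by field; rewrite gt_eqF.
  by field; rewrite lt_eqF.
apply/seteqP; split => x /= H i; have := H i; rewrite mxE /lo /hi;
  case: ltrgt0P (s0 i) => // si _.
- by rewrite ler_pdivrMr// ler_pdivlMr// lerBlDr lerBrDr mulrC.
- by rewrite ler_ndivrMr// ler_ndivlMr// lerBlDr lerBrDr mulrC andbC.
- by rewrite ler_pdivrMr// ler_pdivlMr// lerBlDr lerBrDr mulrC.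
- by rewrite ler_ndivrMr// ler_ndivlMr// lerBlDr lerBrDr mulrC andbC.
Qed.

Definition coord_perm n (s : 'S_n) (x : 'rV[R]_n) : 'rV[R]_n :=
  \row_i x ord0 (s i).

Lemma measurable_coord_perm n (s : 'S_n) :
  measurable_fun setT (coord_perm s).
Proof.
apply/measurable_fun_rVP => i.
rewrite (_ : (fun x => _) = fun x : 'rV[R]_n => x ord0 (s i)).
  exact: measurable_coord.
by apply/funext => x; rewrite mxE.
Qed.

HB.instance Definition _ n (s : 'S_n) :=
  isMeasurableFun.Build _ _ _ _ (coord_perm s)
    (measurable_coord_perm s).

Lemma lebesgue_rV_perm n (s : 'S_n) A : measurable A ->
  lebesgue_rV n A = lebesgue_rV n (coord_perm s @^-1` A).
Proof.
move=> mA.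
apply: (lebesgue_rV_unique (m := pushforward (lebesgue_rV n)
  (coord_perm s))) => // a b ab.
change (lebesgue_rV n (coord_perm s @^-1` box a b) =
  (\prod_(i < n) (b i - a i))%:E)%E.
rewrite (_ : _ @^-1` _ = box (fun i => a ((s^-1)%g i)) (fun i => b ((s^-1)%g i))).
  rewrite lebesgue_rV_box => [|i]; last exact: ab.
  rewrite (reindex_inj (@perm_inj _ s))/=; congr EFin.
  by apply: eq_bigr => i _; rewrite permK.
apply/seteqP; split => x /= H i.
  by have := H ((s^-1)%g i); rewrite mxE permKV.
by have := H (s i); rewrite mxE /= permK.
Qed.

Local Open Scope ereal_scope.

Lemma integral_rV_affine n (s c : 'rV[R]_n) (f : 'rV[R]_n -> \bar R) :
  (forall i, s ord0 i != 0)%R -> measurable_fun setT f -> (forall x, 0 <= f x) ->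
  \int[lebesgue_rV n]_x f x =
  (\prod_(i < n) `|s ord0 i|)%:E * \int[lebesgue_rV n]_x f (diag_affine s c x).
Proof.
move=> s0 mf f0.
have p0 : (0 <= \prod_(i < n) `|s ord0 i|)%R by apply: prodr_ge0.
rewrite (eq_measure_integral (mscale (NngNum p0)
  (pushforward (lebesgue_rV n) (diag_affine s c)))); last first.
  by move=> A mA _; exact: (lebesgue_rV_affine c s0 mA).
rewrite ge0_integral_mscale//; congr (_ * _).
by rewrite ge0_integral_pushforward.
Qed.

Lemma integral_rV_shift n (c : 'rV[R]_n) (f : 'rV[R]_n -> \bar R) :
  measurable_fun setT f -> (forall x, 0 <= f x) ->
  \int[lebesgue_rV n]_x f (x + c)%R = \int[lebesgue_rV n]_x f x.
Proof.
move=> mf f0.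
rewrite [RHS](integral_rV_affine (s := const_mx 1%R) c)//; last first.
  by move=> i; rewrite mxE oner_eq0.
rewrite big1 ?mul1e => [|i _]; last by rewrite mxE normr1.
apply: eq_integral => x _; congr f; apply/rowP => i.
by rewrite !mxE mul1r.
Qed.

End Lebesgue.

(** * Euclidean norm and Lipschitz functions *)

Section Euclid.
Context {R : realType} {n : nat}.
Implicit Types (x y z : 'rV[R]_n) (a b : R).

Definition dotv x y : R := \sum_i x ord0 i * y ord0 i.

Lemma dotvC x y : dotv x y = dotv y x.
Proof. by apply: eq_bigr => i _; rewrite mulrC. Qed.

Lemma dotvDl x y z : dotv (x + y) z = dotv x z + dotv y z.
Proof. by rewrite -big_split; apply: eq_bigr => i _; rewrite !mxE mulrDl. Qed.

Lemma dotvDr x y z : dotv z (x + y) = dotv z x + dotv z y.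
Proof. by rewrite dotvC dotvDl !(dotvC z). Qed.

Lemma dotvZl a x y : dotv (a *: x) y = a * dotv x y.
Proof. by rewrite mulr_sumr; apply: eq_bigr => i _; rewrite !mxE mulrA. Qed.

Lemma dotvZr a x y : dotv x (a *: y) = a * dotv x y.
Proof. by rewrite dotvC dotvZl dotvC. Qed.

Lemma dotvNl x y : dotv (- x) y = - dotv x y.
Proof. by rewrite -scaleN1r dotvZl mulN1r. Qed.

Lemma dotvNr x y : dotv x (- y) = - dotv x y.
Proof. by rewrite dotvC dotvNl dotvC. Qed.

Lemma dotvv_ge0 x : 0 <= dotv x x.
Proof. by apply: sumr_ge0 => i _; rewrite -expr2 sqr_ge0. Qed.

Lemma enorm_ge0 x : 0 <= enorm x.
Proof. exact: sqrtr_ge0. Qed.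

Lemma sqr_enorm x : enorm x ^+ 2 = dotv x x.
Proof.
rewrite sqr_sqrtr; last by apply: sumr_ge0 => i _; exact: sqr_ge0.
by apply: eq_bigr => i _; rewrite expr2.
Qed.

Lemma enormE x : enorm x = Num.sqrt (dotv x x).
Proof. by rewrite -sqr_enorm sqrtr_sqr ger0_norm// enorm_ge0. Qed.

Lemma enormZ a x : enorm (a *: x) = `|a| * enorm x.
Proof.
rewrite !enormE dotvZl dotvZr mulrA -expr2 sqrtrM ?sqr_ge0//.
by rewrite sqrtr_sqr.
Qed.

Lemma enormN x : enorm (- x) = enorm x.
Proof. by rewrite -scaleN1r enormZ normrN1 mul1r. Qed.

Lemma enormBC x y : enorm (x - y) = enorm (y - x).
Proof. by rewrite -enormN opprB. Qed.

Lemma enorm0 : enorm (0 : 'rV[R]_n) = 0.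
Proof. by rewrite -(scale0r 0) enormZ normr0 mul0r. Qed.

Lemma coord_le_enorm x i : `|x ord0 i| <= enorm x.
Proof.
rewrite -sqrtr_sqr ler_wsqrtr// (bigD1 i)//= lerDl sumr_ge0// => j _.
exact: sqr_ge0.
Qed.

Lemma enorm_eq0 x : (enorm x == 0) = (x == 0).
Proof.
apply/eqP/eqP => [x0|->]; last exact: enorm0.
apply/rowP => i; rewrite mxE; apply/eqP.
by rewrite -normr_le0 -x0 coord_le_enorm.
Qed.

Lemma enorm_gt0 x : (0 < enorm x) = (x != 0).
Proof. by rewrite lt_neqAle enorm_ge0 andbT eq_sym enorm_eq0. Qed.

(** Cauchy--Schwarz, from the nonnegative square of (y . y) x - (x . y) y. *)
Lemma sqr_dotv_le x y : dotv x y ^+ 2 <= dotv x x * dotv y y.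
Proof.
have [->|y0] := eqVneq y 0.
  by rewrite -(scale0r 0) !dotvZr !mul0r expr0n mulr0.
have yy : 0 < dotv y y by rewrite -sqr_enorm exprn_gt0// enorm_gt0.
have := dotvv_ge0 (dotv y y *: x - dotv x y *: y).
rewrite !(dotvDl, dotvDr, dotvNl, dotvNr, dotvZl, dotvZr) (dotvC y x).
set p := dotv x x; set q := dotv y y in yy *; set r := dotv x y => H.
have : 0 <= q * (p * q - r ^+ 2) by apply: le_trans H _; lra.
by rewrite pmulr_rge0// subr_ge0.
Qed.

Lemma dotv_le x y : `|dotv x y| <= enorm x * enorm y.
Proof.
rewrite -(@ler_pXn2r _ 2)// ?nnegrE ?mulr_ge0 ?enorm_ge0//.
by rewrite real_normK ?num_real// exprMn !sqr_enorm sqr_dotv_le.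
Qed.

Lemma sqr_enormD x y :
  enorm (x + y) ^+ 2 = enorm x ^+ 2 + 2 * dotv x y + enorm y ^+ 2.
Proof. by rewrite !sqr_enorm !(dotvDl, dotvDr) (dotvC y x); lra. Qed.

Lemma sqr_enormB x y :
  enorm (x - y) ^+ 2 = enorm x ^+ 2 - 2 * dotv x y + enorm y ^+ 2.
Proof. by rewrite sqr_enormD dotvNr enormN mulrN. Qed.

Lemma enormD x y : enorm (x + y) <= enorm x + enorm y.
Proof.
rewrite -(@ler_pXn2r _ 2)// ?nnegrE ?addr_ge0 ?enorm_ge0//.
rewrite sqr_enormD; have := le_trans (ler_norm _) (dotv_le x y); nra.
Qed.

Lemma enormB x y : enorm (x - y) <= enorm x + enorm y.
Proof. by rewrite (le_trans (enormD _ _))// enormN. Qed.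

Lemma enorm_le_sum x : enorm x <= \sum_i `|x ord0 i|.
Proof.
have S0 : 0 <= \sum_i `|x ord0 i| by exact: sumr_ge0.
rewrite -(@ler_pXn2r _ 2)// ?nnegrE ?enorm_ge0// sqr_enorm.
rewrite expr2 mulr_suml; apply: ler_sum => i _.
rewrite (le_trans (ler_norm _))// normrM ler_wpM2l//.
by rewrite (bigD1 i)//= lerDl sumr_ge0.
Qed.

Lemma sphere_proj0 : sphere_proj (0 : 'rV[R]_n) = 0.
Proof. by rewrite /sphere_proj scaler0. Qed.

Lemma enorm_sphere_proj x : x != 0 -> enorm (sphere_proj x) = 1.
Proof.
rewrite -enorm_gt0 => x0.
by rewrite enormZ ger0_norm ?invr_ge0 ?ltW// mulVf// gt_eqF.
Qed.

Lemma enorm_sphere_proj_le1 x : enorm (sphere_proj x) <= 1.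
Proof.
have [->|x0] := eqVneq x 0; first by rewrite sphere_proj0 enorm0 ler01.
by rewrite enorm_sphere_proj.
Qed.

Lemma sphere_projZ a x : 0 < a -> sphere_proj (a *: x) = sphere_proj x.
Proof.
move=> a0; rewrite /sphere_proj enormZ gtr0_norm// scalerA invfM.
by rewrite mulrAC mulVf ?mul1r// gt_eqF.
Qed.

Lemma sphere_projK x : enorm x *: sphere_proj x = x.
Proof.
have [->|x0] := eqVneq x 0; first by rewrite enorm0 scale0r.
by rewrite scalerA mulfV ?scale1r// enorm_eq0.
Qed.

Lemma ratr_approx x (e : R) : 0 < e ->
  exists q : 'rV[rat]_n, enorm (x - map_mx ratr q) < e.
Proof.
move=> e0; pose c : R := e / n.+1%:R.
have c0 : 0 < c by rewrite divr_gt0.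
have H i : exists q : rat, `|x ord0 i - ratr q| < c.
  have [|q] := @rat_in_itvoo R (x ord0 i - c) (x ord0 i + c); first by lra.
  by rewrite in_itv/= => /andP[? ?]; exists q; rewrite ltr_norml; lra.
exists (\row_i sval (cid (H i))).
apply: (le_lt_trans (enorm_le_sum _)).
apply: (@le_lt_trans _ _ (\sum_(i < n) c)).
  apply: ler_sum => i _; rewrite !mxE.
  by case: cid => q /= /ltW.
rewrite sumr_const card_ord -mulr_natr /c -mulrA gtr_pMr//.
by rewrite ltr_pdivrMl// mulr1 ltr_nat.
Qed.

Lemma measurable_rVD d (T : measurableType d) (f g : T -> 'rV[R]_n) :
  measurable_fun setT f -> measurable_fun setT g ->
  measurable_fun setT (fun t => f t + g t).
Proof.
move=> /measurable_fun_rVP mf /measurable_fun_rVP mg.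
apply/measurable_fun_rVP => i.
under eq_fun do rewrite mxE.
exact: measurable_funD.
Qed.

Lemma measurable_rVZ d (T : measurableType d) (f : T -> R) (g : T -> 'rV[R]_n) :
  measurable_fun setT f -> measurable_fun setT g ->
  measurable_fun setT (fun t => f t *: g t).
Proof.
move=> mf /measurable_fun_rVP mg.
apply/measurable_fun_rVP => i.
under eq_fun do rewrite mxE.
exact: measurable_funM.
Qed.

Lemma measurable_rVB d (T : measurableType d) (f g : T -> 'rV[R]_n) :
  measurable_fun setT f -> measurable_fun setT g ->
  measurable_fun setT (fun t => f t - g t).
Proof.
move=> mf mg; rewrite (_ : (fun t => _) = fun t => f t + (-1) *: g t).
  by apply: measurable_rVD => //; apply: measurable_rVZ.
by apply/funext => t; rewrite scaleN1r.
Qed.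

Lemma measurable_dotv d (T : measurableType d) (f g : T -> 'rV[R]_n) :
  measurable_fun setT f -> measurable_fun setT g ->
  measurable_fun setT (fun t => dotv (f t) (g t)).
Proof.
move=> /measurable_fun_rVP mf /measurable_fun_rVP mg.
by apply: measurable_sum => i; exact: measurable_funM.
Qed.

(** The product sigma-algebra is generated by coordinates, so continuity alone
    says nothing about it. The set where f < a is a countable union of
    sublevel sets of cones f q + L |x - q| whose apex q is rational. *)
Lemma lipschitz_measurable (L : R) (f : 'rV[R]_n -> R) : 0 <= L ->
  euclidean_lipschitz L f -> measurable_fun setT f.
Proof.
move=> L0 fL; apply: (measurability _ (RGenInftyO.measurableE R)) => A [B [a ->] <-].
rewrite setTI (_ : _ @^-1` _ = \bigcup_(q in [set: 'rV[rat]_n])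
  [set x | f (map_mx ratr q) + L * enorm (x - map_mx ratr q) < a]).
  apply: countable_bigcupT_measurable => [|q]; first exact: countableP.
  have mg : measurable_fun setT (fun x : 'rV[R]_n =>
      f (map_mx ratr q) + L * enorm (x - map_mx ratr q)).
    apply: measurable_funD => //; apply: measurable_funM => //.
    by apply: (measurableT_comp measurable_enorm); exact: measurable_rVB.
  rewrite (_ : [set _ | _] = setT `&` (fun x : 'rV[R]_n =>
      f (map_mx ratr q) + L * enorm (x - map_mx ratr q)) @^-1` `]-oo, a[).
    by apply: mg => //; exact: measurable_itv.
  by rewrite setTI; apply/seteqP; split => x /=; rewrite in_itv.
apply/seteqP; split => x /=; rewrite in_itv/=.
  move=> fa; have e0 : 0 < (a - f x) / (2 * L + 1).
    by rewrite divr_gt0 ?subr_gt0// ltr_wpDl// mulr_ge0.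
  have [q xq] := ratr_approx x e0; exists q => //=.
  have := fL (map_mx ratr q) x; rewrite enormBC => /(le_trans (ler_norm _)).
  move: xq; rewrite ltr_pdivlMr; last by lra.
  have := enorm_ge0 (x - map_mx ratr q); nra.
move=> [q _ /=]; apply: le_lt_trans.
have := fL x (map_mx ratr q) => /(le_trans (ler_norm _)); lra.
Qed.

End Euclid.

(** * Polar coordinates *)

Section restriction.
Local Open Scope ereal_scope.

Lemma ge0_integral_mrestr d (T : measurableType d) (R : realType)
    (mu : {measure set T -> \bar R}) (D : set T) (mD : measurable D)
    (f : T -> \bar R) : measurable_fun setT f -> (forall x, 0 <= f x) ->
  \int[mrestr mu mD]_x f x = \int[mu]_(x in D) f x.
Proof.
move=> mf f0.
rewrite (@ge0_negligible_integral _ _ _ _ setT (~` D))//; last 2 first.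
- exact: measurableC.
- by change (mu (~` D `&` D) = 0); rewrite setICl measure0.
rewrite setDE setCK setTI; apply: eq_measure_integral => A mA AD.
by change (mu (A `&` D) = mu A); rewrite setIidl.
Qed.

End restriction.

Section sphere.
Context {R : realType} {n : nat}.
Notation lam := (@lebesgue_rV R n).
Notation PB := (@unif_ball R n).
Local Open Scope ereal_scope.

Definition ball_vol : R := fine (lam eball).

Lemma ball_volE : lam eball = ball_vol%:E.
Proof.
have /andP[v0 voo] := @lebesgue_eball R n.
by rewrite fineK// ge0_fin_numE// ltW.
Qed.

Lemma ball_vol_gt0 : (0 < ball_vol)%R.
Proof. by have /andP[] := @lebesgue_eball R n; rewrite ball_volE lte_fin. Qed.

Lemma unif_ball_volE A : PB A = lam (A `&` eball) * (ball_vol^-1)%:E.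
Proof. exact: unif_ballE. Qed.

Lemma integral_unif_ball (f : 'rV[R]_n -> \bar R) :
  measurable_fun setT f -> (forall x, 0 <= f x) ->
  \int[PB]_x f x = (ball_vol^-1)%:E * \int[lam]_(x in eball) f x.
Proof.
move=> mf f0.
have v0 : (0 <= ball_vol^-1)%R by rewrite invr_ge0 ltW// ball_vol_gt0.
rewrite (eq_measure_integral
  (mscale (NngNum v0) (mrestr lam (@measurable_eball R n)))); last first.
  by move=> A mA _; exact: etrans (unif_ball_volE A) (muleC _ _).
by rewrite ge0_integral_mscale// ge0_integral_mrestr.
Qed.

(** Flips of signs and permutations of coordinates are all the isometries that
    the moments of order one and two require. *)
Lemma unif_ball_invariant (T : {mfun 'rV[R]_n >-> 'rV[R]_n}) :
  (forall A, measurable A -> lam (T @^-1` A) = lam A) ->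
  (forall x, enorm (T x) = enorm x) ->
  forall A, measurable A -> PB (T @^-1` A) = PB A.
Proof.
move=> lT nT A mA; rewrite !unif_ball_volE; congr (_ * _).
rewrite -[RHS]lT; last by apply: measurableI => //; exact: measurable_eball.
by congr (lam _); apply/seteqP; split => x; rewrite /eball/= nT.
Qed.

Lemma integral_unif_ball_invariant (T : {mfun 'rV[R]_n >-> 'rV[R]_n})
    (f : 'rV[R]_n -> R) :
  (forall A, measurable A -> PB (T @^-1` A) = PB A) ->
  measurable_fun setT f -> (exists M, forall x, `|f x| <= M)%R ->
  \int[PB]_x (f (T x))%:E = \int[PB]_x (f x)%:E.
Proof.
move=> iT mf [M fM].
rewrite [RHS](eq_measure_integral (pushforward PB T)); last first.
  by move=> A mA _; exact/esym/iT.
rewrite integral_pushforward//; first exact/measurable_EFinP.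
rewrite preimage_setT; apply: (@measurable_bounded_integrable _ _ _ PB).
- by [].
- by rewrite (le_lt_trans (probability_le1 _ _))// ltry.
- exact: measurableT_comp.
- by exists M; split => [|M' MM' x _ /=];
  [exact: num_real|exact: le_trans (fM _) (ltW MM')].
Qed.

Definition flip_coord (i : 'I_n) : 'rV[R]_n :=
  (\row_j (if j == i then -1 else 1))%R.

Lemma flip_coordE i x j :
  (diag_affine (flip_coord i) 0 x ord0 j =
    if j == i then - x ord0 j else x ord0 j)%R.
Proof. by rewrite !mxE addr0; case: eqP; rewrite ?mulN1r ?mul1r. Qed.

Lemma enorm_flip_coord i x : enorm (diag_affine (flip_coord i) 0%R x) = enorm x.
Proof.
rewrite /enorm; congr Num.sqrt; apply: eq_bigr => j _.
by rewrite flip_coordE; case: ifP; rewrite ?sqrrN.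
Qed.

Lemma unif_ball_flip i A : measurable A ->
  PB (diag_affine (flip_coord i) 0 @^-1` A) = PB A.
Proof.
apply: unif_ball_invariant => [B mB|x]; last exact: enorm_flip_coord.
rewrite [RHS](@lebesgue_rV_affine _ _ (flip_coord i) 0)//; last first.
  by move=> j; rewrite mxE; case: ifP; rewrite ?oppr_eq0 oner_eq0.
rewrite big1 ?mul1e// => j _.
by rewrite mxE; case: ifP; rewrite ?normrN normr1.
Qed.

Lemma unif_ball_perm (s : 'S_n) A : measurable A ->
  PB (coord_perm s @^-1` A) = PB A.
Proof.
apply: unif_ball_invariant => [B mB|x]; first exact/esym/lebesgue_rV_perm.
rewrite /enorm; congr Num.sqrt; rewrite [RHS](reindex_inj (@perm_inj _ s))/=.
by apply: eq_bigr => j _; rewrite mxE.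
Qed.

Lemma unif_sphereE A : unif_sphere A = PB (sphere_proj @^-1` A).
Proof. by []. Qed.

Lemma lebesgue_scale (r : R) A : (r != 0)%R -> measurable A ->
  lam A = (`|r| ^+ n)%:E * lam [set x | A (r *: x)%R].
Proof.
move=> r0 mA; rewrite (@lebesgue_rV_affine _ _ (const_mx r) 0)//; last first.
  by move=> i; rewrite mxE.
congr (_ * _).
  by under eq_bigr do rewrite mxE; rewrite prodr_const card_ord.
congr (lam _); apply/seteqP; split => x /=; rewrite (_ : diag_affine _ _ _ = r *: x)%R//;
  by apply/rowP => i; rewrite !mxE addr0.
Qed.

Lemma lebesgue_origin : (0 < n)%N -> lam [set 0%R] = 0.
Proof.
move=> n0; have := @lebesgue_rV_box R n (fun=> 0%R) (fun=> 0%R) (fun=> lexx _).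
rewrite (_ : box _ _ = [set 0%R]); last first.
  apply/seteqP; split => [x H|x -> i]; last by rewrite mxE lexx.
  by apply/rowP => i; rewrite mxE; apply/eqP; rewrite eq_le andbC; exact: H.
move=> ->; rewrite prodr_const card_ord subrr expr0n.
by case: (n) n0.
Qed.

Lemma measurable_rball (r : R) : measurable [set x : 'rV[R]_n | (enorm x <= r)%R].
Proof.
rewrite (_ : [set _ | _] = setT `&` (@enorm R n) @^-1` `]-oo, r]).
  by apply: measurable_enorm => //; exact: measurable_itv.
by rewrite setTI; apply/seteqP; split => x /=; rewrite in_itv.
Qed.

Lemma measurable_sphere_preimage (C : set 'rV[R]_n) : measurable C ->
  measurable (sphere_proj @^-1` C).
Proof. by move=> mC; rewrite -[X in measurable X]setTI; exact: measurable_sphere_proj. Qed.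

(** Radius and direction are independent: the ball of radius r is the image of
    the unit ball under a scaling, which keeps directions. For r <= 0 both
    sides vanish, because the origin is a null set. *)
Lemma lebesgue_cone (r : R) (C : set 'rV[R]_n) : (0 < n)%N -> measurable C ->
  lam ([set x | (enorm x <= r)%R] `&` sphere_proj @^-1` C) =
  lam [set x | (enorm x <= r)%R] * PB (sphere_proj @^-1` C).
Proof.
move=> n0 mC; have mC' := measurable_sphere_preimage mC.
have mr := measurable_rball r.
have [r0|r0] := leP r 0%R.
  have H0 : lam [set x | (enorm x <= r)%R] = 0.
    apply/eqP; rewrite eq_le measure_ge0 andbT -(lebesgue_origin n0).
    apply: le_measure; rewrite ?inE//.
      rewrite (_ : [set 0%R] = box (fun=> 0%R) (fun=> 0%R)); first exact: measurable_box.
      apply/seteqP; split => [x -> i|x H]; first by rewrite mxE lexx.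
      by apply/rowP => i; rewrite mxE; apply/eqP; rewrite eq_le andbC; exact: H.
    move=> x /= xr; apply/eqP; rewrite -enorm_eq0 eq_le enorm_ge0 andbT.
    exact: le_trans r0.
  rewrite H0 mul0e; apply/eqP; rewrite eq_le measure_ge0 andbT -H0.
  by apply: le_measure; rewrite ?inE//; exact: measurableI.
have r1 x : ((enorm (r *: x) <= r) = (enorm x <= 1))%R.
  by rewrite enormZ gtr0_norm// ger_pMr.
rewrite (lebesgue_scale (r := r))//; last 2 first.
  by rewrite gt_eqF.
  exact: measurableI.
rewrite [X in _ = X * _](lebesgue_scale (r := r))//; last by rewrite gt_eqF.
rewrite -muleA; congr (_ * _).
have E : [set x : 'rV[R]_n | [set y | (enorm y <= r)%R] (r *: x)%R] = eball.
  by apply/seteqP; split => x /=; rewrite r1.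
rewrite E unif_ball_volE.
rewrite ball_volE muleCA -EFinM mulfV ?mule1 ?gt_eqF ?ball_vol_gt0//.
congr (lam _); apply/seteqP; split => x /=; rewrite r1 sphere_projZ//.
  by case.
by case.
Qed.

(** Polar coordinates without a formula for the law of the radius: the
    direction of x may be replaced by that of an independent point of the
    ball. Products of a half-line and a set of directions are stable under
    intersection, and for them this is lebesgue_cone. *)
Lemma integral_polar (Phi : R * 'rV[R]_n -> \bar R) : (0 < n)%N ->
  measurable_fun setT Phi -> (forall p, 0 <= Phi p) ->
  \int[lam]_x Phi (enorm x, sphere_proj x) =
  \int[lam]_x \int[PB]_y Phi (enorm x, sphere_proj y).
Proof.
move=> n0 mPhi Phi0.
pose T1 (x : 'rV[R]_n) := (enorm x, sphere_proj x).
have mT1 : measurable_fun setT T1.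
  by apply: measurable_fun_pair; [exact: measurable_enorm|exact: measurable_sphere_proj].
pose T1m : {mfun 'rV[R]_n >-> (R * 'rV[R]_n)%type} :=
  HB.pack T1 (isMeasurableFun.Build _ _ _ _ T1 mT1).
pose T2 (p : 'rV[R]_n * 'rV[R]_n) := (enorm p.1, sphere_proj p.2).
have mT2 : measurable_fun setT T2.
  apply: measurable_fun_pair.
    exact: (measurableT_comp measurable_enorm measurable_fst).
  exact: (measurableT_comp measurable_sphere_proj measurable_snd).
pose T2m : {mfun ('rV[R]_n * 'rV[R]_n)%type >-> (R * 'rV[R]_n)%type} :=
  HB.pack T2 (isMeasurableFun.Build _ _ _ _ T2 mT2).
transitivity (\int[lam \x PB]_p Phi (T2 p)); last first.
  rewrite fubini_tonelli1//; exact: measurableT_comp.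
transitivity (\int[pushforward lam T1m]_p Phi p).
  by rewrite ge0_integral_pushforward.
transitivity (\int[pushforward (lam \x PB) T2m]_p Phi p); last first.
  by rewrite ge0_integral_pushforward.
apply: eq_measure_integral => A mA _.
pose G := [set A | exists r C, measurable C /\ A = `]-oo, r]%classic `*` C
  :> set (R * 'rV[R]_n)].
have mball r : lam [set x | (enorm x <= r)%R] < +oo.
  apply: (@le_lt_trans _ _ (lam (box (fun=> - r)%R (fun=> r)))).
    apply: le_measure; rewrite ?inE; [exact: measurable_rball|exact: measurable_box|].
    by move=> x /= xr i; rewrite -ler_norml (le_trans (coord_le_enorm _ _)).
  have [r0|r0] := leP 0%R r.
    by rewrite lebesgue_rV_box ?ltry// => i; lra.
  rewrite (_ : box _ _ = set0) ?measure0//; apply/seteqP; split => // x.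
  move=> /(_ (Ordinal n0)); lra.
apply: (measure_unique G (fun k => `]-oo, k%:R]%classic `*` setT)) => //.
- apply/seteqP; split; last first.
    apply: smallest_sub; first exact: sigma_algebra_measurable.
    by move=> B [r [C [mC ->]]]; apply: measurableX.
  have mG : forall r C, measurable C -> <<s G >> (`]-oo, r]%classic `*` C).
    by move=> r C mC; apply: sub_sigma_algebra; exists r, C.
  apply: smallest_sub; first exact: smallest_sigma_algebra.
  rewrite subUset; split => B [C mC <-].
    have : measurable_fun setT (fun p : g_sigma_algebraType G => p.1 : R).
      apply: (measurability _ (RGenOInfty.measurableE R)) => D [E [a ->] <-].
      rewrite setTI (_ : _ @^-1` _ = ~` (`]-oo, a]%classic `*` setT)).
        by apply: measurableC; exact: mG.
      apply/seteqP; split => -[x y] /=; rewrite !in_itv/= andbT ltNge.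
        by move=> /negP H [].
      by move=> H; apply/negP => ?; apply: H.
    by move=> /(_ measurableT _ mC).
  have : measurable_fun setT (fun p : g_sigma_algebraType G => p.2 : 'rV[R]_n).
    move=> _ D mD; rewrite setTI.
    rewrite (_ : _ @^-1` _ = \bigcup_k (`]-oo, k%:R]%classic `*` D)).
      by apply: bigcupT_measurable => k; exact: mG.
    apply/seteqP; split => [[x y] /= Dy|[x y] /= [k _ []]//].
    exists (Num.trunc x).+1 => //; split => //=.
    by rewrite in_itv/= ltW// truncnS_gt.
  by move=> /(_ measurableT _ mC).
- move=> A1 A2 [r [C [mC ->]]] [r' [C' [mC' ->]]].
  exists (Num.min r r'), (C `&` C'); split; first exact: measurableI.
  rewrite -setXI; congr (_ `*` _); apply/seteqP; split => x /=; rewrite !in_itv/= le_min.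
    by case=> -> ->.
  by case/andP.
- by move=> k; exists k%:R, setT.
- apply/seteqP; split => // -[x y] _.
  exists (Num.trunc x).+1 => //; split => //=.
  by rewrite in_itv/= ltW// truncnS_gt.
- move=> A1 [r [C [mC ->]]].
  transitivity (lam ([set x | (enorm x <= r)%R] `&` sphere_proj @^-1` C)).
    by congr (lam _); apply/seteqP; split => x; rewrite /= in_itv/=.
  rewrite lebesgue_cone//.
  transitivity ((lam \x PB) ([set x | (enorm x <= r)%R] `*` (sphere_proj @^-1` C))).
    rewrite product_measure1E//; first exact: measurable_rball.
    exact: measurable_sphere_preimage.
  by congr ((lam \x PB) _); apply/seteqP; split => x; rewrite /= in_itv/=.
- move=> k; apply: (eq_ind _ (fun e => e < +oo) (mball k%:R)).
  by congr (lam _); apply/seteqP; split => x; rewrite /= in_itv/=; [|case].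
Qed.

End sphere.

(** * Integrals of bounded functions *)

Section bounded.
Context {d} {T : measurableType d} {R : realType}.
Implicit Types f g : T -> R.

(** A class of functions that are integrable for every finite measure and
    stable under all operations used below, which spares most integrability
    side conditions. *)
Definition bmeas f := measurable_fun setT f /\ exists M, forall x, `|f x| <= M.

Lemma bmeas_cst (c : R) : bmeas (fun=> c).
Proof. by split; [exact: measurable_cst|exists `|c|]. Qed.

Lemma bmeasD f g : bmeas f -> bmeas g -> bmeas (fun x => f x + g x).
Proof.
move=> [mf [M fM]] [mg [N gN]]; split; first exact: measurable_funD.
by exists (M + N) => x; rewrite (le_trans (ler_normD _ _))// lerD.
Qed.

Lemma bmeasM f g : bmeas f -> bmeas g -> bmeas (fun x => f x * g x).
Proof.
move=> [mf [M fM]] [mg [N gN]]; split; first exact: measurable_funM.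
by exists (M * N) => x; rewrite normrM ler_pM.
Qed.

Lemma bmeasN f : bmeas f -> bmeas (fun x => - f x).
Proof.
move=> bf; have := bmeasM (bmeas_cst (-1)) bf.
by congr bmeas; apply/funext => x; rewrite mulN1r.
Qed.

Lemma bmeasB f g : bmeas f -> bmeas g -> bmeas (fun x => f x - g x).
Proof. by move=> bf bg; apply: bmeasD => //; exact: bmeasN. Qed.

Lemma bmeasX f k : bmeas f -> bmeas (fun x => f x ^+ k).
Proof.
move=> [mf [M fM]]; split; first exact: measurable_funX.
by exists (M ^+ k) => x; rewrite normrX lerXn2r ?nnegrE// (le_trans _ (fM x)).
Qed.

Lemma bmeas_sum I (s : seq I) (f : I -> T -> R) : (forall i, bmeas (f i)) ->
  bmeas (fun x => \sum_(i <- s) f i x).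
Proof.
move=> bf; elim: s => [|i s IH].
  by under eq_fun do rewrite big_nil; exact: bmeas_cst.
by under eq_fun do rewrite big_cons; exact: bmeasD.
Qed.

Lemma bmeas_norm f : bmeas f -> bmeas (fun x => `|f x|).
Proof.
move=> [mf [M fM]]; split; first exact: measurableT_comp.
by exists M => x; rewrite normr_id.
Qed.

Lemma bmeas_integrable (mu : {measure set T -> \bar R}) f :
  (mu setT < +oo)%E -> bmeas f -> mu.-integrable setT (EFin \o f).
Proof.
move=> mu_fin [mf [M fM]]; apply: measurable_bounded_integrable => //.
by exists M; split => [|M' MM' x _ /=];
  [exact: num_real|exact: le_trans (fM _) (ltW MM')].
Qed.

Section finite.
Variables (mu : {measure set T -> \bar R}) (mu_fin : (mu setT < +oo)%E).

Lemma bmeas_EFin_fint f : bmeas f ->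
  (\int[mu]_x (f x)%:E)%E = (\int[mu]_x f x)%:E.
Proof.
by move=> bf; rewrite fineK//; apply: integrable_fin_num => //;
  exact: bmeas_integrable.
Qed.

Lemma bmeas_fintD f g : bmeas f -> bmeas g ->
  \int[mu]_x (f x + g x) = \int[mu]_x f x + \int[mu]_x g x.
Proof. by move=> bf bg; rewrite RintegralD//; exact: bmeas_integrable. Qed.

Lemma bmeas_fintB f g : bmeas f -> bmeas g ->
  \int[mu]_x (f x - g x) = \int[mu]_x f x - \int[mu]_x g x.
Proof. by move=> bf bg; rewrite RintegralB//; exact: bmeas_integrable. Qed.

Lemma bmeas_fintZ c f : bmeas f ->
  \int[mu]_x (c * f x) = c * \int[mu]_x f x.
Proof. by move=> bf; rewrite RintegralZl//; exact: bmeas_integrable. Qed.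

Lemma bmeas_fint_sum I (s : seq I) (f : I -> T -> R) :
  (forall i, bmeas (f i)) ->
  \int[mu]_x (\sum_(i <- s) f i x) = \sum_(i <- s) \int[mu]_x f i x.
Proof.
move=> bf; elim: s => [|i s IH].
  under eq_Rintegral do rewrite big_nil.
  by rewrite Rintegral_cst// mul0r big_nil.
under eq_Rintegral do rewrite big_cons.
by rewrite bmeas_fintD ?IH ?big_cons//; exact: bmeas_sum.
Qed.

Lemma bmeas_fint_le f g : bmeas f -> bmeas g -> (forall x, f x <= g x) ->
  \int[mu]_x f x <= \int[mu]_x g x.
Proof. by move=> bf bg fg; apply: le_Rintegral => //; exact: bmeas_integrable. Qed.

Lemma bmeas_fint_norm_le f g : bmeas f -> bmeas g -> (forall x, `|f x| <= g x) ->
  `|\int[mu]_x f x| <= \int[mu]_x g x.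
Proof.
move=> bf bg fg; apply: (le_trans (le_normr_Rintegral _ (bmeas_integrable mu_fin bf))) => //.
by apply: bmeas_fint_le => //; exact: bmeas_norm.
Qed.

End finite.

Section probability.
Variable P : probability T R.

Lemma probability_lty : (P setT < +oo)%E.
Proof. by rewrite (le_lt_trans (probability_le1 _ _))// ltry. Qed.

Lemma bmeas_EFin_Rintegral f : bmeas f ->
  (\int[P]_x (f x)%:E)%E = (\int[P]_x f x)%:E.
Proof. exact: (bmeas_EFin_fint probability_lty). Qed.

Lemma bmeas_RintegralD f g : bmeas f -> bmeas g ->
  \int[P]_x (f x + g x) = \int[P]_x f x + \int[P]_x g x.
Proof. exact: (bmeas_fintD probability_lty). Qed.

Lemma bmeas_RintegralB f g : bmeas f -> bmeas g ->
  \int[P]_x (f x - g x) = \int[P]_x f x - \int[P]_x g x.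
Proof. exact: (bmeas_fintB probability_lty). Qed.

Lemma bmeas_RintegralZ c f : bmeas f ->
  \int[P]_x (c * f x) = c * \int[P]_x f x.
Proof. exact: (bmeas_fintZ probability_lty). Qed.

Lemma bmeas_Rintegral_sum I (s : seq I) (f : I -> T -> R) :
  (forall i, bmeas (f i)) ->
  \int[P]_x (\sum_(i <- s) f i x) = \sum_(i <- s) \int[P]_x f i x.
Proof. exact: (bmeas_fint_sum probability_lty). Qed.

Lemma Rintegral_prob_cst c : \int[P]_x c = c.
Proof.
rewrite Rintegral_cst// [X in fine X](_ : _ = 1%E) ?mulr1//.
exact: probability_setT.
Qed.

Lemma bmeas_le_Rintegral f g : bmeas f -> bmeas g -> (forall x, f x <= g x) ->
  \int[P]_x f x <= \int[P]_x g x.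
Proof. exact: (bmeas_fint_le probability_lty). Qed.

Lemma bmeas_norm_Rintegral_le f M : bmeas f -> (forall x, `|f x| <= M) ->
  `|\int[P]_x f x| <= M.
Proof.
move=> bf fM; rewrite -[leRHS]Rintegral_prob_cst.
by apply: (bmeas_fint_norm_le probability_lty) => //; exact: bmeas_cst.
Qed.

End probability.
End bounded.

(** * Moments of a uniform direction *)

Section moments.
Context {R : realType} {n : nat}.
Notation PB := (@unif_ball R n).

Lemma bmeas_sphere_coord i : bmeas (fun y : 'rV[R]_n => sphere_proj y ord0 i).
Proof.
split.
  exact: (measurableT_comp (measurable_coord (T := R) i) measurable_sphere_proj).
exists 1 => y; exact: le_trans (coord_le_enorm _ _) (enorm_sphere_proj_le1 _).
Qed.

Lemma bmeas_sphere_dotv a : bmeas (fun y : 'rV[R]_n => dotv a (sphere_proj y)).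
Proof.
by apply: bmeas_sum => i; apply: bmeasM; [exact: bmeas_cst|exact: bmeas_sphere_coord].
Qed.

Lemma sphere_proj_flip_coord i (x : 'rV[R]_n) j :
  sphere_proj (diag_affine (flip_coord i) 0 x) ord0 j =
  if j == i then - sphere_proj x ord0 j else sphere_proj x ord0 j.
Proof.
rewrite /sphere_proj enorm_flip_coord mxE flip_coordE [in RHS]mxE.
by case: ifP => _; rewrite ?mulrN.
Qed.

Lemma enorm_coord_perm s (x : 'rV[R]_n) : enorm (coord_perm s x) = enorm x.
Proof.
rewrite /enorm; congr Num.sqrt; rewrite [RHS](reindex_inj (@perm_inj _ s))/=.
by apply: eq_bigr => j _; rewrite mxE.
Qed.

Lemma sphere_proj_coord_perm s (x : 'rV[R]_n) j :
  sphere_proj (coord_perm s x) ord0 j = sphere_proj x ord0 (s j).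
Proof. by rewrite /sphere_proj enorm_coord_perm !mxE. Qed.

Lemma Rintegral_unif_ball_invariant (T : {mfun 'rV[R]_n >-> 'rV[R]_n})
    (f : 'rV[R]_n -> R) :
  (forall A, measurable A -> PB (T @^-1` A) = PB A) -> bmeas f ->
  \int[PB]_x f (T x) = \int[PB]_x f x.
Proof.
by move=> iT [mf bf]; congr fine; exact: integral_unif_ball_invariant.
Qed.

Lemma sphere_mean i : \int[PB]_y sphere_proj y ord0 i = 0.
Proof.
have b := bmeas_sphere_coord i.
have := Rintegral_unif_ball_invariant (unif_ball_flip i) b.
under eq_Rintegral do rewrite sphere_proj_flip_coord eqxx -mulN1r.
rewrite bmeas_RintegralZ//; lra.
Qed.

Lemma sphere_uncorrelated i j : i != j ->
  \int[PB]_y (sphere_proj y ord0 i * sphere_proj y ord0 j) = 0.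
Proof.
move=> ij.
have b := bmeasM (bmeas_sphere_coord i) (bmeas_sphere_coord j).
have := Rintegral_unif_ball_invariant (unif_ball_flip i) b.
under eq_Rintegral do
  rewrite !sphere_proj_flip_coord eqxx [j == i]eq_sym (negPf ij) mulNr -mulN1r.
rewrite bmeas_RintegralZ//; lra.
Qed.

Lemma sphere_second_moment_eq i j :
  \int[PB]_y (sphere_proj y ord0 i ^+ 2) = \int[PB]_y (sphere_proj y ord0 j ^+ 2).
Proof.
have b := bmeasX 2 (bmeas_sphere_coord j).
have := Rintegral_unif_ball_invariant (unif_ball_perm (tperm i j)) b.
by under eq_Rintegral do rewrite sphere_proj_coord_perm tpermR.
Qed.

Lemma sphere_second_moment_le i :
  \int[PB]_y (sphere_proj y ord0 i ^+ 2) <= n%:R^-1.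
Proof.
have n0 : (0 < n%:R :> R) by rewrite ltr0n; apply: leq_ltn_trans (ltn_ord i).
rewrite -[leRHS]mul1r ler_pdivlMr//.
have -> : \int[PB]_y (sphere_proj y ord0 i ^+ 2) * n%:R =
    \sum_(j < n) \int[PB]_y (sphere_proj y ord0 j ^+ 2).
  rewrite (eq_bigr (fun=> \int[PB]_y (sphere_proj y ord0 i ^+ 2))).
    by rewrite sumr_const card_ord mulr_natr.
  by move=> j _; exact: sphere_second_moment_eq.
rewrite -bmeas_Rintegral_sum => [|j]; last exact/bmeasX/bmeas_sphere_coord.
rewrite -[leRHS](Rintegral_prob_cst PB); apply: bmeas_le_Rintegral.
- by apply: bmeas_sum => j; exact/bmeasX/bmeas_sphere_coord.
- exact: bmeas_cst.
- move=> y.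
  have -> : \sum_(j < n) sphere_proj y ord0 j ^+ 2 = enorm (sphere_proj y) ^+ 2.
    by rewrite sqr_enorm; apply: eq_bigr => j _; rewrite expr2.
  by rewrite exprn_ile1 ?enorm_ge0 ?enorm_sphere_proj_le1.
Qed.

(** Sign flips make the coordinates uncorrelated and permutations give them
    the same second moment, at most 1 / n as their squares add up to at most
    1. The inequality allows for the vector 0, whose direction is 0. *)
Lemma sphere_isotropic a :
  \int[PB]_y (dotv a (sphere_proj y) ^+ 2) <= enorm a ^+ 2 / n%:R.
Proof.
pose u (y : 'rV[R]_n) i := sphere_proj y ord0 i.
have bu i : bmeas (u ^~ i) by exact: bmeas_sphere_coord.
rewrite (_ : (fun y => _) = fun y => \sum_i \sum_j
    (a ord0 i * a ord0 j) * (u y i * u y j)); last first.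
  apply/funext => y; rewrite expr2 mulr_suml; apply: eq_bigr => i _.
  by rewrite mulr_sumr; apply: eq_bigr => j _; rewrite /u; ring.
have buu i j : bmeas (fun y => u y i * u y j) by exact: bmeasM.
have bauu i j : bmeas (fun y => (a ord0 i * a ord0 j) * (u y i * u y j)).
  by apply: bmeasM => //; exact: bmeas_cst.
rewrite bmeas_Rintegral_sum => [|i]; last exact: bmeas_sum.
rewrite sqr_enorm mulr_suml; apply: ler_sum => i _.
rewrite bmeas_Rintegral_sum// (bigD1 i)//= big1 ?addr0 => [|j ji]; last first.
  by rewrite bmeas_RintegralZ// sphere_uncorrelated ?mulr0// eq_sym.
rewrite bmeas_RintegralZ// ler_wpM2l -?expr2 ?sqr_ge0//.
by under eq_Rintegral do rewrite -expr2; exact: sphere_second_moment_le.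
Qed.

End moments.

(** * Translated balls and star-shaped regions *)

Lemma measurable_le_set d (T : measurableType d) (R : realType) (f g : T -> R) :
  measurable_fun setT f -> measurable_fun setT g ->
  measurable [set x | f x <= g x].
Proof.
move=> mf mg.
rewrite (_ : [set x | _] = setT `&` (fun x => g x - f x) @^-1` `[0, +oo[).
  by apply: measurable_funB.
by rewrite setTI; apply/seteqP; split => x /=; rewrite in_itv/= andbT subr_ge0.
Qed.

Lemma bmeas_indic d (T : measurableType d) (R : realType) (A : set T) :
  measurable A -> bmeas (\1_A : T -> R).
Proof.
move=> mA; split; first exact: measurable_indic.
by exists 1 => x; rewrite indicE; case: (_ \in _); rewrite ?normr1 ?normr0 ?ler01.
Qed.

Lemma bmeas_comp d d' (T : measurableType d) (T' : measurableType d')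
    (R : realType) (f : T' -> R) (g : T -> T') :
  bmeas f -> measurable_fun setT g -> bmeas (fun x => f (g x)).
Proof.
by move=> [mf [M fM]] mg; split; [exact: measurableT_comp|exists M].
Qed.

Section powers.
Context {R : realType}.

Lemma lerX_sub (n : nat) (a b : R) : 0 <= b -> b <= a -> a <= 2 ->
  a ^+ n - b ^+ n <= n%:R * 2 ^+ n * (a - b).
Proof.
move=> b0 ba a2; have a0 := le_trans b0 ba.
elim: n => [|n IH]; first by rewrite !expr0 subrr !mul0r.
have bn : b ^+ n <= 2 ^+ n by rewrite lerXn2r ?nnegrE// (le_trans ba).
have -> : a ^+ n.+1 - b ^+ n.+1 = a * (a ^+ n - b ^+ n) + (a - b) * b ^+ n.
  by rewrite !exprS; ring.
have p0 : 0 <= 2 ^+ n :> R by rewrite exprn_ge0.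
have : a * (a ^+ n - b ^+ n) <= 2 * (n%:R * 2 ^+ n * (a - b)).
  by rewrite ler_pM// subr_ge0 lerXn2r ?nnegrE.
have : (a - b) * b ^+ n <= (a - b) * 2 ^+ n by rewrite ler_wpM2l// subr_ge0.
have : 0 <= (a - b) * 2 ^+ n by rewrite mulr_ge0// subr_ge0.
rewrite -natr1 exprS; lra.
Qed.

Lemma expr1D_taylor (n : nat) (t : R) : `|t| <= 1 ->
  `|(1 + t) ^+ n - 1 - n%:R * t| <= 4 ^+ n * t ^+ 2.
Proof.
move=> t1; have t2 := sqr_ge0 t.
elim: n => [|n IH]; first by rewrite !expr0 subrr mul0r subrr normr0 mul1r.
have -> : (1 + t) ^+ n.+1 - 1 - n.+1%:R * t =
  (1 + t) * ((1 + t) ^+ n - 1 - n%:R * t) + n%:R * t ^+ 2.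
  by rewrite exprS -natr1; ring.
rewrite (le_trans (ler_normD _ _))// normrM [X in _ + X]ger0_norm; last by rewrite mulr_ge0 ?sqr_ge0.
have n4 : n%:R <= 4 ^+ n :> R.
  by rewrite -natrX ler_nat ltnW// ltn_expl.
have : `|1 + t| <= 2 by rewrite (le_trans (ler_normD _ _))// normr1; lra.
move=> H; have : `|1 + t| * `|(1 + t) ^+ n - 1 - n%:R * t| <= 2 * (4 ^+ n * t ^+ 2).
  by rewrite ler_pM.
have : n%:R * t ^+ 2 <= 4 ^+ n * t ^+ 2 by rewrite ler_wpM2r.
have : 0 <= 4 ^+ n * t ^+ 2 by rewrite mulr_ge0// exprn_ge0.
by rewrite [4 ^+ n.+1]exprS; lra.
Qed.

End powers.

Section clip.
Context {R : realType} {n : nat}.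
Notation lam := (@lebesgue_rV R n).
Notation PB := (@unif_ball R n).

(** The identity for the uniform law of the ball, but bounded everywhere,
    which makes f (x + delta bclip y) a bounded function of y. *)
Definition bclip (y : 'rV[R]_n) : 'rV[R]_n := if enorm y <= 1 then y else 0.

Lemma enorm_bclip y : enorm (bclip y) <= 1.
Proof. by rewrite /bclip; case: ifP => // _; rewrite enorm0 ler01. Qed.

Lemma indic_eball (y : 'rV[R]_n) : \1_eball y = ((enorm y <= 1)%R)%:R :> R.
Proof.
rewrite indicE; congr ((_ : bool)%:R).
by apply/idP/idP => [/set_mem|/mem_set].
Qed.

Lemma measurable_bclip : measurable_fun setT bclip.
Proof.
have E : bclip = fun y => (\1_eball y : R) *: y.
  apply/funext => y; rewrite indic_eball /bclip.
  by case: ifP; rewrite ?scale1r ?scale0r.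
rewrite E; apply: (measurable_rVZ (g := id)); last exact: measurable_id.
apply: measurable_indic; exact: measurable_eball.
Qed.

Lemma integral_bclip (g : 'rV[R]_n -> \bar R) : measurable_fun setT g ->
  (\int[PB]_y g y = \int[PB]_y g (bclip y))%E.
Proof.
move=> mg; apply: ae_eq_integral => //.
  exact: (measurableT_comp mg measurable_bclip).
exists (~` eball); split.
- by apply: measurableC; exact: measurable_eball.
- by rewrite [LHS](unif_ball_volE) setICl measure0 mul0e.
- move=> y /= H B; apply: H => _; rewrite /bclip.
  by move: B; rewrite /eball/= => ->.
Qed.

Lemma lebesgue_rball (r : R) : (0 < n)%N -> 0 <= r ->
  lam [set x | enorm x <= r] = (r ^+ n * ball_vol (R := R) (n := n))%:E.
Proof.
move=> n0; rewrite le_eqVlt => /predU1P[<-|r0].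
  rewrite expr0n gtn_eqF// mul0r (_ : [set x | _] = [set 0]).
    exact: lebesgue_origin.
  apply/seteqP; split => x /=; last by move=> ->; rewrite enorm0.
  by move=> H; apply/eqP; rewrite -enorm_eq0 eq_le H enorm_ge0.
rewrite (lebesgue_scale (r := r)) ?gt_eqF//; last exact: measurable_rball.
rewrite gtr0_norm// EFinM; congr (_ * _)%E; rewrite -ball_volE.
congr (lam _); apply/seteqP; split => x /=;
  by rewrite /eball/= enormZ gtr0_norm// ger_pMr.
Qed.

(** A finite measure that contains all the regions to be compared: balls with
    centre in the ball of radius 1 and star-shaped regions close to the unit
    ball. *)
Definition lebesgue_rball2 := mrestr lam (@measurable_rball R n 2).

Hypothesis n0 : (0 < n)%N.

Lemma lebesgue_rball2_fin : (lebesgue_rball2 setT < +oo)%E.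
Proof.
change (lam (setT `&` [set x | (enorm x <= 2)%R]) < +oo)%E.
by rewrite setTI lebesgue_rball// ltry.
Qed.

Lemma integral_rball2 (f : 'rV[R]_n -> R) : bmeas f -> (forall x, 0 <= f x) ->
  (forall x, 2 < enorm x -> f x = 0) ->
  (\int[lam]_x (f x)%:E = (\int[lebesgue_rball2]_x f x)%R%:E)%E.
Proof.
move=> bf f0 f2; rewrite -(bmeas_EFin_fint lebesgue_rball2_fin bf).
rewrite ge0_integral_mrestr//; last first.
  by case: bf => mf _; exact/measurable_EFinP.
rewrite [RHS]integral_mkcond; apply: eq_integral => x _.
rewrite patchE; case: ifPn => // /negP H.
by rewrite f2// ltNge; apply/negP => x2; apply: H; rewrite inE.
Qed.

(** A star-shaped region in polar coordinates: in the direction y it is a ball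
    of radius rho y, of volume rho y ^ n. *)
Lemma integral_star (k rho : 'rV[R]_n -> R) : bmeas k -> (forall x, 0 <= k x) ->
  measurable_fun setT rho -> (forall y, 0 <= rho (sphere_proj y) <= 2) ->
  \int[lebesgue_rball2]_w (k (sphere_proj w) * \1_[set w | enorm w <= rho (sphere_proj w)] w) =
  ball_vol (R := R) (n := n) * \int[PB]_y (k (sphere_proj y) * rho (sphere_proj y) ^+ n).
Proof.
move=> bk k0 mrho rho2.
have mks : measurable_fun setT (fun w => k (@sphere_proj R n w)).
  by apply: measurableT_comp; [case: bk|exact: measurable_sphere_proj].
have mrs : measurable_fun setT (fun w => rho (@sphere_proj R n w)).
  by apply: measurableT_comp => //; exact: measurable_sphere_proj.
have mS : measurable [set w : 'rV[R]_n | enorm w <= rho (sphere_proj w)].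
  by apply: measurable_le_set => //; exact: measurable_enorm.
have b1 : bmeas (fun w => k (sphere_proj w) *
    (\1_[set w | enorm w <= rho (sphere_proj w)] w : R)).
  apply: bmeasM; last exact: bmeas_indic.
  by apply: bmeas_comp => //; exact: measurable_sphere_proj.
have b2 : bmeas (fun y : 'rV[R]_n => k (sphere_proj y) * rho (sphere_proj y) ^+ n).
  apply: bmeasM; first by apply: bmeas_comp => //; exact: measurable_sphere_proj.
  apply: bmeasX; split => //; exists 2 => y.
  by have /andP[? ?] := rho2 y; rewrite ger0_norm.
apply: EFin_inj; rewrite -integral_rball2//; first last.
- move=> x x2; rewrite indicE memNset ?mulr0//= => xr.
  have /andP[_ r2] := rho2 x.
  by move: (lt_le_trans x2 (le_trans xr r2)); rewrite ltxx.
- by move=> x; rewrite mulr_ge0// indicE.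
pose Phi (p : R * 'rV[R]_n) : \bar R :=
  (k p.2 * \1_[set p | p.1 <= rho p.2] p)%:E.
have mPhi : measurable_fun setT Phi.
  apply/measurable_EFinP; apply: measurable_funM.
    by apply: measurableT_comp; [case: bk|exact: measurable_snd].
  apply: measurable_indic; apply: measurable_le_set => //.
  exact: (measurableT_comp mrho measurable_snd).
have Phi0 p : (0 <= Phi p)%E by rewrite lee_fin mulr_ge0// indicE.
transitivity (\int[lam]_x Phi (enorm x, sphere_proj x))%E.
  by apply: eq_integral => x _; rewrite /Phi/= !indicE; do 2 congr EFin.
rewrite integral_polar//.
rewrite (fubini_tonelli (fun p : _ * _ => Phi (enorm p.1, sphere_proj p.2)))//; last first.
  apply: (measurableT_comp mPhi); apply: measurable_fun_pair.
    exact: (measurableT_comp measurable_enorm measurable_fst).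
  exact: (measurableT_comp measurable_sphere_proj measurable_snd).
rewrite EFinM -(bmeas_EFin_Rintegral PB b2) -ge0_integralZl//=; first last.
- by rewrite lee_fin ltW// ball_vol_gt0.
- by move=> x _; rewrite lee_fin mulr_ge0// exprn_ge0//; case/andP: (rho2 x).
- by apply/measurable_EFinP; case: b2.
apply: eq_integral => y _; rewrite /Phi/=.
have /andP[r0 _] := rho2 y.
under eq_integral do rewrite EFinM.
rewrite ge0_integralZl//; first last.
- by rewrite lee_fin.
- apply/measurable_EFinP; rewrite (_ : (fun x => _) =
    \1_[set x : 'rV[R]_n | enorm x <= rho (sphere_proj y)]).
    by apply: measurable_indic; exact: measurable_rball.
  by apply/funext => x; rewrite !indicE.
transitivity ((k (sphere_proj y))%:E * \int[lam]_x
    (\1_[set x : 'rV[R]_n | (enorm x <= rho (sphere_proj y))%R] x)%:E)%E.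
  by congr (_ * _)%E; apply: eq_integral => x _; rewrite !indicE.
rewrite integral_indic//; last exact: measurable_rball.
rewrite setIT [X in (_ * X)%E](lebesgue_rball n0 r0) -!EFinM; congr EFin; ring.
Qed.

Lemma integral_shift_ball (H : 'rV[R]_n -> R) (v : 'rV[R]_n) : bmeas H ->
  (forall x, 0 <= H x) -> (forall x, 2 < enorm x -> H x = 0) ->
  \int[lebesgue_rball2]_w (H w * \1_[set w | enorm (w - v) <= 1] w) =
  ball_vol (R := R) (n := n) * \int[PB]_y H (bclip y + v).
Proof.
move=> bH H0 H2.
have mS : measurable [set w : 'rV[R]_n | enorm (w - v) <= 1].
  apply: measurable_le_set => //; apply: (measurableT_comp measurable_enorm).
  exact: measurable_rVB.
have b1 : bmeas (fun w => H w * (\1_[set w | enorm (w - v) <= 1] w : R)).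
  by apply: bmeasM => //; exact: bmeas_indic.
have mc : measurable_fun setT (fun y : 'rV[R]_n => y + v) by exact: measurable_rVD.
have mH : measurable_fun setT (fun y : 'rV[R]_n => (H (y + v))%:E).
  by apply/measurable_EFinP; apply: measurableT_comp => //; case: bH.
have b2 : bmeas (fun y : 'rV[R]_n => H (bclip y + v)).
  apply: bmeas_comp => //; apply: measurable_rVD => //; exact: measurable_bclip.
apply: EFin_inj; rewrite -integral_rball2//; first last.
- by move=> x x2; rewrite H2// mul0r.
- by move=> x; rewrite mulr_ge0// indicE.
rewrite EFinM -(bmeas_EFin_Rintegral PB b2) -(integral_bclip mH).
rewrite integral_unif_ball//; last by move=> y; rewrite lee_fin.
rewrite muleA -EFinM mulfV ?gt_eqF ?ball_vol_gt0// mul1e.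
rewrite -(integral_rV_shift v)//; first last.
- by move=> x; rewrite lee_fin mulr_ge0// indicE.
- by apply/measurable_EFinP; case: b1.
rewrite [RHS]integral_mkcond; apply: eq_integral => x _.
rewrite patchE indicE/=.
have -> : (x + v \in [set w | enorm (w - v) <= 1]) = (x \in eball).
  by apply/idP/idP => /set_mem/= H1; apply: mem_set; move: H1; rewrite /eball/= addrK.
by case: ifP; rewrite ?mulr1 ?mulr0.
Qed.

End clip.

Lemma leq_bool (a b : bool) : (a -> b) -> (a <= b)%N.
Proof. by case: a b => -[] // /(_ isT). Qed.

Section taylor.
Context {R : realType} {n : nat}.
Notation lam := (@lebesgue_rV R n).
Notation PB := (@unif_ball R n).
Notation V := (ball_vol (R := R) (n := n)).

(** The gradient at 0 of the average of h over the unit ball, in the form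
    given by the divergence theorem. *)
Definition sphere_grad (h : 'rV[R]_n -> R) : 'rV[R]_n :=
  \row_i (n%:R * \int[PB]_y (h (sphere_proj y) * sphere_proj y ord0 i)).

Lemma dotv_sphere_le (v y : 'rV[R]_n) : `|dotv v (sphere_proj y)| <= enorm v.
Proof.
rewrite (le_trans (dotv_le _ _))// ler_piMr ?enorm_ge0//.
exact: enorm_sphere_proj_le1.
Qed.

Lemma sphere_mean_dotv (v : 'rV[R]_n) : \int[PB]_y dotv v (sphere_proj y) = 0.
Proof.
rewrite /dotv bmeas_Rintegral_sum => [|i]; last first.
  by apply: bmeasM; [exact: bmeas_cst|exact: bmeas_sphere_coord].
apply: big1 => i _; rewrite bmeas_RintegralZ; last exact: bmeas_sphere_coord.
by rewrite sphere_mean mulr0.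
Qed.

Lemma dotv_sphere_grad (h : 'rV[R]_n -> R) v :
  bmeas (fun y : 'rV[R]_n => h (sphere_proj y)) ->
  dotv v (sphere_grad h) =
  n%:R * \int[PB]_y (h (sphere_proj y) * dotv v (sphere_proj y)).
Proof.
move=> bh.
have bi i : bmeas (fun y : 'rV[R]_n => h (sphere_proj y) * sphere_proj y ord0 i).
  by apply: bmeasM => //; exact: bmeas_sphere_coord.
transitivity (n%:R * \int[PB]_y (\sum_i v ord0 i *
    (h (sphere_proj y) * sphere_proj y ord0 i))).
  rewrite bmeas_Rintegral_sum => [|i]; last by apply: bmeasM => //; exact: bmeas_cst.
  rewrite mulr_sumr; apply: eq_bigr => i _; rewrite bmeas_RintegralZ// mxE; ring.
congr (_ * _); apply: eq_Rintegral => y _.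
by rewrite mulr_sumr; apply: eq_bigr => i _; ring.
Qed.

Section lipschitz.
Variables (l : R) (h : 'rV[R]_n -> R).
Hypotheses (l0 : 0 <= l) (hl : euclidean_lipschitz l h).

Let mh : measurable_fun setT h := lipschitz_measurable l0 hl.

Lemma lipschitz_ball_le (w : 'rV[R]_n) (r : R) : enorm w <= r ->
  `|h w - h 0| <= l * r.
Proof. by move=> wr; rewrite (le_trans (hl _ _))// subr0 ler_wpM2l. Qed.

Lemma bmeas_lipschitz_sphere : bmeas (fun y : 'rV[R]_n => h (sphere_proj y)).
Proof.
split; first exact: (measurableT_comp mh measurable_sphere_proj).
exists (`|h 0| + l) => y; rewrite -[h _](subrK (h 0)) addrC.
rewrite (le_trans (ler_normD _ _))// lerD2l.
by have := lipschitz_ball_le (enorm_sphere_proj_le1 y); rewrite mulr1.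
Qed.

Lemma bmeas_lipschitz_ball (v : 'rV[R]_n) :
  bmeas (fun y : 'rV[R]_n => h (bclip y + v)).
Proof.
split.
  by apply: measurableT_comp => //; apply: measurable_rVD => //; exact: measurable_bclip.
exists (`|h 0| + l * (1 + enorm v)) => y; rewrite -[h _](subrK (h 0)) addrC.
rewrite (le_trans (ler_normD _ _))// lerD2l; apply: lipschitz_ball_le.
by rewrite (le_trans (enormD _ _))// lerD2r enorm_bclip.
Qed.

(* Integrals over lebesgue_rball2 are related to Lebesgue integrals for
   nonnegative functions supported in the ball of radius 2, hence the shift c
   and the cut-off H. The shift drops out in the end because directions have
   mean zero. *)
Let c := 2 * l - h 0.
Let H w := if enorm w <= 2 then h w + c else 0.

Let HE w : enorm w <= 2 -> H w = h w + c.
Proof. by rewrite /H => ->. Qed.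

Let Hs w : H (sphere_proj w) = h (sphere_proj w) + c.
Proof. by apply: HE; rewrite (le_trans (enorm_sphere_proj_le1 _))//; lra. Qed.

Let H0 w : 0 <= H w.
Proof.
rewrite /H; case: ifP => // w2; have := lipschitz_ball_le w2.
by rewrite /c ler_norml => /andP[]; lra.
Qed.

Let H2 w : 2 < enorm w -> H w = 0.
Proof. by rewrite /H ltNge => /negPf ->. Qed.

Let H4 w : H w <= 4 * l.
Proof.
rewrite /H; case: ifP => [w2|_]; last by rewrite mulr_ge0.
have := lipschitz_ball_le w2; rewrite /c ler_norml => /andP[]; lra.
Qed.

Let bH : bmeas H.
Proof.
split; last first.
  by exists (4 * l) => w; rewrite ger0_norm.
rewrite (_ : H = fun w => (h w + c) * \1_[set w | enorm w <= 2] w).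
  apply: measurable_funM; first exact: measurable_funD.
  by apply: measurable_indic; exact: measurable_rball.
apply/funext => w; rewrite /H indicE.
case: ifPn => w2; first by rewrite mem_set// mulr1.
by rewrite memNset ?mulr0//=; exact/negP.
Qed.

Let Hs_le w : H (sphere_proj w) <= 3 * l.
Proof.
rewrite Hs; have := lipschitz_ball_le (enorm_sphere_proj_le1 w).
rewrite /c ler_norml => /andP[]; lra.
Qed.

Let indE (A : 'rV[R]_n -> bool) w : \1_[set w | A w] w = (A w)%:R :> R.
Proof.
rewrite indicE; congr ((_ : bool)%:R).
by apply/idP/idP => [/set_mem|/mem_set].
Qed.

(** With t = v . dir(w), the region |w| <= 1 + t contains the ball of centre
    v, which contains the region |w| <= 1 + t - |v|^2; the second term of the
    bound pays for this difference. Everything that enters or leaves the unit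
    ball lies in the shell 1 - 2 |v| < |w| <= 1 + |v|, where replacing w by
    dir(w) changes H by at most l |v|; this is the first term. *)
Lemma ball_star_pointwise (v w : 'rV[R]_n) : enorm v <= 2^-1 ->
  `|H w * (enorm (w - v) <= 1)%R%:R - H w * (enorm (w - 0) <= 1)%R%:R
    - H (sphere_proj w) * (enorm w <= 1 + dotv v (sphere_proj w))%R%:R
    + H (sphere_proj w) * (enorm w <= 1)%R%:R|
  <= l * enorm v * ((enorm w <= 1 + enorm v)%R%:R - (enorm w <= 1 - 2 * enorm v)%R%:R)
   + 4 * l * ((enorm w <= 1 + dotv v (sphere_proj w))%R%:R
      - (enorm w <= 1 + dotv v (sphere_proj w) - enorm v ^+ 2)%R%:R).
Proof.
rewrite subr0; set r := enorm w; set t := dotv v (sphere_proj w); set a := enorm v => a2.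
have a0 : 0 <= a by exact: enorm_ge0.
have r0 : 0 <= r by exact: enorm_ge0.
have ta : `|t| <= a by exact: dotv_sphere_le.
have ta2 : t ^+ 2 <= a ^+ 2 by rewrite -[t ^+ 2]real_normK ?num_real// lerXn2r ?nnegrE.
move/ler_normlP : (ta) => [ta' ta''].
have wv2 : enorm (w - v) ^+ 2 = r ^+ 2 - 2 * (r * t) + a ^+ 2.
  by rewrite sqr_enormB -/r -/a -{1}[w]sphere_projK dotvZl dotvC.
have SE : (enorm (w - v) <= 1) = (enorm (w - v) ^+ 2 <= 1).
  by rewrite -[in RHS](expr1n _ 2) ler_pXn2r ?nnegrE// enorm_ge0.
have S1 : enorm (w - v) <= 1 -> r <= 1 + t.
  rewrite SE wv2 => S; rewrite leNgt; apply/negP => rt; nra.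
have S2 : r <= 1 + t - a ^+ 2 -> enorm (w - v) <= 1.
  rewrite SE wv2 => S; have [rt|rt] := leP t r.
    have : (r - t) ^+ 2 <= (1 - a ^+ 2) ^+ 2.
      by rewrite lerXn2r ?nnegrE; nra.
    nra.
  nra.
have tri : `|r - 1| <= a -> r <= 2 -> `|H (sphere_proj w) - H w| <= l * a.
  move=> ra r2; rewrite Hs HE// opprD addrACA subrr addr0 distrC.
  rewrite (le_trans (hl _ _))// ler_wpM2l//.
  rewrite -{1}[w]sphere_projK -/r -[X in _ - X]scale1r -scalerBl enormZ.
  by rewrite (le_trans _ ra)// ler_piMr// enorm_sphere_proj_le1.
have Sr : enorm (w - v) <= 1 -> r <= 1 + a.
  by move=> S; rewrite /r -[w](subrK v) (le_trans (enormD _ _))// lerD2r.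
have nSr : 1 < enorm (w - v) -> 1 - a < r.
  by move=> S; have := enormB w v; rewrite -/r -/a; lra.
have S21 : r <= 1 + t - a ^+ 2 -> r <= 1 + t.
  by move=> S; rewrite (le_trans S)// gerBl sqr_ge0.
have E21 : r <= 1 - 2 * a -> r <= 1 + a by move=> ?; lra.
have la : 0 <= l * a by rewrite mulr_ge0.
have hs0 := H0 (sphere_proj w); have hs3 := Hs_le w.
have pos : 0 <= l * a * ((r <= 1 + a)%R%:R - (r <= 1 - 2 * a)%R%:R).
  rewrite mulr_ge0// subr_ge0 ler_nat leq_bool//.
have [S|nS] := leP (enorm (w - v)) 1; have [B|nB] := leP r 1.
- rewrite S1// !mulr1 subrr sub0r addNr normr0 addr_ge0// mulr_ge0 ?mulr_ge0//.
  by rewrite subr_ge0 ler_nat leq_bool.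
- rewrite S1// !(mulr1, mulr0) subr0 addr0 distrC.
  have -> : (r <= 1 + a) = true by rewrite Sr.
  have -> : (r <= 1 - 2 * a) = false by apply/negbTE; rewrite -ltNge; lra.
  have := Sr S => ra.
  have tr : `|H (sphere_proj w) - H w| <= l * a.
    by apply: tri; [rewrite ler_norml; lra|lra].
  apply: (le_trans tr); rewrite subr0 mulr1 lerDl mulr_ge0 ?mulr_ge0//.
  by rewrite subr_ge0 ler_nat leq_bool.
- have ra := nSr nS.
  have -> : (r <= 1 + a) = true by lra.
  have -> : (r <= 1 - 2 * a) = false by apply/negbTE; rewrite -ltNge; lra.
  have -> : (r <= 1 + t - a ^+ 2) = false.
    by apply/negbTE/negP => /S2; rewrite leNgt nS.
  have : `|H (sphere_proj w) - H w| <= l * a.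
    by apply: tri; [rewrite ler_norml; lra|lra].
  rewrite !ler_norml => /andP[? ?].
  case: (r <= 1 + t); rewrite !(mulr1, mulr0, subr0); lra.
- have -> : (r <= 1 + t - a ^+ 2) = false.
    by apply/negbTE/negP => /S2; rewrite leNgt nS.
  apply: (@le_trans _ _ (4 * l * ((r <= 1 + t)%R%:R - false%:R))); last by lra.
  rewrite !mulr0 subr0 !sub0r addr0 normrN.
  case: (r <= 1 + t); last by rewrite mulr0 normr0 subrr mulr0.
  by rewrite mulr1 subr0 mulr1 ger0_norm//; lra.
Qed.

Hypothesis n0 : (0 < n)%N.

Let bHs : bmeas (fun y : 'rV[R]_n => H (sphere_proj y)).
Proof. by apply: bmeas_comp => //; exact: measurable_sphere_proj. Qed.

Let V0 : 0 < V.
Proof. exact: ball_vol_gt0. Qed.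

Let bind (A : 'rV[R]_n -> bool) : measurable [set w | A w] ->
  bmeas (fun w : 'rV[R]_n => (A w)%:R : R).
Proof.
move=> mA; rewrite (_ : (fun w => _) = \1_[set w | A w]); first exact: bmeas_indic.
by apply/funext => w; rewrite indE.
Qed.

Let mrho (rho : 'rV[R]_n -> R) : measurable_fun setT rho ->
  measurable [set w : 'rV[R]_n | enorm w <= rho (sphere_proj w)].
Proof.
move=> mr; apply: measurable_le_set; first exact: measurable_enorm.
by apply: (measurableT_comp mr); exact: measurable_sphere_proj.
Qed.

Let int_shift v : enorm v <= 1 -> \int[(@lebesgue_rball2 R n)]_w (H w * (enorm (w - v) <= 1)%R%:R) =
  V * (\int[PB]_y h (bclip y + v) + c).
Proof.
move=> v1.
rewrite -(Rintegral_prob_cst PB c) -bmeas_RintegralD//; first last.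
- exact: bmeas_cst.
- exact: bmeas_lipschitz_ball.
rewrite (_ : \int[PB]_y _ = \int[PB]_y H (bclip y + v)).
  rewrite -integral_shift_ball//.
  by apply: eq_Rintegral => w _; rewrite (indE (fun w => enorm (w - v) <= 1)).
apply: eq_Rintegral => y _; rewrite HE//.
by rewrite (le_trans (enormD _ _))//; have := enorm_bclip y; lra.
Qed.

Let int_star (k rho : 'rV[R]_n -> R) : bmeas k -> (forall x, 0 <= k x) ->
  measurable_fun setT rho -> (forall y, 0 <= rho (sphere_proj y) <= 2) ->
  \int[(@lebesgue_rball2 R n)]_w (k (sphere_proj w) * (enorm w <= rho (sphere_proj w))%R%:R) =
  V * \int[PB]_y (k (sphere_proj y) * rho (sphere_proj y) ^+ n).
Proof.
move=> bk k0 mr r2; rewrite -integral_star//.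
apply: eq_Rintegral => w _.
by rewrite (indE (fun w => enorm w <= rho (sphere_proj w))).
Qed.

Let int_star1 (rho : 'rV[R]_n -> R) :
  measurable_fun setT rho -> (forall y, 0 <= rho (sphere_proj y) <= 2) ->
  \int[(@lebesgue_rball2 R n)]_w ((enorm w <= rho (sphere_proj w))%R%:R) =
  V * \int[PB]_y (rho (sphere_proj y) ^+ n).
Proof.
move=> mr r2; have := @int_star (cst 1) rho (bmeas_cst 1) (fun=> ler01) mr r2.
under eq_Rintegral do rewrite mul1r.
by under [in X in _ = _ * X -> _]eq_Rintegral do rewrite mul1r.
Qed.

Let mdot v : measurable_fun setT (fun y : 'rV[R]_n => dotv v y).
Proof. exact: measurable_dotv. Qed.

(** Integration of ball_star_pointwise. The star-shaped region contributes the
    mean of H (t) (1 + v . t)^n over directions t, whose part linear in v is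
    dotv v (sphere_grad h); the two terms of the bound are |v| times a
    difference of n-th powers of radii that differ by 3 |v|, and a difference
    of n-th powers of radii that differ by |v|^2. *)
Lemma ball_taylor_small v : enorm v <= 2^-1 ->
  `|\int[PB]_y h (bclip y + v) - \int[PB]_y h (bclip y + 0)
    - dotv v (sphere_grad h)|
  <= (7 * (n%:R * 2 ^+ n) + 3 * 4 ^+ n) * l * enorm v ^+ 2.
Proof.
move=> v2; set a := enorm v in v2 *.
have a0 : 0 <= a by exact: enorm_ge0.
have aa : a ^+ 2 <= 4^-1 by nra.
have a1 : a <= 1 by lra.
have ra1 : 0 <= 1 + a <= 2 by lra.
have ra2 : 0 <= 1 - 2 * a <= 2 by lra.
have one2 : 0 <= (1 : R) <= 2 by lra.
have zero1 : enorm (0 : 'rV[R]_n) <= 1 by rewrite enorm0.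
have n2 : 0 <= n%:R * 2 ^+ n :> R by rewrite mulr_ge0// exprn_ge0.
have aE : (1 + a) ^+ n - (1 - 2 * a) ^+ n <= n%:R * 2 ^+ n * (3 * a).
  apply: (le_trans (lerX_sub _ _ _ _)); [lra|lra|lra|].
  by rewrite ler_wpM2l//; lra.
have sum_le (x y l1 l2 : R) : x <= l1 + l2 -> y <= 3 * l * (4 ^+ n * a ^+ 2) ->
    l1 <= l * a * (n%:R * 2 ^+ n * (3 * a)) ->
    l2 <= 4 * l * (n%:R * 2 ^+ n * a ^+ 2) ->
    x + y <= (7 * (n%:R * 2 ^+ n) + 3 * 4 ^+ n) * l * a ^+ 2.
  by move=> h1 h2 h3 h4; lra.
pose rho1 (y : 'rV[R]_n) := 1 + dotv v y.
pose rho2 (y : 'rV[R]_n) := 1 + dotv v y - a ^+ 2.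
have mrho1 : measurable_fun setT rho1 by apply: measurable_funD.
have mrho2 : measurable_fun setT rho2 by apply: measurable_funB.
have rho1_2 y : 0 <= rho1 (sphere_proj y) <= 2.
  by have := dotv_sphere_le v y; rewrite -/a ler_norml /rho1 => /andP[]; lra.
have rho2_2 y : 0 <= rho2 (sphere_proj y) <= 2.
  have := dotv_sphere_le v y; have := sqr_ge0 a.
  by rewrite -/a ler_norml /rho2 => ? /andP[]; lra.
have IS := @int_shift v a1; have IB := @int_shift 0 zero1.
have IJ := int_star bH H0 mrho1 rho1_2.
have IK : \int[(@lebesgue_rball2 R n)]_w (H (sphere_proj w) * (enorm w <= 1)%R%:R) =
    V * \int[PB]_y (H (sphere_proj y)).
  rewrite (int_star bH H0 (measurable_cst (1 : R)) (fun=> one2)).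
  by under eq_Rintegral do rewrite /= expr1n mulr1.
have IE1 : \int[(@lebesgue_rball2 R n)]_w ((enorm w <= 1 + a)%R%:R) = V * (1 + a) ^+ n.
  rewrite -(Rintegral_prob_cst PB ((1 + a) ^+ n)).
  exact: (int_star1 (measurable_cst (1 + a)) (fun=> ra1)).
have IE2 : \int[(@lebesgue_rball2 R n)]_w ((enorm w <= 1 - 2 * a)%R%:R) = V * (1 - 2 * a) ^+ n.
  rewrite -(Rintegral_prob_cst PB ((1 - 2 * a) ^+ n)).
  exact: (int_star1 (measurable_cst (1 - 2 * a)) (fun=> ra2)).
have IS1 := int_star1 mrho1 rho1_2.
have IS2 := int_star1 mrho2 rho2_2.
have b1 : bmeas (fun w => H w * (enorm (w - v) <= 1)%R%:R).
  apply: bmeasM => //; apply: bind; apply: measurable_le_set => //.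
  by apply: (measurableT_comp measurable_enorm); exact: measurable_rVB.
have b2 : bmeas (fun w => H w * (enorm (w - 0) <= 1)%R%:R).
  apply: bmeasM => //; apply: bind; apply: measurable_le_set => //.
  by apply: (measurableT_comp measurable_enorm); exact: measurable_rVB.
have b3 : bmeas (fun w => H (sphere_proj w) * (enorm w <= rho1 (sphere_proj w))%R%:R).
  by apply: bmeasM => //; apply: bind; exact: mrho.
have b4 : bmeas (fun w => H (sphere_proj w) * (enorm w <= 1)%R%:R).
  by apply: bmeasM => //; apply: bind; exact: measurable_rball.
have b5 : bmeas (fun w : 'rV[R]_n => (enorm w <= 1 + a)%R%:R : R).
  by apply: bind; exact: measurable_rball.
have b6 : bmeas (fun w : 'rV[R]_n => (enorm w <= 1 - 2 * a)%R%:R : R).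
  by apply: bind; exact: measurable_rball.
have b7 : bmeas (fun w : 'rV[R]_n => (enorm w <= rho1 (sphere_proj w))%R%:R : R).
  by apply: bind; exact: mrho.
have b8 : bmeas (fun w : 'rV[R]_n => (enorm w <= rho2 (sphere_proj w))%R%:R : R).
  by apply: bind; exact: mrho.
have bp1 : bmeas (fun y : 'rV[R]_n => rho1 (sphere_proj y) ^+ n).
  apply: bmeasX; split.
    by apply: (measurableT_comp mrho1); exact: measurable_sphere_proj.
  by exists 2 => y; have /andP[? ?] := rho1_2 y; rewrite ger0_norm.
have bp2 : bmeas (fun y : 'rV[R]_n => rho2 (sphere_proj y) ^+ n).
  apply: bmeasX; split.
    by apply: (measurableT_comp mrho2); exact: measurable_sphere_proj.
  by exists 2 => y; have /andP[? ?] := rho2_2 y; rewrite ger0_norm.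
have fin2 := @lebesgue_rball2_fin R n n0.
have := bmeas_fint_norm_le fin2
  (bmeasD (bmeasB (bmeasB b1 b2) b3) b4)
  (bmeasD (bmeasM (bmeas_cst (l * a)) (bmeasB b5 b6))
          (bmeasM (bmeas_cst (4 * l)) (bmeasB b7 b8)))
  (fun w => @ball_star_pointwise v w v2).
rewrite (bmeas_fintD fin2 (bmeasB (bmeasB b1 b2) b3) b4).
rewrite (bmeas_fintB fin2 (bmeasB b1 b2) b3) (bmeas_fintB fin2 b1 b2).
rewrite (bmeas_fintD fin2 (bmeasM (bmeas_cst (l * a)) (bmeasB b5 b6))
          (bmeasM (bmeas_cst (4 * l)) (bmeasB b7 b8))).
rewrite (bmeas_fintZ fin2 (l * a) (bmeasB b5 b6)).
rewrite (bmeas_fintZ fin2 (4 * l) (bmeasB b7 b8)).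
rewrite (bmeas_fintB fin2 b5 b6) (bmeas_fintB fin2 b7 b8).
rewrite IS IB IJ IK IE1 IE2 IS1 IS2.
set P1 := \int[PB]_y h (bclip y + v); set P0 := \int[PB]_y h (bclip y + 0).
rewrite (_ : V * (P1 + c) - V * (P0 + c) - V * \int[PB]_y (H (sphere_proj y) *
   rho1 (sphere_proj y) ^+ n) + V * \int[PB]_y H (sphere_proj y) =
   V * (P1 - P0 - (\int[PB]_y (H (sphere_proj y) *
   rho1 (sphere_proj y) ^+ n) - \int[PB]_y H (sphere_proj y)))); last by ring.
rewrite -(bmeas_RintegralB PB (bmeasM bHs bp1) bHs).
rewrite normrM gtr0_norm// -!mulrBr ![_ * (V * _)]mulrCA -mulrDr ler_pM2l//.
rewrite -(bmeas_RintegralB PB bp1 bp2).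
set Q := \int[PB]_y (H (sphere_proj y) * rho1 (sphere_proj y) ^+ n - H (sphere_proj y)).
set S := \int[PB]_y (rho1 (sphere_proj y) ^+ n - rho2 (sphere_proj y) ^+ n) => main.
have SE : S <= n%:R * 2 ^+ n * a ^+ 2.
  rewrite -[leRHS](Rintegral_prob_cst PB) /S; apply: bmeas_le_Rintegral.
  - exact: bmeasB.
  - exact: bmeas_cst.
  - move=> y; have /andP[r1 r1'] := rho1_2 y; have /andP[r2 r2'] := rho2_2 y.
    have E : rho1 (sphere_proj y) - rho2 (sphere_proj y) = a ^+ 2.
      by rewrite /rho1 /rho2; ring.
    rewrite -E; apply: lerX_sub => //.
    by rewrite -subr_ge0 E sqr_ge0.
have QE : `|Q - dotv v (sphere_grad h)| <= 3 * l * (4 ^+ n * a ^+ 2).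
  have bhs := bmeas_lipschitz_sphere.
  have bd := bmeas_sphere_dotv v.
  have bHp : bmeas (fun y : 'rV[R]_n =>
      H (sphere_proj y) * rho1 (sphere_proj y) ^+ n) by exact: bmeasM.
  have bhd : bmeas (fun y : 'rV[R]_n => h (sphere_proj y) * dotv v (sphere_proj y)).
    exact: bmeasM.
  have bnd : bmeas (fun y : 'rV[R]_n => n%:R * (h (sphere_proj y) * dotv v (sphere_proj y))).
    by apply: bmeasM => //; exact: bmeas_cst.
  have bcd : bmeas (fun y : 'rV[R]_n => n%:R * c * dotv v (sphere_proj y)).
    by apply: bmeasM => //; exact: bmeas_cst.
  rewrite dotv_sphere_grad// -bmeas_RintegralZ//.
  have -> : Q - \int[PB]_y (n%:R * (h (sphere_proj y) * dotv v (sphere_proj y))) =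
    Q - \int[PB]_y (n%:R * (h (sphere_proj y) * dotv v (sphere_proj y)))
      - \int[PB]_y (n%:R * c * dotv v (sphere_proj y)).
    by rewrite [X in _ = _ - X]bmeas_RintegralZ// sphere_mean_dotv mulr0 subr0.
  rewrite /Q -bmeas_RintegralB//; last exact: bmeasB.
  rewrite -bmeas_RintegralB//; last by apply: bmeasB => //; exact: bmeasB.
  apply: bmeas_norm_Rintegral_le; first by apply: bmeasB => //; do 2 apply: bmeasB => //.
  move=> y.
  have -> : H (sphere_proj y) * rho1 (sphere_proj y) ^+ n - H (sphere_proj y) -
     n%:R * (h (sphere_proj y) * dotv v (sphere_proj y)) -
     n%:R * c * dotv v (sphere_proj y) =
     H (sphere_proj y) * ((1 + dotv v (sphere_proj y)) ^+ n - 1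
        - n%:R * dotv v (sphere_proj y)).
    by rewrite {3}Hs /rho1 (_ : h _ = H (sphere_proj y) - c) ?Hs; ring.
  rewrite normrM (ger0_norm (H0 _)); apply: ler_pM => //.
  have ta := dotv_sphere_le v y; rewrite -/a in ta.
  apply: (le_trans (expr1D_taylor _ (le_trans ta a1))).
  rewrite ler_wpM2l ?exprn_ge0// -[_ ^+ 2]real_normK ?num_real//.
  by rewrite lerXn2r ?nnegrE.
have -> : P1 - P0 - dotv v (sphere_grad h) =
  (P1 - P0 - Q) + (Q - dotv v (sphere_grad h)) by ring.
apply: (le_trans (ler_normD _ _)).
apply: (sum_le _ _ _ _ main QE).
- by rewrite ler_wpM2l// mulr_ge0.
- by rewrite ler_wpM2l// mulr_ge0.
Qed.

(** For |v| > 1/2 each term on the left is O(|v|) by the Lipschitz property,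
    hence O(|v|^2). *)
Lemma ball_taylor v :
  `|\int[PB]_y h (bclip y + v) - \int[PB]_y h (bclip y + 0)
    - dotv v (sphere_grad h)|
  <= (7 * (n%:R * 2 ^+ n) + 3 * 4 ^+ n + 2 + 2 * n%:R) * l * enorm v ^+ 2.
Proof.
set a := enorm v; have a0 : 0 <= a by exact: enorm_ge0.
have la : 0 <= l * a ^+ 2 by rewrite mulr_ge0// sqr_ge0.
have [v2|v2] := leP a 2^-1.
  apply: (le_trans (ball_taylor_small v2)).
  rewrite -!mulrA ler_wpM2r// -addrA lerDl addr_ge0// mulr_ge0//.
have la' : l * a <= 2 * (l * a ^+ 2).
  by rewrite mulrCA ler_wpM2l//; nra.
have p0 : 0 <= 7 * (n%:R * 2 ^+ n) + 3 * 4 ^+ n :> R.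
  by rewrite addr_ge0// mulr_ge0// ?mulr_ge0// exprn_ge0.
have P : `|\int[PB]_y h (bclip y + v) - \int[PB]_y h (bclip y + 0)| <= l * a.
  rewrite -bmeas_RintegralB; [|exact: bmeas_lipschitz_ball..].
  apply: bmeas_norm_Rintegral_le.
    by apply: bmeasB; exact: bmeas_lipschitz_ball.
  move=> y; rewrite (le_trans (hl _ _))//.
  by rewrite addr0 addrC addKr.
have D : `|dotv v (sphere_grad h)| <= n%:R * (l * a).
  have bhs := bmeas_lipschitz_sphere.
  have bd := bmeas_sphere_dotv v.
  rewrite dotv_sphere_grad// normrM ger0_norm// ler_wpM2l//.
  have -> : \int[PB]_y (h (sphere_proj y) * dotv v (sphere_proj y)) =
     \int[PB]_y (h (sphere_proj y) * dotv v (sphere_proj y))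
     - \int[PB]_y (h 0 * dotv v (sphere_proj y)).
    by rewrite [X in _ - X]bmeas_RintegralZ// sphere_mean_dotv mulr0 subr0.
  have b1 : bmeas (fun y : 'rV[R]_n => h (sphere_proj y) * dotv v (sphere_proj y)).
    exact: bmeasM.
  have b2 : bmeas (fun y : 'rV[R]_n => h 0 * dotv v (sphere_proj y)).
    by apply: bmeasM => //; exact: bmeas_cst.
  rewrite -bmeas_RintegralB//; apply: bmeas_norm_Rintegral_le; first exact: bmeasB.
  move=> y; rewrite -mulrBl normrM ler_pM//; last exact: dotv_sphere_le.
  by have := lipschitz_ball_le (enorm_sphere_proj_le1 y); rewrite mulr1.
have nla : n%:R * (l * a) <= n%:R * (2 * (l * a ^+ 2)) by rewrite ler_wpM2l.
have : 0 <= (7 * (n%:R * 2 ^+ n) + 3 * 4 ^+ n) * (l * a ^+ 2) by rewrite mulr_ge0.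
move=> ?; apply: (le_trans (ler_normB _ _)); lra.
Qed.

End lipschitz.
End taylor.

(** * Differentiability of the smoothed function *)

Section dual.
Context {R : realType} {n : nat}.

(** The linear argument comes last, in order to carry the structure of a
    linear form. *)
Definition dotr (G v : 'rV[R]_n) : R := dotv v G.

Lemma dotr_is_linear G : linear (dotr G).
Proof. by move=> a u v; rewrite /dotr dotvDl dotvZl. Qed.

HB.instance Definition _ G := GRing.isLinear.Build R 'rV[R]_n R _ (dotr G) (dotr_is_linear G).

Lemma enorm_le_norm (v : 'rV[R]_n) : enorm v <= n%:R * `|v|.
Proof.
rewrite (le_trans (enorm_le_sum _))//.
apply: (@le_trans _ _ (\sum_(i < n) `|v|)).
  apply: ler_sum => i _; rewrite [leRHS]mx_normrE.
  exact: (le_bigmax _ (fun ij => `|v ij.1 ij.2|) (ord0, i)).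
by rewrite sumr_const card_ord mulr_natl.
Qed.

Lemma continuous_dotr G : continuous (dotr G).
Proof.
apply/linear_bounded_continuous/linear_boundedP; near=> r => x.
rewrite (le_trans (dotv_le _ _))//.
apply: (@le_trans _ _ (n%:R * `|x| * enorm G)).
  by rewrite ler_wpM2r ?enorm_ge0// enorm_le_norm.
by rewrite mulrAC ler_wpM2r//; near: r; apply: nbhs_pinfty_ge; rewrite num_real.
Unshelve. all: by end_near. Qed.

(** Differentiability refers to the sup norm, but the two norms are
    equivalent, so that a quadratic error is negligible for both. *)
Lemma quadratic_differentiable (f : 'rV[R]_n -> R) (x G : 'rV[R]_n) (C : R) :
  (forall v, `|f (x + v) - f x - dotv v G| <= C * enorm v ^+ 2) ->
  differentiable f x /\ gradient f x = G.
Proof.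
move=> fC.
have H : (f : 'rV[R]_n -> R^o) \o shift x =
    cst (f x : R^o) + (dotr G : 'rV[R]_n -> R^o) +o_ (0 : 'rV[R]_n) id.
  apply/eqaddoP => e e0; apply/(@nbhs_norm0P _ 'rV[R]_n).
  have p0 : 0 < `|C| * n%:R ^+ 2 + 1 by rewrite ltr_wpDl// mulr_ge0// exprn_ge0.
  exists (e / (`|C| * n%:R ^+ 2 + 1)); first by rewrite /= divr_gt0.
  move=> v /=; rewrite ltr_pdivlMr// => ve.
  have -> : (f \o shift x - (cst (f x) + dotr G)) v = f (x + v) - f x - dotv v G.
    by rewrite !fctE /= opprD addrA (addrC v).
  apply: (le_trans (fC v)).
  have nv := enorm_le_norm v; have nv0 := enorm_ge0 v.
  apply: (@le_trans _ _ (`|C| * (n%:R * `|v|) ^+ 2)).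
    apply: (@le_trans _ _ (`|C| * enorm v ^+ 2)).
      by rewrite ler_wpM2r ?sqr_ge0// ler_norm.
    by rewrite ler_wpM2l// lerXn2r ?nnegrE// (le_trans nv0).
  rewrite exprMn mulrA expr2 [X in _ * X <= _]expr2 mulrA ler_wpM2r//.
  rewrite -expr2 mulrC; apply: le_trans (ltW ve).
  by rewrite ler_wpM2l// lerDl ler01.
have dfE : 'd f x = dotr G :> ('rV[R]_n -> R).
  by apply: diff_unique => //; exact: continuous_dotr.
have df : differentiable f x.
  by apply/diff_locallyP; rewrite dfE; split => //; exact: continuous_dotr.
split=> //; apply/rowP => i; rewrite mxE deriveE// dfE /dotr /dotv.
rewrite (bigD1 i)//= big1 ?addr0 => [|j ji].
  by rewrite mxE !eqxx mul1r.
by rewrite mxE (negPf ji) andbF mul0r.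
Qed.

End dual.

Section smoothed.
Context {R : realType} {n : nat}.
Notation PB := (@unif_ball R n).
Variables (L delta : R) (f : 'rV[R]_n -> R).
Hypotheses (n0 : (0 < n)%N) (L0 : 0 <= L) (d0 : 0 < delta).
Hypothesis fL : euclidean_lipschitz L f.

Let mf : measurable_fun setT f := lipschitz_measurable L0 fL.

Lemma smoothedE x : smoothed delta f x = \int[PB]_y f (x + delta *: bclip y).
Proof.
rewrite /smoothed unlock; congr fine; rewrite integral_bclip//.
apply/measurable_EFinP; apply: measurableT_comp => //.
by apply: measurable_rVD => //; apply: measurable_rVZ.
Qed.

Lemma lipschitz_rescale x :
  euclidean_lipschitz (delta * L) (fun u => f (x + delta *: u)).
Proof.
move=> u v; rewrite (le_trans (fL _ _))// opprD addrACA subrr add0r -scalerBr.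
by rewrite enormZ gtr0_norm// mulrCA mulrA.
Qed.

Lemma rescale_ge0 : 0 <= delta * L.
Proof. by rewrite mulr_ge0// ltW. Qed.

Lemma bmeas_smoothed x : bmeas (fun y : 'rV[R]_n => f (x + delta *: bclip y)).
Proof.
have := bmeas_lipschitz_ball rescale_ge0 (lipschitz_rescale x) 0.
by congr bmeas; apply/funext => y; rewrite addr0.
Qed.

(** The gradient of the smoothed function in the form in which the estimator
    produces it, an average over directions. *)
Definition smoothed_grad x : 'rV[R]_n :=
  delta^-1 *: sphere_grad (fun u => f (x + delta *: u)).

Definition taylor_cst : R :=
  (7 * (n%:R * 2 ^+ n) + 3 * 4 ^+ n + 2 + 2 * n%:R) * L / delta.

Lemma taylor_cst_ge0 : 0 <= taylor_cst.
Proof.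
rewrite /taylor_cst divr_ge0 ?(ltW d0)// mulr_ge0//.
Qed.

Lemma smoothed_taylor x v :
  `|smoothed delta f (x + v) - smoothed delta f x - dotv v (smoothed_grad x)|
  <= taylor_cst * enorm v ^+ 2.
Proof.
have := ball_taylor rescale_ge0 (lipschitz_rescale x) n0 (delta^-1 *: v).
rewrite !smoothedE.
under eq_Rintegral do rewrite scalerDr scalerA mulfV ?gt_eqF// scale1r (addrC _ v) addrA.
under [in X in _ - X - _]eq_Rintegral do rewrite addr0.
rewrite dotvZl -dotvZr => /le_trans; apply.
rewrite enormZ ger0_norm ?invr_ge0 ?(ltW d0)// /taylor_cst.
rewrite le_eqVlt; apply/orP; left; apply/eqP; field.
by rewrite gt_eqF.
Qed.

Lemma smoothed_differentiable x :
  differentiable (smoothed delta f) x /\ gradient (smoothed delta f) x = smoothed_grad x.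
Proof. exact: quadratic_differentiable (smoothed_taylor x). Qed.

Lemma smoothed_lipschitz : euclidean_lipschitz L (smoothed delta f).
Proof.
move=> x y; rewrite !smoothedE -bmeas_RintegralB; [|exact: bmeas_smoothed..].
apply: bmeas_norm_Rintegral_le; first by apply: bmeasB; exact: bmeas_smoothed.
move=> z; rewrite (le_trans (fL _ _))//.
by rewrite opprD addrACA subrr addr0.
Qed.

Lemma smoothed_close x : `|smoothed delta f x - f x| <= L * delta.
Proof.
rewrite smoothedE -(Rintegral_prob_cst PB (f x)) -bmeas_RintegralB;
  [|exact: bmeas_smoothed|exact: bmeas_cst].
apply: bmeas_norm_Rintegral_le; first by apply: bmeasB; [exact: bmeas_smoothed|exact: bmeas_cst].
move=> z; rewrite (le_trans (fL _ _))// ler_wpM2l//.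
by rewrite addrC addKr enormZ gtr0_norm// ger_pMr// enorm_bclip.
Qed.

(** Along its gradient G the smoothed function increases by t |G|^2 - O(t^2)
    for a step t G, and by at most L t |G|. *)
Lemma enorm_smoothed_grad x : enorm (smoothed_grad x) <= L.
Proof.
set G := smoothed_grad x; have G0 := enorm_ge0 G; have C0 := taylor_cst_ge0.
rewrite leNgt; apply/negP => LG.
(* For this step the quadratic error is at most half of the excess |G| - L,
   relative to t |G|. *)
pose t := (enorm G - L) / (2 * (taylor_cst + 1) * enorm G).
have Gp : 0 < enorm G by exact: le_lt_trans LG.
have t0 : 0 < t by rewrite divr_gt0 ?subr_gt0// mulr_gt0// mulr_gt0// ltr_wpDl.
have := smoothed_taylor x (t *: G).
have := smoothed_lipschitz (x + t *: G) x.
rewrite -/G (addrC x) addrK enormZ (gtr0_norm t0) dotvZl -sqr_enorm exprMn.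
move=> /ler_normlP[_ H1] /ler_normlP[H2 _].
have : t * enorm G ^+ 2 <= L * (t * enorm G) + taylor_cst * (t ^+ 2 * enorm G ^+ 2).
  lra.
have -> : t * enorm G ^+ 2 = t * enorm G * enorm G by ring.
have -> : L * (t * enorm G) + taylor_cst * (t ^+ 2 * enorm G ^+ 2) =
  t * enorm G * (L + taylor_cst * (t * enorm G)) by ring.
rewrite (ler_pM2l (mulr_gt0 t0 Gp)).
have -> : t * enorm G = (enorm G - L) / (2 * (taylor_cst + 1)).
  rewrite /t; field; rewrite gt_eqF//=; lra.
have : taylor_cst * ((enorm G - L) / (2 * (taylor_cst + 1))) <= (enorm G - L) / 2.
  have c1 : 0 < taylor_cst + 1 by rewrite ltr_wpDl.
  have -> : taylor_cst * ((enorm G - L) / (2 * (taylor_cst + 1))) =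
    (enorm G - L) / 2 * (taylor_cst / (taylor_cst + 1)) by field; rewrite gt_eqF.
  rewrite ler_piMr//; first by rewrite divr_ge0// subr_ge0 ltW.
  by rewrite ler_pdivrMr// mul1r lerDl.
lra.
Qed.

(** Through lipschitz_measurable this makes the gradient a measurable function
    of the point. *)
Lemma smoothed_grad_lipschitz i :
  euclidean_lipschitz (delta^-1 * (n%:R * L)) (fun x => smoothed_grad x ord0 i).
Proof.
move=> x y; rewrite /smoothed_grad !mxE -mulrBr normrM gtr0_norm ?invr_gt0// -!mulrA.
rewrite ler_wpM2l ?invr_ge0 ?(ltW d0)// -mulrBr normrM ger0_norm// ler_wpM2l//.
have b z : bmeas (fun t : 'rV[R]_n =>
    f (z + delta *: sphere_proj t) * sphere_proj t ord0 i).
  apply: bmeasM; last exact: bmeas_sphere_coord.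
  exact: (bmeas_lipschitz_sphere rescale_ge0 (lipschitz_rescale z)).
rewrite -bmeas_RintegralB//; apply: bmeas_norm_Rintegral_le; first exact: bmeasB.
move=> z; rewrite -mulrBl normrM -[leRHS]mulr1; apply: ler_pM => //.
  by rewrite (le_trans (fL _ _))// opprD addrACA subrr addr0.
exact: le_trans (coord_le_enorm _ _) (enorm_sphere_proj_le1 _).
Qed.

Lemma measurable_smoothed_grad : measurable_fun setT smoothed_grad.
Proof.
apply/measurable_fun_rVP => i; apply: lipschitz_measurable (smoothed_grad_lipschitz i).
by rewrite !mulr_ge0// invr_ge0 ltW.
Qed.

End smoothed.

(** * Rotations mixing two vectors *)

Section rotation.
Context {R : realType} {n : nat}.
Notation lam := (@lebesgue_rV R n).
Notation VV := ('rV[R]_n * 'rV[R]_n)%type.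
Local Open Scope ereal_scope.

Definition shear1 (a : R) (p : VV) : VV := (p.1 + a *: p.2, p.2)%R.
Definition shear2 (a : R) (p : VV) : VV := (p.1, p.2 + a *: p.1)%R.
Definition rot (c s : R) (p : VV) : VV := (c *: p.1 + s *: p.2, c *: p.2 - s *: p.1)%R.

Lemma measurable_shear1 a : measurable_fun setT (shear1 a).
Proof.
apply: measurable_fun_pair => //; apply: measurable_rVD => //.
by apply: measurable_rVZ => //; exact: measurable_snd.
Qed.

Lemma measurable_shear2 a : measurable_fun setT (shear2 a).
Proof.
apply: measurable_fun_pair => //; apply: measurable_rVD => //.
by apply: measurable_rVZ => //; exact: measurable_fst.
Qed.

Lemma measurable_rot c s : measurable_fun setT (rot c s).
Proof.
apply: measurable_fun_pair.
  by apply: measurable_rVD; apply: measurable_rVZ.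
by apply: measurable_rVB; apply: measurable_rVZ.
Qed.

Lemma integral_shear1 a (F : VV -> \bar R) : measurable_fun setT F ->
  (forall p, 0 <= F p) ->
  \int[lam \x lam]_p F (shear1 a p) = \int[lam \x lam]_p F p.
Proof.
move=> mF F0; rewrite !fubini_tonelli2//; last first.
  by apply: measurableT_comp => //; exact: measurable_shear1.
apply: eq_integral => y _; rewrite /fubini_G /shear1/=.
by rewrite (integral_rV_shift (a *: y) (f := fun x => F (x, y)))//;
  apply: measurableT_comp => //; exact: pair2_measurable.
Qed.

Lemma integral_shear2 a (F : VV -> \bar R) : measurable_fun setT F ->
  (forall p, 0 <= F p) ->
  \int[lam \x lam]_p F (shear2 a p) = \int[lam \x lam]_p F p.
Proof.
move=> mF F0; rewrite !fubini_tonelli1//; last first.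
  by apply: measurableT_comp => //; exact: measurable_shear2.
apply: eq_integral => x _; rewrite /fubini_F /shear2/=.
by rewrite (integral_rV_shift (a *: x) (f := fun y => F (x, y)))//;
  apply: measurableT_comp => //; exact: pair1_measurable.
Qed.

(** A rotation is a product of three shears, the outer ones of slope tan(a/2)
    for an angle a. Each shear translates one component by a multiple of the
    other, so invariance under translations is enough for invariance under
    rotations. *)
Lemma rot_shear (c s : R) p : (s != 0 -> c ^+ 2 + s ^+ 2 = 1 ->
  rot c s p = shear1 ((1 - c) / s) (shear2 (- s) (shear1 ((1 - c) / s) p)))%R.
Proof.
move=> s0 cs; have s2 : (s ^+ 2 = (1 - c) * (1 + c))%R.
  by apply: (addrI (c ^+ 2)%R); rewrite cs; ring.
have E : ((1 - c) / s * (1 + c) = s)%R.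
  by rewrite mulrAC -s2 expr2 mulfK.
rewrite /rot /shear1 /shear2/=; congr pair; apply/rowP => i; rewrite !mxE.
  rewrite -[X in (_ + X * _ = _)%R]E; field; exact/s0.
by field.
Qed.

Lemma integral_rot (c s : R) (F : VV -> \bar R) : (s != 0)%R ->
  (c ^+ 2 + s ^+ 2 = 1)%R -> measurable_fun setT F -> (forall p, 0 <= F p) ->
  \int[lam \x lam]_p F (rot c s p) = \int[lam \x lam]_p F p.
Proof.
move=> s0 cs mF F0; set a := ((1 - c) / s)%R.
rewrite -[RHS](integral_shear1 a)//.
rewrite -[RHS](integral_shear2 (- s)%R)//; last first.
  by apply: measurableT_comp => //; exact: measurable_shear1.
rewrite -[RHS](integral_shear1 a)//; last first.
  apply: (measurableT_comp mF); apply: (measurableT_comp (measurable_shear1 a)).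
  exact: measurable_shear2.
by apply: eq_integral => p _; rewrite rot_shear.
Qed.

Lemma integral_swap (F : VV -> \bar R) : measurable_fun setT F ->
  (forall p, 0 <= F p) ->
  \int[lam \x lam]_p F (p.2, p.1) = \int[lam \x lam]_p F p.
Proof.
move=> mF F0; rewrite fubini_tonelli1// ?fubini_tonelli2//.
apply: (measurableT_comp mF); apply: measurable_fun_pair => //.
Qed.

End rotation.

(** * A thin shell in the space of pairs *)

Section polar_product.
Context {R : realType} {n : nat}.
Notation lam := (@lebesgue_rV R n).
Notation PB := (@unif_ball R n).
Local Open Scope ereal_scope.

Lemma integral_polarM (k : 'rV[R]_n -> \bar R) (w : R -> \bar R) : (0 < n)%N ->
  measurable_fun setT k -> (forall y, 0 <= k y) ->
  measurable_fun setT w -> (forall r, 0 <= w r) ->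
  \int[lam]_y (k (sphere_proj y) * w (enorm y)) =
  \int[PB]_z k (sphere_proj z) * \int[lam]_y w (enorm y).
Proof.
move=> n0 mk k0 mw w0.
rewrite (integral_polar (Phi := fun p => k p.2 * w p.1))//; last 2 first.
- apply: emeasurable_funM; first exact: (measurableT_comp mk measurable_snd).
  exact: (measurableT_comp mw measurable_fst).
- by move=> p; rewrite mule_ge0.
rewrite /= -ge0_integralZl//; last 2 first.
- exact: (measurableT_comp mw measurable_enorm).
- by apply: integral_ge0.
apply: eq_integral => y _; rewrite ge0_integralZr//.
exact: (measurableT_comp mk measurable_sphere_proj).
Qed.

End polar_product.

Section shell.
Context {R : realType} {n : nat}.
Notation lam := (@lebesgue_rV R n).
Notation PB := (@unif_ball R n).
Notation V := (ball_vol (R := R) (n := n)).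
Notation VV := ('rV[R]_n * 'rV[R]_n)%type.
Variable eps : R.
Hypotheses (n0 : (0 < n)%N) (eps0 : 0 < eps) (eps1 : eps < 1).

(** The weight replaces the surface measure of the unit sphere of R^n x
    R^n: it is a density, so that Fubini applies, and it depends on |x|
    and |y| only through |x|^2 + |y|^2, which the rotations mixing x and y
    preserve. *)
Definition shell_weight (a b : R) : R :=
  if 1 - eps <= a ^+ 2 + b ^+ 2 <= 1 then 1 else 0.

Lemma shell_weight_ge0 a b : 0 <= shell_weight a b.
Proof. by rewrite /shell_weight; case: ifP. Qed.

Lemma shell_weight_le a b x y : (1 - eps <= a ^+ 2 + b ^+ 2 -> a ^+ 2 + b ^+ 2 <= 1 -> x <= y) ->
  x * shell_weight a b <= y * shell_weight a b.
Proof.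
rewrite /shell_weight => H; case: ifP => [/andP[p q]|_]; last by rewrite !mulr0.
by rewrite !mulr1; exact: H.
Qed.

Lemma shell_weight_radial (a b a' b' : R) : a ^+ 2 + b ^+ 2 = a' ^+ 2 + b' ^+ 2 ->
  shell_weight a b = shell_weight a' b'.
Proof. by rewrite /shell_weight => ->. Qed.

Lemma shell_weight_indic (a b : R) : shell_weight a b =
  \1_([set q : R * R | 1 - eps <= q.1 ^+ 2 + q.2 ^+ 2] `&`
      [set q : R * R | q.1 ^+ 2 + q.2 ^+ 2 <= 1]) (a, b).
Proof.
rewrite /shell_weight indicE; case: ifPn => [/andP[? ?]|H]; first by rewrite mem_set.
by rewrite memNset// => -[/= p q]; move: H; rewrite p q.
Qed.

Lemma measurable_shell_weight : measurable_fun setT (fun q : R * R => shell_weight q.1 q.2).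
Proof.
have m2 : measurable_fun setT (fun q : R * R => q.1 ^+ 2 + q.2 ^+ 2).
  by apply: measurable_funD; apply: measurable_funX.
rewrite (_ : (fun q => _) = \1_([set q : R * R | 1 - eps <= q.1 ^+ 2 + q.2 ^+ 2] `&`
      [set q : R * R | q.1 ^+ 2 + q.2 ^+ 2 <= 1])); last first.
  by apply/funext => -[a b]; rewrite shell_weight_indic.
by apply: measurable_indic; apply: measurableI; apply: measurable_le_set.
Qed.

Let pair_weight (p : VV) := shell_weight (enorm p.1) (enorm p.2).

Let measurable_pair_weight : measurable_fun setT pair_weight.
Proof.
apply: (measurableT_comp (f := fun q : R * R => shell_weight q.1 q.2) measurable_shell_weight
  (g := fun p : VV => (enorm p.1, enorm p.2))).
apply: measurable_fun_pair.
  exact: (measurableT_comp measurable_enorm measurable_fst).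
exact: (measurableT_comp measurable_enorm measurable_snd).
Qed.

Definition shell_int (Phi : VV -> R) : \bar R :=
  (\int[lam \x lam]_p (Phi p * shell_weight (enorm p.1) (enorm p.2))%:E)%E.

Definition nonneg_measurable (Phi : VV -> R) :=
  measurable_fun setT Phi /\ forall p, 0 <= Phi p.

Let measurable_weighted Phi : nonneg_measurable Phi ->
  measurable_fun setT (fun p => (Phi p * shell_weight (enorm p.1) (enorm p.2))%:E).
Proof. by move=> [mP _]; apply/measurable_EFinP; exact: measurable_funM. Qed.

Let weighted_ge0 Phi : nonneg_measurable Phi ->
  forall p, (0 <= (Phi p * shell_weight (enorm p.1) (enorm p.2))%:E)%E.
Proof. by move=> [_ P0] p; rewrite lee_fin mulr_ge0// shell_weight_ge0. Qed.

Lemma shell_int_le Phi Psi : nonneg_measurable Phi -> nonneg_measurable Psi ->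
  (forall x y, enorm x ^+ 2 + enorm y ^+ 2 <= 1 ->
     1 - eps <= enorm x ^+ 2 + enorm y ^+ 2 -> Phi (x, y) <= Psi (x, y)) ->
  (shell_int Phi <= shell_int Psi)%E.
Proof.
move=> hP hQ H; apply: ge0_le_integral => //; [|exact: measurable_weighted|exact: measurable_weighted|].
- by move=> p _; exact: weighted_ge0.
- by move=> [x y] _; rewrite lee_fin shell_weight_le// => ? ?; exact: H.
Qed.

Lemma shell_intD Phi Psi : nonneg_measurable Phi -> nonneg_measurable Psi ->
  shell_int (fun p => Phi p + Psi p) = (shell_int Phi + shell_int Psi)%E.
Proof.
move=> hP hQ; rewrite /shell_int -ge0_integralD//; first last.
- exact: measurable_weighted.
- by move=> p _; exact: weighted_ge0.
- exact: measurable_weighted.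
- by move=> p _; exact: weighted_ge0.
by apply: eq_integral => p _; rewrite mulrDl EFinD.
Qed.

Lemma shell_intZ (k : R) Phi : 0 <= k -> nonneg_measurable Phi ->
  shell_int (fun p => k * Phi p) = (k%:E * shell_int Phi)%E.
Proof.
move=> k0 hP; rewrite /shell_int -ge0_integralZl//; first last.
- by move=> p _; exact: weighted_ge0.
- exact: measurable_weighted.
by apply: eq_integral => p _; rewrite -mulrA EFinM.
Qed.

Lemma enorm_rot (c s : R) (p : VV) : c ^+ 2 + s ^+ 2 = 1 ->
  enorm (rot c s p).1 ^+ 2 + enorm (rot c s p).2 ^+ 2 =
  enorm p.1 ^+ 2 + enorm p.2 ^+ 2.
Proof.
move=> cs; rewrite /rot/= sqr_enormD sqr_enormB !enormZ !exprMn !real_normK ?num_real//.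
rewrite !dotvZl !dotvZr (dotvC p.2 p.1).
rewrite -[RHS]mul1r -cs; ring.
Qed.

Lemma shell_int_rot c s Phi : s != 0 -> c ^+ 2 + s ^+ 2 = 1 -> nonneg_measurable Phi ->
  shell_int (fun p => Phi (rot c s p)) = shell_int Phi.
Proof.
move=> s0 cs hP; rewrite /shell_int.
rewrite -[RHS](integral_rot s0 cs (measurable_weighted hP) (weighted_ge0 hP)).
apply: eq_integral => p _; congr (_ * _)%:E.
by apply: shell_weight_radial; rewrite enorm_rot.
Qed.

Lemma shell_int_swap Phi : nonneg_measurable Phi -> shell_int (fun p => Phi (p.2, p.1)) = shell_int Phi.
Proof.
move=> hP; rewrite /shell_int -[RHS](integral_swap (measurable_weighted hP) (weighted_ge0 hP)).
apply: eq_integral => p _; congr (_ * _)%:E.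
by apply: shell_weight_radial; rewrite addrC.
Qed.

Lemma nonneg_cst (k : R) : 0 <= k -> nonneg_measurable (fun=> k).
Proof. by move=> k0; split. Qed.

Lemma nonneg_sqr (f : VV -> R) : measurable_fun setT f -> nonneg_measurable (fun p => f p ^+ 2).
Proof. by move=> mf; split; [exact: measurable_funX|move=> p; exact: sqr_ge0]. Qed.

Lemma nonnegZ (k : R) f : 0 <= k -> nonneg_measurable f -> nonneg_measurable (fun p => k * f p).
Proof.
move=> k0 [mf f0]; split; first exact: measurable_funM.
by move=> p; exact: mulr_ge0.
Qed.

Lemma nonnegD f g : nonneg_measurable f -> nonneg_measurable g -> nonneg_measurable (fun p => f p + g p).
Proof.
move=> [mf f0] [mg g0]; split; first exact: measurable_funD.
by move=> p; exact: addr_ge0.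
Qed.

Definition shell_mass : R := fine (shell_int (fun=> 1)).
Notation M := shell_mass.

Lemma shell_int1_bounds : (0 < shell_int (fun=> 1%R) < +oo)%E.
Proof.
pose S := [set p : VV | 1 - eps <= enorm p.1 ^+ 2 + enorm p.2 ^+ 2]
  `&` [set p : VV | enorm p.1 ^+ 2 + enorm p.2 ^+ 2 <= 1].
have mq : measurable_fun setT (fun p : VV => enorm p.1 ^+ 2 + enorm p.2 ^+ 2).
  apply: measurable_funD; apply: measurable_funX.
    exact: (measurableT_comp measurable_enorm measurable_fst).
  exact: (measurableT_comp measurable_enorm measurable_snd).
have mS : measurable S by apply: measurableI; apply: measurable_le_set.
have -> : shell_int (fun=> 1) = (lam \x lam)%E S.
  transitivity (\int[(lam \x lam)%E]_p (\1_S p : R)%:E)%E; last first.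
    by rewrite integral_indic// setIT.
  apply: eq_integral => p _; rewrite mul1r shell_weight_indic; congr EFin.
have e0 := eps0; have e1 := eps1.
apply/andP; split.
  (* The product of two layers r1 < |x|, |y| <= r2 lies in the shell. *)
  pose r2 : R := Num.sqrt 2^-1; pose r1 : R := Num.sqrt ((1 - eps) / 2).
  have r10 : 0 <= r1 by exact: sqrtr_ge0.
  have r20 : 0 <= r2 by exact: sqrtr_ge0.
  have r1E : r1 ^+ 2 = (1 - eps) / 2 by rewrite sqr_sqrtr//; lra.
  have r2E : r2 ^+ 2 = 2^-1 by rewrite sqr_sqrtr//; lra.
  have r12 : r1 < r2 by rewrite -(@ltr_pXn2r _ 2)// ?nnegrE// r1E r2E; lra.
  pose B1 := [set x : 'rV[R]_n | enorm x <= r1].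
  pose B2 := [set x : 'rV[R]_n | enorm x <= r2].
  pose A := B2 `\` B1.
  have mA : measurable A by apply: measurableD; exact: measurable_rball.
  have A0 : (0 < lam A)%E.
    rewrite lt_neqAle measure_ge0 andbT eq_sym; apply/negP => /eqP A0.
    have : (lam B2 <= lam B1)%E.
      apply: (@le_trans _ _ (lam (B1 `|` A))).
        apply: le_measure; rewrite ?inE; [exact: measurable_rball| |].
          by apply: measurableU => //; exact: measurable_rball.
        move=> x /= xr; have [?|?] := leP (enorm x) r1; [by left|right].
        by split => //; apply/negP; rewrite -ltNge.
      apply: (le_trans (measureU2 _ _ _)) => //; first exact: measurable_rball.
      by rewrite [X in (_ + X)%E]A0 adde0.
    rewrite /B1 /B2 !lebesgue_rball// lee_fin ler_pM2r ?ball_vol_gt0// leNgt => /negP; apply.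
    by rewrite ltrXn2r// gtn_eqF.
  apply: (@lt_le_trans _ _ ((lam \x lam)%E (A `*` A))).
    by rewrite product_measure1E// mule_gt0.
  apply: le_measure; rewrite ?inE//; first exact: measurableX.
  move=> [x y] [/= [x2 /negP x1] [y2 /negP y1]].
  rewrite -ltNge in x1; rewrite -ltNge in y1.
  have sq (z : 'rV[R]_n) : r1 < enorm z -> enorm z <= r2 ->
      (1 - eps) / 2 <= enorm z ^+ 2 <= 2^-1.
    move=> z1 z2; rewrite -r1E -r2E !lerXn2r ?nnegrE ?enorm_ge0//.
    by rewrite ltW.
  have /andP[? ?] := sq _ x1 x2; have /andP[? ?] := sq _ y1 y2.
  by split => /=; lra.
apply: (@le_lt_trans _ _ ((lam \x lam)%E (eball `*` eball))).
  apply: le_measure; rewrite ?inE//.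
    by apply: measurableX; exact: measurable_eball.
  have sq (a b : R) : 0 <= a -> a ^+ 2 + b ^+ 2 <= 1 -> a <= 1.
    by move=> a0 H; rewrite -(@ler_pXn2r _ 2)// ?nnegrE// expr1n; have := sqr_ge0 b; lra.
  move=> [x y] [/= _ H]; split; rewrite /eball/=.
    by apply: sq H; exact: enorm_ge0.
  by apply: (sq _ (enorm x)); [exact: enorm_ge0|rewrite addrC].
rewrite product_measure1E; [|exact: measurable_eball..].
by rewrite [X in (X * _)%E]ball_volE [X in (_ * X)%E]ball_volE -EFinM ltry.
Qed.

Lemma shell_int1 : shell_int (fun=> 1) = M%:E.
Proof.
have /andP[h0 h1] := shell_int1_bounds.
by rewrite /M fineK// ge0_fin_numE// ltW.
Qed.

Lemma shell_mass_gt0 : 0 < M.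
Proof. by have /andP[] := shell_int1_bounds; rewrite shell_int1 lte_fin. Qed.

Lemma shell_int_cst k : 0 <= k -> shell_int (fun=> k) = (k * M)%:E.
Proof.
move=> k0; have := shell_intZ k0 (nonneg_cst ler01).
by rewrite shell_int1 -EFinM => <-; congr shell_int; apply/funext => p; rewrite mulr1.
Qed.

Let me1 : measurable_fun setT (fun p : VV => enorm p.1).
Proof. exact: (measurableT_comp measurable_enorm measurable_fst). Qed.

Let me2 : measurable_fun setT (fun p : VV => enorm p.2).
Proof. exact: (measurableT_comp measurable_enorm measurable_snd). Qed.

(** The exchange of x and y shows that |x|^2 and |y|^2 have the same integral,
    and their sum is at most 1 on the shell. *)
Lemma shell_half : (shell_int (fun p => (enorm p.2 ^+ 2)%R) <= (M / 2)%:E)%E.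
Proof.
have h1 := nonneg_sqr me1; have h2 := nonneg_sqr me2.
have E : shell_int (fun p => enorm p.1 ^+ 2) = shell_int (fun p => enorm p.2 ^+ 2).
  by rewrite -(shell_int_swap h2).
have : (shell_int (fun p => (enorm p.1 ^+ 2)%R) + shell_int (fun p => (enorm p.2 ^+ 2)%R) <= M%:E)%E.
  rewrite -shell_intD// -shell_int1; apply: shell_int_le; [exact: nonnegD|exact: nonneg_cst|].
  by move=> x y H _.
rewrite E; move: (shell_int _) => [r| |]//.
- by rewrite -EFinD !lee_fin; lra.
- by move=> _; rewrite leNye.
Qed.

(** For fixed x the weight depends on |y| only, so the direction of y is
    uniform and sphere_isotropic applies. *)
Lemma shell_isotropic (G : 'rV[R]_n -> 'rV[R]_n) : measurable_fun setT G ->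
  (shell_int (fun p => (dotv (G p.1) p.2 ^+ 2)%R) <=
   n%:R^-1%:E * shell_int (fun p => (enorm (G p.1) ^+ 2 * enorm p.2 ^+ 2)%R))%E.
Proof.
move=> mG.
have mG1 : measurable_fun setT (fun p : VV => G p.1).
  by apply: (measurableT_comp mG); exact: measurable_fst.
have h1 : nonneg_measurable (fun p => dotv (G p.1) p.2 ^+ 2).
  by apply: nonneg_sqr; apply: measurable_dotv => //; exact: measurable_snd.
have h2 : nonneg_measurable (fun p => enorm (G p.1) ^+ 2 * enorm p.2 ^+ 2).
  split; last by move=> p; rewrite mulr_ge0// sqr_ge0.
  apply: measurable_funM; apply: measurable_funX => //.
  exact: (measurableT_comp measurable_enorm).
rewrite -shell_intZ ?invr_ge0//.
have h3 : nonneg_measurable (fun p => n%:R^-1 * (enorm (G p.1) ^+ 2 * enorm p.2 ^+ 2)).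
  by apply: nonnegZ; rewrite ?invr_ge0.
rewrite /shell_int !fubini_tonelli1//; [|exact: measurable_weighted h3|exact: weighted_ge0 h3
                                 |exact: measurable_weighted h1|exact: weighted_ge0 h1].
have mF (Phi : VV -> R) : nonneg_measurable Phi -> forall x, measurable_fun setT
    (fun y => (Phi (x, y) * shell_weight (enorm x) (enorm y))%:E).
  move=> hP x; have := measurable_weighted hP => /measurableT_comp/(_ (pair1_measurable x)).
  exact.
apply: ge0_le_integral => //.
- by move=> x _; apply: integral_ge0 => y _; exact: weighted_ge0 h1 _.
- by apply: measurable_fun_fubini_tonelli_F; [exact: measurable_weighted h1|exact: weighted_ge0 h1].
- by apply: measurable_fun_fubini_tonelli_F; [exact: measurable_weighted h3|exact: weighted_ge0 h3].
move=> x _; rewrite /fubini_F/=.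
pose w (r : R) := (r ^+ 2 * shell_weight (enorm x) r)%:E.
have mw : measurable_fun setT w.
  apply/measurable_EFinP; apply: measurable_funM; first exact: measurable_funX.
  apply: (measurableT_comp measurable_shell_weight (g := fun r : R => (enorm x, r))).
  exact: measurable_fun_pair.
have w0 r : (0 <= w r)%E by rewrite lee_fin mulr_ge0 ?sqr_ge0 ?shell_weight_ge0.
pose k (y : 'rV[R]_n) := (dotv (G x) y ^+ 2)%:E.
have mk : measurable_fun setT k.
  by apply/measurable_EFinP; apply: measurable_funX; exact: measurable_dotv.
have k0 y : (0 <= k y)%E by rewrite lee_fin sqr_ge0.
rewrite (_ : \int[lam]_y _ = \int[lam]_y (k (sphere_proj y) * w (enorm y)))%E; last first.
  apply: eq_integral => y _; rewrite /k /w -EFinM mulrA -exprMn; congr (_ ^+ 2 * _)%:E.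
  by rewrite -{1}[y]sphere_projK dotvZr mulrC.
rewrite integral_polarM//.
rewrite [leRHS](_ : _ =
  (n%:R^-1 * enorm (G x) ^+ 2)%:E * \int[lam]_y w (enorm y))%E; last first.
  rewrite -ge0_integralZl//; first last.
  - by rewrite lee_fin mulr_ge0 ?invr_ge0 ?sqr_ge0.
  - exact: (measurableT_comp mw measurable_enorm).
  by apply: eq_integral => y _; rewrite /w -EFinM !mulrA.
apply: lee_wpmul2r; first by apply: integral_ge0.
rewrite bmeas_EFin_Rintegral; last exact/bmeasX/bmeas_sphere_dotv.
by rewrite lee_fin mulrC; exact: sphere_isotropic.
Qed.

(** The directions of x and y are independent and uniform for the weight,
    which depends on the norms only. *)
Lemma shell_int_sphere (Psi : VV -> R) : nonneg_measurable Psi ->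
  shell_int (fun p => Psi (sphere_proj p.1, sphere_proj p.2)) =
  (\int[PB]_z \int[PB]_z' (Psi (sphere_proj z, sphere_proj z'))%:E * M%:E)%E.
Proof.
move=> [mP P0].
pose q (t : 'rV[R]_n) := (\int[PB]_z' (Psi (t, sphere_proj z'))%:E)%E.
have mPs : measurable_fun setT (fun p : VV => (Psi (p.1, sphere_proj p.2))%:E).
  apply/measurable_EFinP; apply: (measurableT_comp mP).
  apply: measurable_fun_pair => //.
  exact: (measurableT_comp measurable_sphere_proj measurable_snd).
have mq : measurable_fun setT q.
  apply: (@measurable_fun_fubini_tonelli_F _ _ _ _ _ PB
    (fun p : VV => (Psi (p.1, sphere_proj p.2))%:E)) => // p.
  by rewrite lee_fin.
have q0 t : (0 <= q t)%E by apply: integral_ge0 => z _; rewrite lee_fin.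
have mpp : measurable_fun setT (fun p : VV => Psi (sphere_proj p.1, sphere_proj p.2)).
  apply: (measurableT_comp mP); apply: measurable_fun_pair.
    exact: (measurableT_comp measurable_sphere_proj measurable_fst).
  exact: (measurableT_comp measurable_sphere_proj measurable_snd).
have hpp : nonneg_measurable (fun p : VV => Psi (sphere_proj p.1, sphere_proj p.2)) by split.
pose w (p : VV) := (shell_weight (enorm p.1) (enorm p.2))%:E.
have mw : measurable_fun setT w by apply/measurable_EFinP.
have w0 p : (0 <= w p)%E by rewrite lee_fin shell_weight_ge0.
have mw1 (a : R) : measurable_fun setT (fun r => (shell_weight a r)%:E).
  apply/measurable_EFinP; apply: (measurableT_comp measurable_shell_weight (g := fun r : R => (a, r))).
  exact: measurable_fun_pair.
have mw2 (b : R) : measurable_fun setT (fun r => (shell_weight r b)%:E).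
  apply/measurable_EFinP; apply: (measurableT_comp measurable_shell_weight (g := fun r : R => (r, b))).
  exact: measurable_fun_pair.
rewrite /shell_int fubini_tonelli1; [|exact: measurable_weighted hpp|exact: weighted_ge0 hpp].
transitivity (\int[lam \x lam]_p (q (sphere_proj p.1) * w p))%E.
  rewrite [RHS]fubini_tonelli1; first last.
  - by move=> p; rewrite mule_ge0.
  - apply: emeasurable_funM => //; apply: (measurableT_comp mq).
    exact: (measurableT_comp measurable_sphere_proj measurable_fst).
  apply: eq_integral => x _; rewrite /fubini_F/=.
  rewrite ge0_integralZl//; last first.
    by rewrite /w/=; exact: (measurableT_comp (mw1 _) measurable_enorm).
  under [LHS]eq_integral do rewrite EFinM.
  rewrite (integral_polarM (k := fun t => (Psi (sphere_proj x, t))%:E)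
     (w := fun r => (shell_weight (enorm x) r)%:E))//.
    apply/measurable_EFinP; apply: (measurableT_comp mP); exact: pair1_measurable.
  by move=> r; rewrite lee_fin P0.
  by move=> r; rewrite lee_fin shell_weight_ge0.
have mqw : measurable_fun setT (fun p : VV => q (sphere_proj p.1) * w p)%E.
  apply: emeasurable_funM => //; apply: (measurableT_comp mq).
  exact: (measurableT_comp measurable_sphere_proj measurable_fst).
rewrite fubini_tonelli2//; last by move=> p; rewrite mule_ge0.
have -> : M%:E = (\int[lam]_y \int[lam]_x w (x, y))%E.
  rewrite -shell_int1 /shell_int fubini_tonelli2; first last.
  - by move=> p; rewrite lee_fin mul1r shell_weight_ge0.
  - by under eq_fun do rewrite mul1r.
  by apply: eq_integral => y _; apply: eq_integral => x _; rewrite mul1r.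
rewrite -ge0_integralZl//; first last.
- by apply: integral_ge0 => z _; exact: q0.
- by move=> y _; apply: integral_ge0.
- exact: measurable_fun_fubini_tonelli_G.
apply: eq_integral => y _; rewrite /fubini_G/=.
rewrite (integral_polarM (w := fun r => (shell_weight r (enorm y))%:E))//.
by move=> r; rewrite lee_fin shell_weight_ge0.
Qed.

End shell.

(** * Variance of a Lipschitz function of a direction *)

Section trig.
Context {R : realType}.

Lemma sin_le_id (a : R) : 0 <= a -> `|sin a| <= a.
Proof.
move=> a0; have [c _] := @MVT_segment R sin cos 0 a a0
  (fun x _ => is_derive_sin x) (continuous_subspaceT (@continuous_sin R)).
rewrite sin0 !subr0 => ->; rewrite normrM (ger0_norm a0) ler_piMl//.
by rewrite ler_norml cos_geN1 cos_le1.
Qed.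

Lemma cos_ge_quadratic (a : R) : 0 <= a -> 1 - cos a <= a ^+ 2 / 2.
Proof.
move=> a0; have {1}-> : a = a / 2 + a / 2 by field.
have c1 := cos2Dsin2 (a / 2).
have s1 : sin (a / 2) ^+ 2 <= (a / 2) ^+ 2.
  rewrite -[sin _ ^+ 2]real_normK ?num_real// lerXn2r ?nnegrE//; first by lra.
  by apply: sin_le_id; lra.
rewrite cosD -!expr2; lra.
Qed.

End trig.

Section poincare.
Context {R : realType} {n : nat}.
Notation lam := (@lebesgue_rV R n).
Notation PB := (@unif_ball R n).
Notation VV := ('rV[R]_n * 'rV[R]_n)%type.
Variable eps : R.
Hypotheses (n0 : (0 < n)%N) (eps0 : 0 < eps) (eps1 : eps < 1).
Notation shell_int := (@shell_int R n eps).
Notation M := (@shell_mass R n eps).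

Let M0 : 0 < M. Proof. exact: shell_mass_gt0. Qed.

Let nV : n%:R != 0 :> R. Proof. by rewrite pnatr_eq0 -lt0n. Qed.

Section smooth.
Variables (phi : 'rV[R]_n -> R) (G : 'rV[R]_n -> 'rV[R]_n) (l C : R).
Hypotheses (l0 : 0 <= l) (C0 : 0 <= C).
Hypothesis mphi : measurable_fun setT phi.
Hypothesis mG : measurable_fun setT G.
Hypothesis phiG : forall x v, `|phi (x + v) - phi x - dotv v (G x)| <= C * enorm v ^+ 2.
Hypothesis Gl : forall x, enorm (G x) <= l.

Let incr (c s : R) (p : VV) := phi (c *: p.1 + s *: p.2) - phi p.1.

Let mincr c s : measurable_fun setT (incr c s).
Proof.
apply: measurable_funB; last exact: (measurableT_comp mphi measurable_fst).
by apply: (measurableT_comp mphi); apply: measurable_rVD; apply: measurable_rVZ.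
Qed.

Let D (a : R) := shell_int (fun p => incr (cos a) (sin a) p ^+ 2).

(** For the rotation R by the angle a, phi (R^2 p) - phi (p) is the sum of two
    increments that have the same distribution by rotation invariance. *)
Let D_double (a : R) : sin a != 0 -> (D (a + a) <= 4%:E * D a)%E.
Proof.
move=> s0.
have h1 := nonneg_sqr (mincr (cos a) (sin a)).
have h1r : nonneg_measurable (fun p => incr (cos a) (sin a) (rot (cos a) (sin a) p) ^+ 2).
  by apply: nonneg_sqr; apply: measurableT_comp => //; exact: measurable_rot.
have E : shell_int (fun p => incr (cos a) (sin a) (rot (cos a) (sin a) p) ^+ 2) = D a.
  exact: (shell_int_rot eps s0 (cos2Dsin2 a) h1).
have -> : (4%:E * D a = shell_int (fun p => (2 * incr (cos a) (sin a) p ^+ 2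
    + 2 * incr (cos a) (sin a) (rot (cos a) (sin a) p) ^+ 2)%R))%E.
  rewrite shell_intD; [|exact: nonnegZ|exact: nonnegZ].
  rewrite !shell_intZ// E -ge0_muleDl ?lee_fin//.
  by rewrite -EFinD -/(D a) (_ : (2 + 2 = 4 :> R)%R); last by ring.
rewrite /D; apply: shell_int_le; [exact: (nonneg_sqr (mincr _ _))|by apply: nonnegD; apply: nonnegZ|].
move=> x y _ _; rewrite /incr/rot/=.
have -> : cos (a + a) *: x + sin (a + a) *: y =
    cos a *: (cos a *: x + sin a *: y) + sin a *: (cos a *: y - sin a *: x).
  by rewrite cosD sinD; apply/rowP => i; rewrite !mxE; ring.
set p := phi _; set q := phi (cos a *: x + _); set r := phi x.
have := sqr_ge0 ((q - r) - (p - q)); nra.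
Qed.

(* For 0 <= a, phi (cos a x + sin a y) is phi (x) + sin a (G x . y) up to K
   a^2 on the shell. *)
Let K := l + 16 * C.

(** The first order term of the increment, sin a (G x . y), has a square
    of mean at most a^2 l^2 / (2 n), by shell_isotropic and shell_half;
    separating it from the error, which is quadratic in a, costs a factor
    2. *)
Let D_small (a : R) : 0 <= a <= 2 ->
  (D a <= ((a ^+ 2 * l ^+ 2 / n%:R + 2 * K ^+ 2 * a ^+ 4) * M)%:E)%E.
Proof.
move=> /andP[a0 a2].
have s1 := sin_le_id a0; have c1 := cos_ge_quadratic a0; have c2 := cos_le1 a.
have mdG : measurable_fun setT (fun p : VV => dotv (G p.1) p.2).
  apply: measurable_dotv => //; exact: (measurableT_comp mG measurable_fst).
have hG := nonneg_sqr mdG.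
have k1 : 0 <= 2 * a ^+ 2 by rewrite mulr_ge0// sqr_ge0.
have k2 : 0 <= 2 * K ^+ 2 * a ^+ 4 by rewrite mulr_ge0 ?exprn_ge0// mulr_ge0 ?sqr_ge0.
apply: (@le_trans _ _ (shell_int (fun p => 2 * a ^+ 2 * dotv (G p.1) p.2 ^+ 2
    + 2 * K ^+ 2 * a ^+ 4))).
  apply: shell_int_le; first exact: (nonneg_sqr (mincr _ _)).
    by apply: nonnegD; [exact: nonnegZ|exact: nonneg_cst].
  move=> x y H _; rewrite /incr/=.
  have x1 : enorm x <= 1.
    rewrite -(@ler_pXn2r _ 2)// ?nnegrE ?enorm_ge0// expr1n.
    by have := sqr_ge0 (enorm y); lra.
  have y1 : enorm y <= 1.
    rewrite -(@ler_pXn2r _ 2)// ?nnegrE ?enorm_ge0// expr1n.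
    by have := sqr_ge0 (enorm x); lra.
  pose v := (cos a - 1) *: x + sin a *: y.
  have -> : cos a *: x + sin a *: y = x + v.
    by apply/rowP => i; rewrite !mxE; ring.
  have v1 : enorm v <= 2 * a.
    rewrite (le_trans (enormD _ _))// !enormZ.
    have : `|cos a - 1| <= a by rewrite ler0_norm ?subr_le0//; nra.
    move=> H1; have : `|cos a - 1| * enorm x <= a * 1 by rewrite ler_pM// enorm_ge0.
    have : `|sin a| * enorm y <= a * 1 by rewrite ler_pM// enorm_ge0.
    lra.
  have v2 : enorm v ^+ 2 <= 4 * a ^+ 2.
    have := enorm_ge0 v; nra.
  have dv : dotv v (G x) = sin a * dotv (G x) y + (cos a - 1) * dotv x (G x).
    by rewrite /v dotvDl !dotvZl (dotvC y); ring.
  set e := phi (x + v) - phi x - sin a * dotv (G x) y.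
  have eK : `|e| <= K * a ^+ 2.
    have -> : e = (phi (x + v) - phi x - dotv v (G x)) + (cos a - 1) * dotv x (G x).
      by rewrite dv /e; ring.
    rewrite (le_trans (ler_normD _ _))// normrM.
    have : `|dotv x (G x)| <= l.
      rewrite (le_trans (dotv_le _ _))// -[leRHS]mul1r ler_pM ?enorm_ge0//.
    move=> H2; have : `|cos a - 1| * `|dotv x (G x)| <= a ^+ 2 / 2 * l.
      by rewrite ler_pM// ler0_norm ?subr_le0//; lra.
    have := phiG x v; have : C * enorm v ^+ 2 <= C * (4 * a ^+ 2) by rewrite ler_wpM2l.
    have : 0 <= a ^+ 2 * l by rewrite mulr_ge0// sqr_ge0.
    have : 0 <= a ^+ 2 * C by rewrite mulr_ge0// sqr_ge0.
    rewrite /K; lra.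
  have -> : phi (x + v) - phi x = sin a * dotv (G x) y + e by rewrite /e; ring.
  have e2 : e ^+ 2 <= K ^+ 2 * a ^+ 4.
    have -> : K ^+ 2 * a ^+ 4 = (K * a ^+ 2) ^+ 2 by ring.
    by rewrite -[e ^+ 2]real_normK ?num_real// lerXn2r ?nnegrE// (le_trans _ eK).
  have s2 : sin a ^+ 2 <= a ^+ 2.
    by rewrite -[sin a ^+ 2]real_normK ?num_real// lerXn2r ?nnegrE.
  have : sin a ^+ 2 * dotv (G x) y ^+ 2 <= a ^+ 2 * dotv (G x) y ^+ 2.
    by rewrite ler_wpM2r// sqr_ge0.
  have := sqr_ge0 (sin a * dotv (G x) y - e).
  rewrite -exprMn; lra.
have hy : nonneg_measurable (fun p : VV => enorm p.2 ^+ 2).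
  by apply: nonneg_sqr; exact: (measurableT_comp measurable_enorm measurable_snd).
have hGy : nonneg_measurable (fun p : VV => enorm (G p.1) ^+ 2 * enorm p.2 ^+ 2).
  split; last by move=> p; rewrite mulr_ge0// sqr_ge0.
  apply: measurable_funM; last by case: hy.
  apply: measurable_funX; apply: (measurableT_comp measurable_enorm).
  exact: (measurableT_comp mG measurable_fst).
have H : (shell_int (fun p => (dotv (G p.1) p.2 ^+ 2)%R) <= (l ^+ 2 / n%:R * (M / 2))%:E)%E.
  apply: (le_trans (shell_isotropic eps n0 mG)).
  have -> : (l ^+ 2 / n%:R * (M / 2) = n%:R^-1 * (l ^+ 2 * (M / 2)))%R by ring.
  rewrite EFinM; apply: lee_wpmul2l; first by rewrite lee_fin invr_ge0.
  apply: (@le_trans _ _ (shell_int (fun p => l ^+ 2 * enorm p.2 ^+ 2))).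
    apply: shell_int_le => //; first by apply: nonnegZ => //; exact: sqr_ge0.
    move=> x y _ _ /=; rewrite ler_wpM2r ?sqr_ge0// lerXn2r ?nnegrE ?enorm_ge0//.
  rewrite shell_intZ ?sqr_ge0// [leRHS]EFinM; apply: lee_wpmul2l; first by rewrite lee_fin sqr_ge0.
  exact: shell_half.
rewrite shell_intD; [|exact: nonnegZ|exact: nonneg_cst].
rewrite shell_intZ// shell_int_cst//.
have -> : ((a ^+ 2 * l ^+ 2 / n%:R + 2 * K ^+ 2 * a ^+ 4) * M =
   2 * a ^+ 2 * (l ^+ 2 / n%:R * (M / 2)) + 2 * K ^+ 2 * a ^+ 4 * M)%R by field.
rewrite EFinD; apply: leeD => //.
by rewrite [leRHS]EFinM; apply: lee_wpmul2l.
Qed.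

Let D_iter k : (D (pi / 2) <= (4 ^+ k)%:E * D (pi / 2 / 2 ^+ k))%E.
Proof.
elim: k => [|k IH]; first by rewrite !expr0 divr1 mul1e.
apply: (le_trans IH); rewrite exprSr EFinM -muleA.
apply: lee_wpmul2l; first by rewrite lee_fin exprn_ge0.
have p0 : 0 < pi / 2 / 2 ^+ k.+1 :> R.
  by rewrite divr_gt0 ?exprn_gt0// divr_gt0// pi_gt0.
have {1}-> : pi / 2 / 2 ^+ k = pi / 2 / 2 ^+ k.+1 + pi / 2 / 2 ^+ k.+1 :> R.
  by rewrite exprS; field; rewrite expf_neq0.
apply: D_double; rewrite gt_eqF//; apply: sin_gt0_pihalf; rewrite p0/=.
rewrite ltr_pdivrMr ?exprn_gt0// ltr_pMr ?divr_gt0 ?pi_gt0//.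
by rewrite exprn_egt1// ltr1n.
Qed.

(** The increment at angle pi / 2 is phi (y) - phi (x). After k halvings, the
    factor 4^k and the square of the angle combine to (pi / 2)^2 <= 4 in the
    main term, while the error term, of order 4 in the angle, is O(4^-k). *)
Lemma shell_smooth :
  (shell_int (fun p => ((phi p.1 - phi p.2) ^+ 2)%R) <= (4 * l ^+ 2 / n%:R * M)%:E)%E.
Proof.
have -> : shell_int (fun p => (phi p.1 - phi p.2) ^+ 2) = D (pi / 2).
  congr shell_int; apply/funext => p; rewrite /incr cos_pihalf sin_pihalf scale0r scale1r add0r.
  by rewrite -sqrrN opprB.
apply/lee_addgt0Pr => e e0.
pose B := 32 * K ^+ 2 * M.
have K2 : 0 <= 2 * K ^+ 2 * M by rewrite mulr_ge0 ?(ltW M0)// mulr_ge0// sqr_ge0.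
have B0 : 0 <= B by rewrite /B mulr_ge0 ?(ltW M0)// mulr_ge0// sqr_ge0.
have [k Bk] : exists k, B / e <= 4 ^+ k.
  exists (Num.trunc (B / e)).+1; rewrite (le_trans (ltW (truncnS_gt _)))//.
  by rewrite -natrX ler_nat ltnW// ltn_expl.
have p1 : 0 < pi / 2 :> R by rewrite divr_gt0// pi_gt0.
have p2 : pi / 2 < 2 :> R := @pihalf_lt2 R.
set a : R := pi / 2 / 2 ^+ k.
have k2 : 0 < 2 ^+ k :> R by rewrite exprn_gt0.
have k4 : 0 < 4 ^+ k :> R by rewrite exprn_gt0.
have k21 : 1 <= 2 ^+ k :> R by rewrite exprn_ege1// ler1n.
have a02 : 0 <= a <= 2.
  rewrite divr_ge0 ?(ltW p1) ?(ltW k2)//= ler_pdivrMr// (le_trans (ltW p2))//.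
  by rewrite ler_peMr.
apply: (le_trans (D_iter k)).
have k40 : (0 <= (4 ^+ k)%:E :> \bar R)%E by rewrite lee_fin ltW.
apply: (le_trans (lee_wpmul2l k40 (D_small a02))).
rewrite -EFinM -EFinD lee_fin.
have a2E : 4 ^+ k * a ^+ 2 = (pi / 2) ^+ 2.
  rewrite /a expr_div_n -exprM mulnC exprM (_ : 2 ^+ 2 = 4 :> R); last by ring.
  by field; rewrite gt_eqF.
have p4 : (pi / 2) ^+ 2 <= 4 :> R by nra.
have -> : 4 ^+ k * ((a ^+ 2 * l ^+ 2 / n%:R + 2 * K ^+ 2 * a ^+ 4) * M) =
  (4 ^+ k * a ^+ 2) * (l ^+ 2 / n%:R * M) + 2 * K ^+ 2 * M * (4 ^+ k * a ^+ 2) ^+ 2 / 4 ^+ k.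
  by field; rewrite nV gt_eqF.
rewrite a2E; apply: lerD.
  have -> : 4 * l ^+ 2 / n%:R * M = 4 * (l ^+ 2 / n%:R * M) by ring.
  by rewrite ler_wpM2r// mulr_ge0 ?(ltW M0)// divr_ge0// sqr_ge0.
rewrite ler_pdivrMr//; rewrite ler_pdivrMr// mulrC in Bk; apply: le_trans Bk.
have -> : B = 2 * K ^+ 2 * M * 4 ^+ 2 by rewrite /B; ring.
by rewrite (ler_wpM2l K2)// lerXn2r ?nnegrE// sqr_ge0.
Qed.

End smooth.

(** Smoothing at the scale eta makes shell_smooth applicable and moves h by at
    most l eta. With (p + e)^2 <= 9/8 p^2 + 9 e^2 the constant 4 becomes 9/2,
    and eta = 1 / (9 n) leaves at most 1/2 for the error. *)
Lemma shell_lipschitz (h : 'rV[R]_n -> R) (l : R) : 0 <= l ->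
  euclidean_lipschitz l h ->
  (shell_int (fun p => ((h p.1 - h p.2) ^+ 2)%R) <= (5 * l ^+ 2 / n%:R * M)%:E)%E.
Proof.
move=> l0 hl.
have n1 : 1 <= n%:R :> R by rewrite ler1n.
pose eta : R := (9 * n%:R)^-1.
have eta0 : 0 < eta by rewrite invr_gt0 mulr_gt0// ltr0n.
have mh := lipschitz_measurable l0 hl.
have sl := smoothed_lipschitz l0 eta0 hl.
have ms := lipschitz_measurable l0 sl.
have main := shell_smooth l0 (taylor_cst_ge0 l0 eta0) ms
  (measurable_smoothed_grad l0 eta0 hl) (smoothed_taylor n0 l0 eta0 hl)
  (enorm_smoothed_grad n0 l0 eta0 hl).
set phi := smoothed eta h in sl ms main.
have hh (g : 'rV[R]_n -> R) : measurable_fun setT g ->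
    nonneg_measurable (fun p : VV => (g p.1 - g p.2) ^+ 2).
  move=> mg; apply: nonneg_sqr; apply: measurable_funB.
    exact: (measurableT_comp mg measurable_fst).
  exact: (measurableT_comp mg measurable_snd).
have k98 : 0 <= 9 / 8 :> R by lra.
have c0 : 0 <= 36 * l ^+ 2 * eta ^+ 2 by rewrite mulr_ge0 ?sqr_ge0// mulr_ge0// sqr_ge0.
apply: (@le_trans _ _ (shell_int (fun p => 9 / 8 * (phi p.1 - phi p.2) ^+ 2
   + 36 * l ^+ 2 * eta ^+ 2))).
  apply: shell_int_le; [exact: hh|apply: nonnegD; [|exact: nonneg_cst]|].
    by apply: nonnegZ; [lra|exact: hh].
  move=> x y _ _ /=.
  have := smoothed_close l0 eta0 hl x; have := smoothed_close l0 eta0 hl y.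
  rewrite -/phi => hy hx.
  set e := (h x - h y) - (phi x - phi y).
  have el : `|e| <= 2 * (l * eta).
    have -> : e = (phi y - h y) - (phi x - h x) by rewrite /e; ring.
    rewrite (le_trans (ler_normB _ _))//; lra.
  have e2 : e ^+ 2 <= (2 * (l * eta)) ^+ 2.
    by rewrite -[e ^+ 2]real_normK ?num_real// lerXn2r ?nnegrE// (le_trans _ el).
  have -> : h x - h y = (phi x - phi y) + e by rewrite /e; ring.
  have := sqr_ge0 ((phi x - phi y) - 8 * e); nra.
rewrite shell_intD; [|by apply: nonnegZ; [lra|exact: hh]|exact: nonneg_cst].
rewrite (shell_intZ eps k98 (hh _ ms)) shell_int_cst//.
apply: (@le_trans _ _ ((9 / 8)%:E * (4 * l ^+ 2 / n%:R * M)%:E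
   + (36 * l ^+ 2 * eta ^+ 2 * M)%:E)%E).
  by apply: leeD => //; apply: lee_wpmul2l => //; rewrite lee_fin; lra.
rewrite -EFinM -EFinD lee_fin.
have eE : eta ^+ 2 <= (72 * n%:R)^-1.
  rewrite /eta exprVn lef_pV2 ?posrE ?mulr_gt0 ?exprn_gt0 ?mulr_gt0 ?ltr0n//.
  by rewrite exprMn; nra.
have : 36 * l ^+ 2 * M * eta ^+ 2 <= 36 * l ^+ 2 * M * (72 * n%:R)^-1.
  by rewrite ler_wpM2l// mulr_ge0 ?(ltW M0)// mulr_ge0// sqr_ge0.
have -> : 36 * l ^+ 2 * M * (72 * n%:R)^-1 = l ^+ 2 / n%:R * M / 2 by field.
lra.
Qed.

Hypothesis eps_small : 2 * eps ^+ 2 <= n%:R^-1.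

(** On the shell 2 |x|^2 - 1 is |x|^2 - |y|^2 up to eps, and the rotation by
    45 degrees turns |x|^2 - |y|^2 into 2 x . y, whose square is small by
    isotropy. *)
Lemma shell_radius :
  (shell_int (fun p => ((2 * enorm p.1 ^+ 2 - 1) ^+ 2)%R) <= (3 / n%:R * M)%:E)%E.
Proof.
have me1 : measurable_fun setT (fun p : VV => enorm p.1).
  exact: (measurableT_comp measurable_enorm measurable_fst).
have me2 : measurable_fun setT (fun p : VV => enorm p.2).
  exact: (measurableT_comp measurable_enorm measurable_snd).
pose d (p : VV) := enorm p.1 ^+ 2 - enorm p.2 ^+ 2.
have md : measurable_fun setT d by apply: measurable_funB; apply: measurable_funX.
have hd := nonneg_sqr md.
pose s : R := Num.sqrt 2^-1.
have s2 : s ^+ 2 = 2^-1 by rewrite sqr_sqrtr// invr_ge0.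
have s0 : s != 0 by rewrite gt_eqF// sqrtr_gt0 invr_gt0.
have ss : s ^+ 2 + s ^+ 2 = 1 by rewrite s2; lra.
have hdot : nonneg_measurable (fun p : VV => dotv p.1 p.2 ^+ 2).
  by apply: nonneg_sqr; exact: measurable_dotv.
have hxy : nonneg_measurable (fun p : VV => enorm p.1 ^+ 2 * enorm p.2 ^+ 2).
  split; last by move=> p; rewrite mulr_ge0// sqr_ge0.
  by apply: measurable_funM; apply: measurable_funX.
have dE : (shell_int (fun p => (d p ^+ 2)%R) <= (n%:R^-1 * M)%:E)%E.
  rewrite -(shell_int_rot eps s0 ss hd).
  have -> : (fun p => d (rot s s p) ^+ 2) = (fun p : VV => 4 * dotv p.1 p.2 ^+ 2).
    apply/funext => p; rewrite /d /rot/= sqr_enormD sqr_enormB !enormZ !exprMn.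
    rewrite !real_normK ?num_real// !dotvZl !dotvZr (dotvC p.2 p.1).
    transitivity ((4 * s ^+ 2 * dotv p.1 p.2) ^+ 2); first by congr (_ ^+ 2); ring.
    by rewrite s2; field.
  rewrite shell_intZ//.
  have -> : (n%:R^-1 * M)%:E = (4%:E * (n%:R^-1%:E * (4^-1 * M)%:E))%E.
    by rewrite -!EFinM; congr EFin; field.
  apply: lee_wpmul2l; first by rewrite lee_fin.
  apply: (le_trans (shell_isotropic eps n0 (G := id) _)); first exact: measurable_id.
  apply: lee_wpmul2l; first by rewrite lee_fin invr_ge0.
  rewrite -(@shell_int_cst R n eps)//; apply: shell_int_le; [exact: hxy|by apply: nonneg_cst|].
  move=> x y H _ /=; have := sqr_ge0 (enorm x ^+ 2 - enorm y ^+ 2).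
  have := sqr_ge0 (enorm x); have := sqr_ge0 (enorm y); nra.
have e2 : 0 <= 2 * eps ^+ 2 by rewrite mulr_ge0// sqr_ge0.
apply: (@le_trans _ _ (shell_int (fun p => 2 * d p ^+ 2 + 2 * eps ^+ 2))).
  apply: shell_int_le.
  - apply: nonneg_sqr; apply: measurable_funB => //; apply: measurable_funM => //.
    exact: measurable_funX.
  - by apply: nonnegD; [exact: nonnegZ|exact: nonneg_cst].
  move=> x y H1 H2; rewrite /d/=.
  set a := enorm x ^+ 2 in H1 H2 *; set b := enorm y ^+ 2 in H1 H2 *.
  have : (a + b - 1) ^+ 2 <= eps ^+ 2.
    rewrite -[(_ - 1) ^+ 2]real_normK ?num_real// lerXn2r ?nnegrE ?(ltW eps0)//.
    have e0 := eps0; by rewrite ler_norml; lra.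
  have := sqr_ge0 ((a - b) - (a + b - 1)); nra.
rewrite shell_intD; [|exact: nonnegZ|exact: nonneg_cst].
rewrite shell_intZ// shell_int_cst//.
have -> : (3 / n%:R * M)%:E = (2%:E * (n%:R^-1 * M)%:E + (n%:R^-1 * M)%:E)%E.
  by rewrite -EFinM -EFinD; congr EFin; ring.
apply: leeD; first by apply: lee_wpmul2l.
by rewrite lee_fin ler_wpM2r// ltW.
Qed.

(** As |x| is close to 1 / sqrt 2, the value of h at dir(x) is compared with
    its value at sqrt 2 x; shell_radius bounds this cost, which occurs for x
    and for y. The constant is 3 (3 + 10 + 3). *)
Lemma shell_poincare (h : 'rV[R]_n -> R) (l : R) : 0 <= l ->
  euclidean_lipschitz l h ->
  (shell_int (fun p => ((h (sphere_proj p.1) - h (sphere_proj p.2)) ^+ 2)%R)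
   <= (48 * l ^+ 2 / n%:R * M)%:E)%E.
Proof.
move=> l0 hl; have mh := lipschitz_measurable l0 hl.
pose q : R := Num.sqrt 2.
have q0 : 0 <= q by exact: sqrtr_ge0.
have q2 : q ^+ 2 = 2 by rewrite sqr_sqrtr.
pose hq x := h (q *: x).
have hql : euclidean_lipschitz (q * l) hq.
  move=> x y; rewrite /hq (le_trans (hl _ _))// -scalerBr enormZ ger0_norm//.
  by rewrite mulrCA mulrA.
have mhq := lipschitz_measurable (mulr_ge0 q0 l0) hql.
have A := shell_lipschitz (mulr_ge0 q0 l0) hql.
have me1 : measurable_fun setT (fun p : VV => enorm p.1).
  exact: (measurableT_comp measurable_enorm measurable_fst).
have ms1 : measurable_fun setT (fun p : VV => sphere_proj p.1).
  exact: (measurableT_comp measurable_sphere_proj measurable_fst).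
have ms2 : measurable_fun setT (fun p : VV => sphere_proj p.2).
  exact: (measurableT_comp measurable_sphere_proj measurable_snd).
have mhs1 := measurableT_comp mh ms1; have mhs2 := measurableT_comp mh ms2.
have mhq1 : measurable_fun setT (fun p : VV => hq p.1).
  exact: (measurableT_comp mhq measurable_fst).
have mhq2 : measurable_fun setT (fun p : VV => hq p.2).
  exact: (measurableT_comp mhq measurable_snd).
have hr : nonneg_measurable (fun p : VV => (2 * enorm p.1 ^+ 2 - 1) ^+ 2).
  apply: nonneg_sqr; apply: measurable_funB => //; apply: measurable_funM => //.
  exact: measurable_funX.
pose b1 (p : VV) := (h (sphere_proj p.1) - hq p.1) ^+ 2.
pose b2 (p : VV) := (h (sphere_proj p.2) - hq p.2) ^+ 2.
pose b3 (p : VV) := (hq p.1 - hq p.2) ^+ 2.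
have h1 : nonneg_measurable b1 by apply: nonneg_sqr; exact: measurable_funB.
have h2 : nonneg_measurable b2 by apply: nonneg_sqr; exact: measurable_funB.
have h3 : nonneg_measurable b3 by apply: nonneg_sqr; exact: measurable_funB.
have B1 : (shell_int b1 <= (3 * l ^+ 2 / n%:R * M)%:E)%E.
  apply: (@le_trans _ _ (shell_int (fun p => l ^+ 2 * (2 * enorm p.1 ^+ 2 - 1) ^+ 2))).
    apply: shell_int_le => //; first by apply: nonnegZ => //; exact: sqr_ge0.
    move=> x y _ _; rewrite /b1/= -exprMn.
    rewrite -[leLHS]real_normK ?num_real// -[leRHS]real_normK ?num_real//.
    rewrite lerXn2r ?nnegrE// normrM (ger0_norm l0).
    rewrite /hq (le_trans (hl _ _))// ler_wpM2l//.
    have -> : sphere_proj x - q *: x = (1 - q * enorm x) *: sphere_proj x.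
      by rewrite -{2}[x]sphere_projK scalerA scalerBl scale1r.
    rewrite enormZ; apply: (@le_trans _ _ `|1 - q * enorm x|).
      by rewrite ler_piMr// enorm_sphere_proj_le1.
    have t0 : 0 <= q * enorm x by rewrite mulr_ge0// enorm_ge0.
    have -> : 2 * enorm x ^+ 2 - 1 = (q * enorm x - 1) * (q * enorm x + 1).
      by rewrite -q2; ring.
    by rewrite distrC normrM ler_peMr// ger0_norm ?addr_ge0// lerDr.
  rewrite shell_intZ// ?sqr_ge0//.
  have -> : (3 * l ^+ 2 / n%:R * M)%:E = ((l ^+ 2)%:E * (3 / n%:R * M)%:E)%E.
    by rewrite -EFinM; congr EFin; ring.
  by apply: lee_wpmul2l; [rewrite lee_fin sqr_ge0|exact: shell_radius].
have B2 : (shell_int b2 <= (3 * l ^+ 2 / n%:R * M)%:E)%E.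
  by rewrite -(shell_int_swap eps h2).
have B3 : (shell_int b3 <= (10 * l ^+ 2 / n%:R * M)%:E)%E.
  apply: (le_trans A); rewrite lee_fin exprMn q2; lra.
apply: (@le_trans _ _ (shell_int (fun p => 3 * (b1 p + (b3 p + b2 p))))).
  apply: shell_int_le.
  - by apply: nonneg_sqr; exact: measurable_funB.
  - by apply: nonnegZ => //; do 2 apply: nonnegD => //.
  move=> x y _ _; rewrite /b1 /b2 /b3/=.
  set a := h (sphere_proj x); set b := h (sphere_proj y).
  set c := hq x; set e := hq y.
  have := sqr_ge0 ((a - c) - (c - e)); have := sqr_ge0 ((a - c) - (e - b)).
  have := sqr_ge0 ((c - e) - (e - b)); nra.
rewrite shell_intZ//; last by do 2 apply: nonnegD => //.
rewrite !shell_intD//; last exact: nonnegD.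
have -> : (48 * l ^+ 2 / n%:R * M)%:E = (3%:E * ((3 * l ^+ 2 / n%:R * M)%:E +
   ((10 * l ^+ 2 / n%:R * M)%:E + (3 * l ^+ 2 / n%:R * M)%:E)))%E.
  by rewrite -!EFinD -EFinM; congr EFin; ring.
apply: lee_wpmul2l; first by rewrite lee_fin.
by apply: leeD => //; apply: leeD.
Qed.

End poincare.

(** Lipschitz functions of a direction concentrate: the trivial bound for the
    integrand is 4 l^2, and the gain of a factor n makes the second moment of
    the estimator linear in the dimension instead of quadratic. *)
Lemma sphere_poincare (R : realType) (n : nat) (h : 'rV[R]_n -> R) (l : R) :
  (0 < n)%N -> 0 <= l -> euclidean_lipschitz l h ->
  (\int[@unif_ball R n]_z \int[@unif_ball R n]_z'
     (((h (sphere_proj z) - h (sphere_proj z')) ^+ 2)%R)%:E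
   <= (48 * l ^+ 2 / n%:R)%:E)%E.
Proof.
move=> n0 l0 hl; have mh := lipschitz_measurable l0 hl.
have n1 : 1 <= n%:R :> R by rewrite ler1n.
pose eps : R := (2 * n%:R)^-1.
have eps0 : 0 < eps by rewrite invr_gt0 mulr_gt0// ltr0n.
have eps1 : eps < 1 by rewrite invf_lt1 ?mulr_gt0 ?ltr0n//; lra.
have eps2 : 2 * eps ^+ 2 <= n%:R^-1.
  rewrite /eps exprVn -[leLHS]invrK lef_pV2 ?posrE ?ltr0n//.
    by rewrite invfM invrK; nra.
  by rewrite invr_gt0 mulr_gt0// invr_gt0 exprn_gt0// mulr_gt0// ltr0n.
have := shell_poincare n0 eps0 eps1 eps2 l0 hl.
have M0 := @shell_mass_gt0 R n eps n0 eps0 eps1.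
rewrite (@shell_int_sphere R n eps n0 eps0 eps1 (fun p => (h p.1 - h p.2) ^+ 2)); last first.
  apply: nonneg_sqr; apply: measurable_funB.
    exact: (measurableT_comp mh measurable_fst).
  exact: (measurableT_comp mh measurable_snd).
by rewrite EFinM lee_pmul2r ?lte_fin.
Qed.

(** * Disintegration *)

Section pull_kernel.
Context d0 d1 d2 (S : measurableType d0) (Y : measurableType d1)
  (Z : measurableType d2) (R : realType) (g : S -> Y).
Local Open Scope ereal_scope.

Definition pull_kernel (mg : measurable_fun setT g) (k : R.-pker Y ~> Z) (s : S) :
  {measure set Z -> \bar R} := k (g s).

Variables (mg : measurable_fun setT g) (k : R.-pker Y ~> Z).

Let measurable_pull_kernel U : measurable U ->
  measurable_fun setT (pull_kernel mg k ^~ U).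
Proof. by move=> mU; exact: (measurableT_comp (measurable_kernel k U mU) mg). Qed.

HB.instance Definition _ := isKernel.Build _ _ _ _ R (pull_kernel mg k)
  measurable_pull_kernel.

Let pull_kernel_prob s : pull_kernel mg k s setT = 1.
Proof. exact: prob_kernel. Qed.

HB.instance Definition _ := Kernel_isProbability.Build _ _ _ _ R
  (pull_kernel mg k) pull_kernel_prob.

End pull_kernel.

Section joint_kernel.
Context d0 d1 d2 (T : measurableType d0) (S : measurableType d1)
  (Z : measurableType d2) (R : realType).
Local Open Scope ereal_scope.

Definition pairl (s : S) (z : Z) := (s, z).

Variables (V : {mfun T >-> S}) (k : R.-pker S ~> Z).

(** The law of (V w, z) when z has the law k (V w). The component of type unit
    makes it composable with P seen as a kernel from a point. *)
Definition joint_kernel (q : unit * T) : {measure set (S * Z) -> \bar R} :=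
  measure_function_pushforward__canonical__measure_function_Measure
    (k (V q.2)) (pair1_measurable (V q.2) : measurable_fun setT (pairl (V q.2))).

Let measurable_joint_kernel U : measurable U ->
  measurable_fun [set: unit * T] (joint_kernel ^~ U).
Proof.
move=> mU.
have mk : measurable_fun setT (fun s : S => k s (xsection U s)).
  by apply: measurable_fun_xsection_finite_kernel; rewrite inE.
rewrite (_ : (fun q => _) = (fun s : S => k s (xsection U s)) \o (V \o snd)).
  by apply: measurableT_comp => //; apply: measurableT_comp.
apply/funext => -[u w] /=; congr (k _ _).
by apply/seteqP; split => z; rewrite /xsection/= /pairl inE.
Qed.

HB.instance Definition _ := isKernel.Build _ _ _ _ R joint_kernel
  measurable_joint_kernel.

Let joint_kernel_prob q : joint_kernel q setT = 1.
Proof. exact: (@prob_kernel _ _ _ _ _ k). Qed.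

HB.instance Definition _ := Kernel_isProbability.Build _ _ _ _ R joint_kernel
  joint_kernel_prob.

(** Both sides integrate Phi against probabilities on S * Z, the law of (V, X)
    and the composition of P with joint_kernel, which agree on rectangles by
    hypothesis. *)
Lemma disintegration (P : probability T R) (X : {mfun T >-> Z}) :
  (forall C B, measurable C -> measurable B ->
    P (V @^-1` C `&` X @^-1` B) = \int[P]_(w in V @^-1` C) k (V w) B) ->
  forall Phi : S * Z -> \bar R, measurable_fun setT Phi -> (forall p, 0 <= Phi p) ->
  \int[P]_w Phi (V w, X w) = \int[P]_w \int[k (V w)]_z Phi (V w, z).
Proof.
move=> H Phi mPhi Phi0.
pose l : R.-pker unit ~> T := kprobability (measurable_cst (P : pprobability T R)).
pose VX w := (V w, X w).
have mVX : measurable_fun setT VX by apply: measurable_fun_pair.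
pose VXm : {mfun T >-> (S * Z)%type} :=
  HB.pack VX (isMeasurableFun.Build _ _ _ _ VX mVX).
transitivity (\int[pushforward P VXm]_p Phi p).
  by rewrite ge0_integral_pushforward.
transitivity (\int[kcomp l joint_kernel tt]_p Phi p); last first.
  rewrite integral_kcomp//; apply: eq_integral => w _.
  rewrite /joint_kernel ge0_integral_pushforward//; exact: pair1_measurable.
apply: eq_measure_integral => A mA _.
pose G := [set A `*` B | A in @measurable _ S & B in @measurable _ Z].
apply: (measure_unique G (fun=> setT)) => //.
- exact: measurable_prod_measurableType.
- move=> _ _ [A1 mA1 [B1 mB1 <-]] [A2 mA2 [B2 mB2 <-]].
  exists (A1 `&` A2); first exact: measurableI.
  by exists (B1 `&` B2); [exact: measurableI|rewrite setXI].
- by move=> _; exists setT => //; exists setT => //; rewrite setXTT.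
- by apply/seteqP; split => // x _; exists 0%N.
- move=> _ [C mC [B mB <-]].
  transitivity (P (V @^-1` C `&` X @^-1` B)); first by congr (P _).
  rewrite H// integral_mkcond /kcomp; apply: eq_integral => w _.
  rewrite patchE /joint_kernel /pushforward/=; case: ifPn => [/set_mem wC|/negP wC].
    by congr (k _ _); apply/seteqP; split => z //= [].
  change (0 = k (V w) (pairl (V w) @^-1` (C `*` B))).
  rewrite (_ : pairl _ @^-1` _ = set0) ?measure0//.
  by apply/seteqP; split => z //= [wC' _]; apply: wC; rewrite inE.
- move=> _; apply: (@le_lt_trans _ _ 1); last by rewrite ltry.
  exact: (probability_le1 (distribution P VXm)).
Qed.

End joint_kernel.

Section sub_sigma.
Context d (T : measurableType d) (G : set (set T)).
Hypothesis sG : sigma_algebra setT G.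

Lemma measurable_wrtP d1 (S : measurableType d1) (f : T -> S) :
  measurable_wrt G f <-> measurable_fun setT (f : g_sigma_algebraType G -> S).
Proof.
have E : <<s G >> = G by exact: sigma_algebra_id.
split=> [mf _ B mB|mf B mB].
  by rewrite setTI /measurable/= E; exact: mf.
by have := mf measurableT B mB; rewrite setTI /measurable/= E.
Qed.

Lemma measurable_wrt_pair d1 d2 (S1 : measurableType d1) (S2 : measurableType d2)
    (f : T -> S1) (g : T -> S2) : measurable_wrt G f -> measurable_wrt G g ->
  measurable_wrt G (fun w => (f w, g w)).
Proof.
move=> /measurable_wrtP mf /measurable_wrtP mg; apply/measurable_wrtP.
exact: measurable_fun_pair.
Qed.

Lemma measurable_wrt_comp d1 d2 (S1 : measurableType d1) (S2 : measurableType d2)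
    (f : S1 -> S2) (g : T -> S1) : measurable_fun setT f -> measurable_wrt G g ->
  measurable_wrt G (fun w => f (g w)).
Proof.
move=> mf /measurable_wrtP mg; apply/measurable_wrtP.
exact: (measurableT_comp mf mg).
Qed.

Lemma measurable_wrt_indic (R : realType) A : G A ->
  measurable_wrt G (\1_A : T -> R).
Proof.
move=> GA; apply/measurable_wrtP; apply: (@measurable_indic _ (g_sigma_algebraType G)).
by rewrite /measurable/= sigma_algebra_id.
Qed.

End sub_sigma.

Section oracle.
Context {R : realType} {n : nat}.
Notation PB := (@unif_ball R n).
Context dO (T : measurableType dO) (P : probability T R).
Local Open Scope ereal_scope.

Lemma measurable_wrt_measurable d1 (S : measurableType d1) (G : set (set T))
    (f : T -> S) : sub_sigma_algebra_of G -> measurable_wrt G f ->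
  measurable_fun setT f.
Proof. by move=> [_ GT] mf _ B mB; rewrite setTI; exact/GT/mf. Qed.

(** Independence of G is a conditional law given by a constant kernel. *)
Lemma direction_integral d1 (S : measurableType d1) (G : set (set T))
    (W : T -> S) (u : {RV P >-> 'rV[R]_n}) (Phi : S * 'rV[R]_n -> \bar R) :
  sub_sigma_algebra_of G -> measurable_wrt G W ->
  has_law P u unif_sphere -> indep_of P G u ->
  measurable_fun setT Phi -> (forall p, 0 <= Phi p) ->
  \int[P]_w Phi (W w, u w) = \int[P]_w \int[PB]_v Phi (W w, sphere_proj v).
Proof.
move=> sG mW lu iu mPhi Phi0.
have mW' := measurable_wrt_measurable sG mW.
pose Wm : {mfun T >-> S} := HB.pack W (isMeasurableFun.Build _ _ _ _ W mW').
pose k : R.-pker S ~> 'rV[R]_n :=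
  kprobability (measurable_cst (unif_sphere : pprobability 'rV[R]_n R)).
have H C B : measurable C -> measurable B ->
    P (Wm @^-1` C `&` u @^-1` B) = \int[P]_(w in Wm @^-1` C) k (Wm w) B.
  move=> mC mB; transitivity (P (W @^-1` C) * unif_sphere B).
    by rewrite -lu//; apply: iu => //; exact: mW.
  transitivity (\int[P]_(w in W @^-1` C) (cst (unif_sphere B) w)); last by [].
  rewrite integral_cst 1?muleC//.
  by rewrite -[X in measurable X]setTI; apply: (mW' measurableT C mC).
apply: (etrans (disintegration H mPhi Phi0)).
apply: eq_integral => w _; apply: ge0_integral_distribution => //.
by apply: measurableT_comp => //; exact: pair1_measurable.
Qed.

(** Two disintegrations: of xi given G and u, then of u given G. *)
Lemma oracle_integral dZ (Z : measurableType dZ) (Xi : R.-pker 'rV[R]_n ~> Z)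
    d1 (S : measurableType d1) (G : set (set T)) (delta : R)
    (W : T -> S) (ys : S -> 'rV[R]_n) (u : {RV P >-> 'rV[R]_n}) (xi : {RV P >-> Z})
    (Phi : S * 'rV[R]_n * Z -> \bar R) :
  sub_sigma_algebra_of G -> measurable_wrt G W -> measurable_fun setT ys ->
  has_law P u unif_sphere -> indep_of P G u ->
  has_cond_law P (sigma_join G u) xi (fun w => Xi (ys (W w) + delta *: u w)%R) ->
  measurable_fun setT Phi -> (forall p, 0 <= Phi p) ->
  \int[P]_w Phi (W w, u w, xi w) =
  \int[P]_w \int[PB]_v \int[Xi (ys (W w) + delta *: sphere_proj v)%R]_z
    Phi (W w, sphere_proj v, z).
Proof.
move=> sG mW mys lu iu lxi mPhi Phi0.
have sH : sigma_algebra setT (sigma_join G u) by exact: smallest_sigma_algebra.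
have mWH : measurable_wrt (sigma_join G u) W.
  by move=> B mB; apply: sub_sigma_algebra; left; exact: mW.
have muH : measurable_wrt (sigma_join G u) u.
  by move=> B mB; apply: sub_sigma_algebra; right; exists B => //; rewrite setTI.
have mVH := measurable_wrt_pair sH mWH muH.
have mW' := measurable_wrt_measurable sG mW.
pose V w := (W w, u w).
have mV : measurable_fun setT V by apply: measurable_fun_pair.
pose Vm : {mfun T >-> (S * 'rV[R]_n)%type} :=
  HB.pack V (isMeasurableFun.Build _ _ _ _ V mV).
pose g (p : S * 'rV[R]_n) := (ys p.1 + delta *: p.2)%R.
have mg : measurable_fun setT g.
  apply: measurable_rVD; first exact: (measurableT_comp mys measurable_fst).
  by apply: measurable_rVZ => //; exact: measurable_snd.
pose k : R.-pker (S * 'rV[R]_n)%type ~> Z := pull_kernel mg Xi.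
have H C B : measurable C -> measurable B ->
    P (Vm @^-1` C `&` xi @^-1` B) = \int[P]_(w in Vm @^-1` C) k (Vm w) B.
  by move=> mC mB; apply: lxi => //; exact: mVH.
apply: (etrans (disintegration H mPhi Phi0)).
pose Psi (p : S * 'rV[R]_n) := \int[k p]_z Phi (p, z).
have mPsi : measurable_fun setT Psi.
  exact: (measurable_fun_integral_finite_kernel Phi k).
have Psi0 p : 0 <= Psi p by apply: integral_ge0.
exact: (direction_integral (Phi := Psi) sG mW lu iu mPsi Psi0).
Qed.

End oracle.

(** * The residual estimator *)

Lemma euclidean_lipschitz_ge0 (R : realType) (n : nat) (L : R) (f : 'rV[R]_n -> R) :
  (0 < n)%N -> euclidean_lipschitz L f -> 0 <= L.
Proof.
move=> n0 fL; pose x : 'rV[R]_n := const_mx 1.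
have x0 : 0 < enorm x.
  rewrite enorm_gt0; apply/negP => /eqP/rowP/(_ (Ordinal n0)).
  by rewrite !mxE => /eqP; rewrite oner_eq0.
have := fL x 0; rewrite subr0 => /(le_trans (normr_ge0 _)).
by rewrite pmulr_lge0.
Qed.

Section nonneg_integrals.
Context d (T : measurableType d) (R : realType) (mu : {measure set T -> \bar R}).

Lemma ge0_integral_EFinD (f g : T -> R) :
  measurable_fun setT f -> measurable_fun setT g ->
  (forall x, 0 <= f x) -> (forall x, 0 <= g x) ->
  (\int[mu]_x (f x + g x)%R%:E = \int[mu]_x (f x)%:E + \int[mu]_x (g x)%:E)%E.
Proof.
move=> mf mg f0 g0; under eq_integral do rewrite EFinD.
by rewrite ge0_integralD//; solve [exact/measurable_EFinP
  | move=> x _; rewrite lee_fin; solve [exact: f0|exact: g0]].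
Qed.

Lemma ge0_integral_EFinZ (k : R) (f : T -> R) : 0 <= k ->
  measurable_fun setT f -> (forall x, 0 <= f x) ->
  (\int[mu]_x (k * f x)%R%:E = k%:E * \int[mu]_x (f x)%:E)%E.
Proof.
move=> k0 mf f0; under eq_integral do rewrite EFinM.
by rewrite ge0_integralZl//; solve [exact/measurable_EFinP
  | move=> x _; rewrite lee_fin; exact: f0].
Qed.

Lemma integral_prob_le (P : probability T R) (f : T -> \bar R) (c : R) :
  measurable_fun setT f -> (forall x, 0 <= f x)%E -> (forall x, f x <= c%:E)%E ->
  (\int[P]_x f x <= c%:E)%E.
Proof.
move=> mf f0 fc; apply: (@le_trans _ _ (\int[P]_x c%:E)%E).
  by apply: ge0_le_integral.
rewrite integral_cst// [X in (_ * X)%E](_ : _ = 1%E) ?mule1//.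
exact: probability_setT.
Qed.

End nonneg_integrals.

Section model.
Context {R : realType} {n : nat} {dZ : measure_display} {Z : measurableType dZ}.
Notation PB := (@unif_ball R n).
Variables (Xi : R.-pker 'rV[R]_n ~> Z) (F : 'rV[R]_n -> Z -> R) (f : 'rV[R]_n -> R).
Variables (L sigma delta : R).
Hypotheses (n0 : (0 < n)%N) (delta0 : 0 < delta).
Hypothesis hF : measurable_fun setT (fun p : 'rV[R]_n * Z => F p.1 p.2).
Hypothesis hLip : euclidean_lipschitz L f.
Hypothesis hint : forall x, (Xi x).-integrable setT (EFin \o F x).
Hypothesis hmean : forall x, (\int[Xi x]_z (F x z)%:E)%E = (f x)%:E.
Hypothesis hvar : forall x,
    ((\int[Xi x]_z (`|F x z - f x| ^+ 2)%:E)%E <= (sigma ^+ 2)%:E)%E.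

Let L0 : 0 <= L := euclidean_lipschitz_ge0 n0 hLip.
Let mf : measurable_fun setT f := lipschitz_measurable L0 hLip.

Lemma measurable_oracle d (T : measurableType d) (a : T -> 'rV[R]_n) (b : T -> Z) :
  measurable_fun setT a -> measurable_fun setT b ->
  measurable_fun setT (fun t => F (a t) (b t)).
Proof.
by move=> ma mb; apply: (measurableT_comp hF (measurable_fun_pair ma mb)).
Qed.

Lemma measurable_query d (T : measurableType d) (a b : T -> 'rV[R]_n) :
  measurable_fun setT a -> measurable_fun setT b ->
  measurable_fun setT (fun t => a t + delta *: b t).
Proof. by move=> ma mb; apply: measurable_rVD => //; exact: measurable_rVZ. Qed.

Let mfst2 d1 d2 d3 (T1 : measurableType d1) (T2 : measurableType d2)
  (T3 : measurableType d3) : measurable_fun setT (fun p : T1 * T2 * T3 => p.1.1).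
Proof. exact: (measurableT_comp measurable_fst measurable_fst). Qed.

Let msnd2 d1 d2 d3 (T1 : measurableType d1) (T2 : measurableType d2)
  (T3 : measurableType d3) : measurable_fun setT (fun p : T1 * T2 * T3 => p.1.2).
Proof. exact: (measurableT_comp measurable_snd measurable_fst). Qed.

Context {dO : measure_display} {Omega : measurableType dO} (P : probability Omega R).

Lemma direction_le1 (u : {RV P >-> 'rV[R]_n}) : has_law P u unif_sphere ->
  {ae P, forall w, enorm (u w) <= 1}.
Proof.
move=> lu; exists (u @^-1` (~` eball)); split.
- rewrite -[X in measurable X]setTI; apply: measurable_funP => //.
  by apply: measurableC; exact: measurable_eball.
- rewrite lu; last by apply: measurableC; exact: measurable_eball.
  rewrite unif_sphereE (_ : _ @^-1` _ = set0) ?measure0//.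
  by apply/seteqP; split => // v /= H; apply: H; exact: enorm_sphere_proj_le1.
- by [].
Qed.

Lemma noise_second_moment (G : set (set Omega)) (y u : {RV P >-> 'rV[R]_n})
    (xi : {RV P >-> Z}) : sub_sigma_algebra_of G -> measurable_wrt G y ->
  has_law P u unif_sphere -> indep_of P G u ->
  has_cond_law P (sigma_join G u) xi (fun w => Xi (y w + delta *: u w)) ->
  (\int[P]_w ((F (y w + delta *: u w) (xi w) - f (y w + delta *: u w)) ^+ 2)%R%:E
     <= (sigma ^+ 2)%:E)%E.
Proof.
move=> sG my lu iu lxi.
pose Phi (p : 'rV[R]_n * 'rV[R]_n * Z) : \bar R :=
  ((F (p.1.1 + delta *: p.1.2) p.2 - f (p.1.1 + delta *: p.1.2)) ^+ 2)%:E.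
have mq : measurable_fun setT (fun p : 'rV[R]_n * 'rV[R]_n * Z =>
    p.1.1 + delta *: p.1.2).
  by apply: measurable_query; [exact: mfst2|exact: msnd2].
have mPhi : measurable_fun setT Phi.
  apply/measurable_EFinP; apply: measurable_funX; apply: measurable_funB.
    by apply: measurable_oracle => //; exact: measurable_snd.
  exact: (measurableT_comp mf mq).
have Phi0 p : (0 <= Phi p)%E by rewrite lee_fin sqr_ge0.
rewrite (oracle_integral (Phi := Phi) sG my (@measurable_id _ _ setT) lu iu lxi mPhi Phi0).
pose k : R.-pker ('rV[R]_n * 'rV[R]_n)%type ~> Z :=
  pull_kernel (measurable_query measurable_fst measurable_snd) Xi.
have mPsi : measurable_fun setT (fun p : 'rV[R]_n * 'rV[R]_n => \int[k p]_z Phi (p, z))%E.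
  exact: (measurable_fun_integral_finite_kernel Phi k).
have mPsi' : measurable_fun setT (fun p : 'rV[R]_n * 'rV[R]_n =>
    \int[k (p.1, sphere_proj p.2)]_z Phi (p.1, sphere_proj p.2, z))%E.
  apply: (measurableT_comp mPsi (g := fun p : 'rV[R]_n * 'rV[R]_n => (p.1, sphere_proj p.2))).
  apply: measurable_fun_pair => //.
  exact: (measurableT_comp measurable_sphere_proj measurable_snd).
have Psi0 p : (0 <= \int[k p]_z Phi (p, z))%E by apply: integral_ge0.
apply: integral_prob_le => [| |w].
- apply: (measurableT_comp _ (measurable_wrt_measurable sG my)
    (f := fun x => \int[PB]_v \int[k (x, sphere_proj v)]_z Phi (x, sphere_proj v, z))%E).
  apply: (@measurable_fun_fubini_tonelli_F _ _ _ _ _ PB (fun p =>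
     \int[k (p.1, sphere_proj p.2)]_z Phi (p.1, sphere_proj p.2, z))%E) => // p.
- by move=> w; apply: integral_ge0 => v _; exact: Psi0.
- apply: integral_prob_le => [| |v].
  + exact: (measurableT_comp mPsi' (pair1_measurable (y w))).
  + by move=> v; exact: Psi0.
  + apply: le_trans (hvar _); apply: ge0_le_integral => //.
    * exact: (measurableT_comp mPhi (pair1_measurable _)).
    * apply/measurable_EFinP; apply: measurable_funX; apply: measurableT_comp => //.
      by apply: measurable_funB => //; exact: measurable_oracle.
    * by move=> z _; rewrite /Phi/= lee_fin real_normK ?num_real.
Qed.

(** As y' and u' are measurable for G1, u is independent of both; given y',
    the directions u' and u are thus independent and uniform, and
    sphere_poincare applies to f rescaled around y'. *)
Lemma direction_variance (G1 G2 : set (set Omega)) (y' u' u : {RV P >-> 'rV[R]_n}) :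
  sub_sigma_algebra_of G2 -> sub_sigma_algebra_of G1 ->
  measurable_wrt G2 y' -> has_law P u' unif_sphere -> indep_of P G2 u' ->
  measurable_wrt G1 y' -> measurable_wrt G1 u' ->
  has_law P u unif_sphere -> indep_of P G1 u ->
  (\int[P]_w ((f (y' w + delta *: u' w) - f (y' w + delta *: u w)) ^+ 2)%R%:E
     <= (48 * (delta * L) ^+ 2 / n%:R)%:E)%E.
Proof.
move=> sG2 sG1 my2 lu' iu' my1 mu1 lu iu.
pose Phi (p : 'rV[R]_n * 'rV[R]_n * 'rV[R]_n) : \bar R :=
  ((f (p.1.1 + delta *: p.1.2) - f (p.1.1 + delta *: p.2)) ^+ 2)%:E.
have mPhi : measurable_fun setT Phi.
  apply/measurable_EFinP; apply: measurable_funX; apply: measurable_funB.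
    apply: (measurableT_comp mf).
    by apply: measurable_query; [exact: mfst2|exact: msnd2].
  apply: (measurableT_comp mf).
  by apply: measurable_query; [exact: mfst2|exact: measurable_snd].
have Phi0 p : (0 <= Phi p)%E by rewrite lee_fin sqr_ge0.
have [sa1 _] := sG1.
rewrite (direction_integral (Phi := Phi) sG1 (measurable_wrt_pair sa1 my1 mu1) lu iu mPhi Phi0).
pose Phi' (p : 'rV[R]_n * 'rV[R]_n * 'rV[R]_n) := Phi (p.1, sphere_proj p.2).
have mPhi' : measurable_fun setT Phi'.
  apply: (measurableT_comp mPhi); apply: measurable_fun_pair => //.
  exact: (measurableT_comp measurable_sphere_proj measurable_snd).
pose Psi p := (\int[PB]_v Phi' (p, v))%E.
have mPsi : measurable_fun setT Psi.
  apply: (@measurable_fun_fubini_tonelli_F _ _ _ _ _ PB Phi');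
    solve [exact: mPhi' | move=> p; exact: Phi0].
have Psi0 p : (0 <= Psi p)%E by apply: integral_ge0 => v _; exact: Phi0.
rewrite (direction_integral (Phi := Psi) sG2 my2 lu' iu' mPsi Psi0).
have mPsi' : measurable_fun setT (fun p : 'rV[R]_n * 'rV[R]_n => Psi (p.1, sphere_proj p.2)).
  apply: (measurableT_comp mPsi); apply: measurable_fun_pair => //.
  exact: (measurableT_comp measurable_sphere_proj measurable_snd).
apply: integral_prob_le => [| |w].
- apply: (measurableT_comp _ (measurable_wrt_measurable sG2 my2)
    (f := fun x => \int[PB]_v Psi (x, sphere_proj v))%E).
  apply: (@measurable_fun_fubini_tonelli_F _ _ _ _ _ PB
    (fun p => Psi (p.1, sphere_proj p.2))) => //.
- by move=> w; apply: integral_ge0 => v _; exact: Psi0.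
exact: (sphere_poincare n0 (rescale_ge0 L0 delta0) (lipschitz_rescale delta0 hLip (y' w))).
Qed.

(** The difference of the two oracle values consists of two noises and of f q
    - f q', split at the point y' + delta u. The square of the sum is at most
    3 times each squared noise, 6 times the contribution of the directions and
    6 L^2 |y - y'|^2; with the factor (n / delta)^2 the directions contribute
    6 * 48 n L^2. *)
Lemma residual_second_moment (G1 G2 : set (set Omega))
    (y u y' u' : {RV P >-> 'rV[R]_n}) (xi xi' : {RV P >-> Z}) :
  sub_sigma_algebra_of G2 -> sub_sigma_algebra_of G1 ->
  measurable_wrt G2 y' -> has_law P u' unif_sphere -> indep_of P G2 u' ->
  has_cond_law P (sigma_join G2 u') xi' (fun w => Xi (y' w + delta *: u' w)) ->
  measurable_wrt G1 y -> measurable_wrt G1 y' -> measurable_wrt G1 u' ->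
  has_law P u unif_sphere -> indep_of P G1 u ->
  has_cond_law P (sigma_join G1 u) xi (fun w => Xi (y w + delta *: u w)) ->
  (\int[P]_w (enorm (g_1pt delta F (y w) (u w) (xi w) (y' w) (u' w) (xi' w)) ^+ 2)%R%:E
    <= (6 * n%:R ^+ 2 * sigma ^+ 2 / delta ^+ 2 + 288 * n%:R * L ^+ 2)%R%:E
       + (6 * n%:R ^+ 2 * L ^+ 2 / delta ^+ 2)%R%:E
         * \int[P]_w (enorm (y w - y' w) ^+ 2)%R%:E)%E.
Proof.
move=> sG2 sG1 my2 lu' iu' lxi' my1 my'1 mu'1 lu iu lxi.
have nz : n%:R != 0 :> R by rewrite pnatr_eq0 -lt0n.
pose q w := y w + delta *: u w; pose q' w := y' w + delta *: u' w.
pose N1 w := (F (q w) (xi w) - f (q w)) ^+ 2.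
pose N2 w := (F (q' w) (xi' w) - f (q' w)) ^+ 2.
pose Q w := (f (q' w) - f (y' w + delta *: u w)) ^+ 2.
pose D w := enorm (y w - y' w) ^+ 2.
have mq : measurable_fun setT q by exact: measurable_query.
have mq' : measurable_fun setT q' by exact: measurable_query.
have mN1 : measurable_fun setT N1.
  apply: measurable_funX; apply: measurable_funB; first exact: measurable_oracle.
  exact: (measurableT_comp mf mq).
have mN2 : measurable_fun setT N2.
  apply: measurable_funX; apply: measurable_funB; first exact: measurable_oracle.
  exact: (measurableT_comp mf mq').
have mQ : measurable_fun setT Q.
  apply: measurable_funX; apply: measurable_funB.
    exact: (measurableT_comp mf mq').
  by apply: (measurableT_comp mf); exact: measurable_query.
have mD : measurable_fun setT D.
  apply: measurable_funX; apply: (measurableT_comp measurable_enorm).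
  exact: measurable_rVB.
have N10 w : 0 <= N1 w by exact: sqr_ge0.
have N20 w : 0 <= N2 w by exact: sqr_ge0.
have Q0 w : 0 <= Q w by exact: sqr_ge0.
have D0 w : 0 <= D w by exact: sqr_ge0.
have IN1 := noise_second_moment sG1 my1 lu iu lxi.
have IN2 := noise_second_moment sG2 my2 lu' iu' lxi'.
have IQ := direction_variance sG2 sG1 my2 lu' iu' my'1 mu'1 lu iu.
pose K : R := (n%:R / delta) ^+ 2.
have K0 : 0 <= K by exact: sqr_ge0.
have L20 : 0 <= 6 * L ^+ 2 by rewrite mulr_ge0// sqr_ge0.
pose B w := 3 * N1 w + (3 * N2 w + (6 * Q w + 6 * L ^+ 2 * D w)).
have mB : measurable_fun setT B.
  apply: measurable_funD; first exact: measurable_funM.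
  apply: measurable_funD; first exact: measurable_funM.
  by apply: measurable_funD; exact: measurable_funM.
have B0 w : 0 <= B w.
  by rewrite /B !addr_ge0// mulr_ge0.
pose g w := g_1pt delta F (y w) (u w) (xi w) (y' w) (u' w) (xi' w).
have mg : measurable_fun setT g.
  apply: measurable_rVZ => //; apply: measurable_funM => //.
  by apply: measurable_funB; exact: measurable_oracle.
have gB : (\int[P]_w (enorm (g w) ^+ 2)%:E <= \int[P]_w (K * B w)%:E)%E.
  apply: ae_ge0_le_integral => //.
  - by move=> w _; rewrite lee_fin sqr_ge0.
  - apply/measurable_EFinP; apply: measurable_funX.
    exact: (measurableT_comp measurable_enorm mg).
  - by move=> w _; rewrite lee_fin mulr_ge0.
  - by apply/measurable_EFinP; exact: measurable_funM.
  apply: filterS (direction_le1 lu) => w uw _; rewrite lee_fin /g /g_1pt.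
  rewrite enormZ exprMn real_normK ?num_real// -/(q w) -/(q' w).
  have u2 : enorm (u w) ^+ 2 <= 1 by rewrite exprn_ile1// enorm_ge0.
  set a := n%:R / delta * _.
  apply: (@le_trans _ _ (a ^+ 2)); first by rewrite ler_piMr// sqr_ge0.
  rewrite /a exprMn -/K ler_wpM2l//.
  have r2 : (f (q w) - f (y' w + delta *: u w)) ^+ 2 <= L ^+ 2 * D w.
    rewrite -[leLHS]real_normK ?num_real// -exprMn lerXn2r ?nnegrE//.
      by rewrite mulr_ge0// enorm_ge0.
    rewrite (le_trans (hLip _ _))// /q opprD addrACA subrr addr0//.
  rewrite /B /N1 /N2 /Q; move: r2.
  set f1 := f (q w); set f2 := f (q' w); set f3 := f (y' w + _).
  set F1 := F _ _; set F2 := F _ _ => r2.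
  have := sqr_ge0 ((F1 - f1) - (f2 - F2)).
  have := sqr_ge0 ((F1 - f1) - (f1 - f2)).
  have := sqr_ge0 ((f2 - F2) - (f1 - f2)).
  have := sqr_ge0 ((f1 - f3) + (f2 - f3)).
  nra.
apply: (le_trans gB).
rewrite ge0_integral_EFinZ//.
have -> : (\int[P]_w (B w)%:E = 3%:E * \int[P]_w (N1 w)%:E + (3%:E * \int[P]_w (N2 w)%:E
    + (6%:E * \int[P]_w (Q w)%:E + (6 * L ^+ 2)%R%:E * \int[P]_w (D w)%:E)))%E.
  rewrite ge0_integral_EFinD//; last 4 first.
  - exact: measurable_funM.
  - apply: measurable_funD; first exact: measurable_funM.
    by apply: measurable_funD; exact: measurable_funM.
  - by move=> w; rewrite mulr_ge0.
  - by move=> w; rewrite !addr_ge0// mulr_ge0.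
  rewrite ge0_integral_EFinD//; last 4 first.
  - exact: measurable_funM.
  - by apply: measurable_funD; exact: measurable_funM.
  - by move=> w; rewrite mulr_ge0.
  - by move=> w; rewrite !addr_ge0// mulr_ge0.
  rewrite ge0_integral_EFinD//; last 4 first.
  - exact: measurable_funM.
  - exact: measurable_funM.
  - by move=> w; rewrite mulr_ge0.
  - by move=> w; rewrite mulr_ge0.
  by rewrite !ge0_integral_EFinZ.
set E := (\int[P]_w (D w)%:E)%E.
have E0 : (0 <= E)%E by apply: integral_ge0 => w _; rewrite lee_fin.
apply: (@le_trans _ _ (K%:E * (3%:E * (sigma ^+ 2)%:E + (3%:E * (sigma ^+ 2)%:E
   + (6%:E * (48 * (delta * L) ^+ 2 / n%:R)%:E + (6 * L ^+ 2)%R%:E * E)))))%E.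
  apply: lee_wpmul2l; first by rewrite lee_fin.
  apply: leeD; first by apply: lee_wpmul2l.
  apply: leeD; first by apply: lee_wpmul2l.
  by apply: leeD => //; apply: lee_wpmul2l.
rewrite !addeA -!EFinM -!EFinD ge0_muleDr//; last 2 first.
- have c0 : 0 <= 48 * (delta * L) ^+ 2 / n%:R.
    by rewrite divr_ge0// mulr_ge0// sqr_ge0.
  by rewrite lee_fin; have s0 := sqr_ge0 sigma; rewrite !addr_ge0// mulr_ge0.
- by rewrite mule_ge0.
rewrite muleA -!EFinM; apply: leeD.
  rewrite lee_fin le_eqVlt; apply/orP; left; apply/eqP; rewrite /K.
  by field; rewrite nz gt_eqF.
rewrite le_eqVlt; apply/orP; left; apply/eqP; congr (_%:E * _)%E; rewrite /K.
by field; rewrite gt_eqF.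
Qed.

Section conditional_expectation.
Context {dS : measure_display} {S : measurableType dS} (ys : S -> 'rV[R]_n) (cs : S -> R).
Hypotheses (mys : measurable_fun setT ys) (mcs : measurable_fun setT cs).
Variable i : 'I_n.

Let x_of (p : S * 'rV[R]_n) := ys p.1 + delta *: p.2.

Let mx : measurable_fun setT x_of.
Proof.
apply: measurable_query; last exact: measurable_snd.
exact: (measurableT_comp mys measurable_fst).
Qed.

Let k : R.-pker (S * 'rV[R]_n)%type ~> Z := pull_kernel mx Xi.

(** A coordinate of the estimator as a function of the state s, which gathers
    what is known before the step, of the direction and of the sample; cs s is
    the previous oracle value. *)
Definition coord_estimator (p : S * 'rV[R]_n * Z) : R :=
  n%:R / delta * (F (x_of p.1) p.2 - cs p.1.1) * p.1.2 ord0 i.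

Let mest : measurable_fun setT coord_estimator.
Proof.
apply: measurable_funM.
  apply: measurable_funM => //; apply: measurable_funB.
    apply: measurable_oracle; last exact: measurable_snd.
    exact: (measurableT_comp mx measurable_fst).
  exact: (measurableT_comp mcs (@mfst2 _ _ _ S _ Z)).
exact: (measurableT_comp (measurable_coord (T := R) i) (@msnd2 _ _ _ S _ Z)).
Qed.

(** Meant for psi the positive or the negative part, since disintegration is
    available for nonnegative functions. *)
Definition state_mean (psi : R -> R) (s : S) : \bar R :=
  (\int[PB]_v \int[Xi (x_of (s, sphere_proj v))]_z
     (psi (coord_estimator (s, sphere_proj v, z)))%:E)%E.

(** Bounds the conditional mean of the absolute value of the estimator, the
    noise being controlled by |t| <= 1 + t^2. *)
Definition state_bound (s : S) : R :=
  n%:R / delta * (1 + sigma ^+ 2 + (`|f (ys s)| + L * delta) + `|cs s|).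

Section part.
Variable psi : R -> R.
Hypotheses (mpsi : measurable_fun setT psi) (psi0 : forall t, 0 <= psi t).
Hypothesis psi_le : forall t, psi t <= `|t|.

Let mpe : measurable_fun setT (fun p => (psi (coord_estimator p))%:E).
Proof. by apply/measurable_EFinP; exact: (measurableT_comp mpsi mest). Qed.

Let inner (p : S * 'rV[R]_n) : \bar R :=
  (\int[k p]_z (psi (coord_estimator (p, z)))%:E)%E.

Let minner : measurable_fun setT inner.
Proof.
by apply: (measurable_fun_integral_finite_kernel
  (fun p => (psi (coord_estimator p))%:E) k) => // p; rewrite lee_fin.
Qed.

Let inner0 p : (0 <= inner p)%E.
Proof. by apply: integral_ge0 => z _; rewrite lee_fin. Qed.

Let minner_sphere : measurable_fun setT
  (fun p : S * 'rV[R]_n => inner (p.1, sphere_proj p.2)).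
Proof.
apply: (measurableT_comp minner); apply: measurable_fun_pair => //.
exact: (measurableT_comp measurable_sphere_proj measurable_snd).
Qed.

Lemma measurable_state_mean : measurable_fun setT (state_mean psi).
Proof.
by apply: (@measurable_fun_fubini_tonelli_F _ _ _ _ _ PB
  (fun p : S * 'rV[R]_n => inner (p.1, sphere_proj p.2))) => //.
Qed.

Lemma state_mean_ge0 s : (0 <= state_mean psi s)%E.
Proof. by apply: integral_ge0 => v _; exact: inner0. Qed.

Lemma inner_le s v : (inner (s, sphere_proj v) <= (state_bound s)%:E)%E.
Proof.
have nd : 0 <= n%:R / delta by rewrite divr_ge0// ltW.
set x := x_of (s, sphere_proj v).
have mFx : measurable_fun setT (F x) by exact: measurable_oracle.
have mN : measurable_fun setT (fun z => `|F x z - f x| ^+ 2).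
  by apply: measurable_funX; apply: measurableT_comp => //; exact: measurable_funB.
pose c := n%:R / delta * (1 + (`|f (ys s)| + L * delta) + `|cs s|).
have c0 : 0 <= c by rewrite mulr_ge0// !addr_ge0// mulr_ge0// ltW.
have fx : `|f x| <= `|f (ys s)| + L * delta.
  rewrite -[f x](subrK (f (ys s))) addrC (le_trans (ler_normD _ _))// lerD2l.
  rewrite (le_trans (hLip _ _))// ler_wpM2l// /x /x_of/= addrC addKr enormZ gtr0_norm//.
  by rewrite ger_pMr// enorm_sphere_proj_le1.
apply: (@le_trans _ _ (\int[k (s, sphere_proj v)]_z
    (n%:R / delta * `|F x z - f x| ^+ 2 + c)%:E)%E).
  apply: ge0_le_integral => //.
  - by move=> z _; rewrite lee_fin.
  - exact: (measurableT_comp mpe (pair1_measurable _)).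
  - by apply/measurable_EFinP; apply: measurable_funD => //; exact: measurable_funM.
  move=> z _; rewrite lee_fin (le_trans (psi_le _))// /coord_estimator -/x /=.
  rewrite normrM normrM (ger0_norm nd).
  have v1 : `|sphere_proj v ord0 i| <= 1.
    exact: le_trans (coord_le_enorm _ _) (enorm_sphere_proj_le1 _).
  apply: (@le_trans _ _ (n%:R / delta * `|F x z - cs s|)).
    by rewrite ler_piMr// mulr_ge0.
  rewrite /c -mulrDr ler_wpM2l//.
  have := ler_normB (F x z) (cs s).
  have := ler_normD (F x z - f x) (f x); rewrite subrK.
  have := sqr_ge0 (`|F x z - f x| - 1); have := normr_ge0 (F x z - f x); nra.
rewrite ge0_integral_EFinD//; last 2 first.
- exact: measurable_funM.
- by move=> z; rewrite mulr_ge0// sqr_ge0.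
rewrite ge0_integral_EFinZ//.
rewrite (_ : \int[k _]_z c%:E = c%:E)%E; last first.
  rewrite integral_cst// [X in (_ * X)%E](_ : _ = 1%E) ?mule1//.
  exact: prob_kernel.
apply: (@le_trans _ _ ((n%:R / delta)%:E * (sigma ^+ 2)%:E + c%:E)%E).
  by apply: leeD => //; apply: lee_wpmul2l; rewrite ?lee_fin//; exact: hvar.
rewrite -EFinM -EFinD lee_fin /c /state_bound le_eqVlt; apply/orP; left.
by apply/eqP; ring.
Qed.

Lemma state_mean_fin s : state_mean psi s \is a fin_num.
Proof.
rewrite ge0_fin_numE ?state_mean_ge0//; apply: (le_lt_trans _ (ltry (state_bound s))).
apply: integral_prob_le => [| |v].
- exact: (measurableT_comp minner_sphere (pair1_measurable s)).
- by move=> v; exact: inner0.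
- exact: inner_le.
Qed.

Lemma inner_bmeas s : bmeas (fun v : 'rV[R]_n => fine (inner (s, sphere_proj v))).
Proof.
split.
  apply: (measurableT_comp (f := fine)) => //.
  exact: (measurableT_comp minner_sphere (pair1_measurable s)).
exists (state_bound s) => v; rewrite ger0_norm; last exact/fine_ge0/inner0.
rewrite -lee_fin fineK; first exact: inner_le.
by rewrite ge0_fin_numE// (le_lt_trans (inner_le s v))// ltry.
Qed.

Lemma state_meanE s :
  state_mean psi s = (\int[PB]_v fine (inner (s, sphere_proj v)))%R%:E.
Proof.
rewrite -bmeas_EFin_Rintegral; last exact: inner_bmeas.
apply: eq_integral => v _; rewrite fineK//.
by rewrite ge0_fin_numE ?inner0// (le_lt_trans (inner_le s v))// ltry.
Qed.

Lemma integral_state_mean (G : set (set Omega)) (W : Omega -> S)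
    (u : {RV P >-> 'rV[R]_n}) (xi : {RV P >-> Z}) :
  sub_sigma_algebra_of G -> measurable_wrt G W ->
  has_law P u unif_sphere -> indep_of P G u ->
  has_cond_law P (sigma_join G u) xi (fun w => Xi (ys (W w) + delta *: u w)) ->
  forall A, G A -> (\int[P]_(w in A) state_mean psi (W w) =
    \int[P]_(w in A) (psi (coord_estimator (W w, u w, xi w)))%:E)%E.
Proof.
move=> sG mW lu iu lxi A GA; have [sa GT] := sG.
(* The event A becomes a component of the state, which turns the integral over
   A into one over the whole space. *)
pose W' w := (W w, \1_A w : R).
have mW' : measurable_wrt G W' by apply: measurable_wrt_pair => //; exact: measurable_wrt_indic.
pose Phi (p : S * R * 'rV[R]_n * Z) : \bar R :=
  (`|p.1.1.2| * psi (coord_estimator (p.1.1.1, p.1.2, p.2)))%:E.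
have mPhi : measurable_fun setT Phi.
  apply/measurable_EFinP; apply: measurable_funM.
    apply: measurableT_comp => //.
    exact: (measurableT_comp measurable_snd (@mfst2 _ _ _ (S * R)%type _ Z)).
  apply: (measurableT_comp mpsi); apply: (measurableT_comp mest).
  apply: measurable_fun_pair; last exact: measurable_snd.
  apply: measurable_fun_pair; last exact: msnd2.
  exact: (measurableT_comp measurable_fst (@mfst2 _ _ _ (S * R)%type _ Z)).
have Phi0 p : (0 <= Phi p)%E by rewrite lee_fin mulr_ge0.
have mysW : measurable_fun setT (fun p : S * R => ys p.1).
  exact: (measurableT_comp mys measurable_fst).
have := oracle_integral (Phi := Phi) sG mW' mysW lu iu lxi mPhi Phi0.
have ind (h : Omega -> \bar R) : (\int[P]_(w in A) h w = \int[P]_w ((`|\1_A w : R|)%:E * h w))%E.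
  rewrite integral_mkcond; apply: eq_integral => w _.
  rewrite patchE indicE; case: ifPn => _; first by rewrite normr1 mul1e.
  by rewrite normr0 mul0e.
rewrite !ind => E; rewrite [RHS](_ : _ = \int[P]_w Phi (W' w, u w, xi w))%E; last first.
  by apply: eq_integral => w _; rewrite /Phi EFinM.
rewrite E; apply: eq_integral => w _.
rewrite /state_mean -ge0_integralZl//; last 2 first.
- exact: (measurableT_comp minner_sphere (pair1_measurable (W w))).
- by move=> v _; exact: inner0.
apply: eq_integral => v _; rewrite -ge0_integralZl//.
- exact: (measurableT_comp mpe (pair1_measurable (W w, sphere_proj v))).
- by move=> z _; rewrite lee_fin.
Qed.

End part.

Let pos (t : R) := Num.max t 0.
Let neg (t : R) := Num.max (- t) 0.

Let mpos : measurable_fun setT pos.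
Proof. exact: measurable_maxr. Qed.

Let mneg : measurable_fun setT neg.
Proof. by apply: measurable_maxr => //; exact: measurableT_comp. Qed.

Let pos0 t : 0 <= pos t. Proof. by rewrite /pos le_max lexx orbT. Qed.
Let neg0 t : 0 <= neg t. Proof. by rewrite /neg le_max lexx orbT. Qed.

Let pos_le t : pos t <= `|t|.
Proof. by rewrite /pos ge_max normr_ge0 ler_norm. Qed.

Let neg_le t : neg t <= `|t|.
Proof. by rewrite /neg ge_max normr_ge0 -normrN ler_norm. Qed.

(** The oracle averages to f, and the constant cs s disappears because
    directions have mean zero; what remains is the formula for the gradient of
    the smoothed function. *)
Lemma state_mean_gradient s :
  gradient (smoothed delta f) (ys s) ord0 i =
  fine (state_mean pos s) - fine (state_mean neg s).
Proof.
rewrite (smoothed_differentiable n0 L0 delta0 hLip (ys s)).2.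
rewrite !state_meanE//= -bmeas_RintegralB; [|exact: inner_bmeas..].
have bf : bmeas (fun v : 'rV[R]_n => f (ys s + delta *: sphere_proj v)).
  exact: (bmeas_lipschitz_sphere (rescale_ge0 L0 delta0) (lipschitz_rescale delta0 hLip (ys s))).
have bi := bmeas_sphere_coord (R := R) i.
transitivity (\int[PB]_v (n%:R / delta * (f (ys s + delta *: sphere_proj v) * sphere_proj v ord0 i)
   - n%:R / delta * cs s * sphere_proj v ord0 i)).
  rewrite bmeas_RintegralB; last 2 first.
  - by apply: bmeasM; [exact: bmeas_cst|exact: bmeasM].
  - by apply: bmeasM => //; exact: bmeas_cst.
  rewrite [X in _ - X]bmeas_RintegralZ// sphere_mean mulr0 subr0.
  rewrite bmeas_RintegralZ; last exact: bmeasM.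
  by rewrite /smoothed_grad !mxE; ring.
apply: eq_Rintegral => v _.
set x := x_of (s, sphere_proj v).
set m := n%:R / delta * sphere_proj v ord0 i.
have iF : (Xi x).-integrable setT (EFin \o F x) by exact: hint.
have ic : (Xi x).-integrable setT (EFin \o (fun=> cs s)).
  by apply: bmeas_integrable; [rewrite prob_kernel ltry|exact: bmeas_cst].
have iFc : (Xi x).-integrable setT (fun z => (F x z)%:E - (cs s)%:E)%E.
  exact: integrableB.
have E : (\int[Xi x]_z (coord_estimator (s, sphere_proj v, z))%:E =
    (m * (f x - cs s))%:E)%E.
  transitivity (\int[Xi x]_z (m%:E * ((F x z)%:E - (cs s)%:E)))%E.
    by apply: eq_integral => z _; rewrite -EFinB -EFinM /coord_estimator /m -/x/=;
      congr EFin; ring.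
  rewrite integralZl// integralB// hmean integral_cst// prob_kernel mule1.
  by rewrite -EFinB -EFinM.
rewrite integralE in E.
have P1 : (\int[Xi x]_z (pos (coord_estimator (s, sphere_proj v, z)))%:E)%E \is a fin_num.
  rewrite ge0_fin_numE; last by apply: integral_ge0 => z _; rewrite lee_fin.
  by rewrite (le_lt_trans (inner_le mpos pos0 pos_le s v))// ltry.
have P2 : (\int[Xi x]_z (neg (coord_estimator (s, sphere_proj v, z)))%:E)%E \is a fin_num.
  rewrite ge0_fin_numE; last by apply: integral_ge0 => z _; rewrite lee_fin.
  by rewrite (le_lt_trans (inner_le mneg neg0 neg_le s v))// ltry.
move: P1 P2; set a := (\int[_]_z _)%E; set b := (\int[_]_z _)%E => P1 P2.
have Eab : (a - b = (m * (f x - cs s))%:E)%E.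
  by rewrite -E; congr (_ - _)%E; apply: eq_integral => z _;
    rewrite ?funeposE ?funenegE EFin_max.
transitivity (fine (a - b)%E); last by rewrite fineB.
by rewrite Eab /m /x /x_of/=; ring.
Qed.

(** The estimator may fail to be integrable, as y and the previous oracle
    value are arbitrary, but its positive and negative parts have finite
    conditional means. *)
Lemma conditional_gradient (G : set (set Omega)) (W : Omega -> S)
    (u : {RV P >-> 'rV[R]_n}) (xi : {RV P >-> Z}) :
  sub_sigma_algebra_of G -> measurable_wrt G W ->
  has_law P u unif_sphere -> indep_of P G u ->
  has_cond_law P (sigma_join G u) xi (fun w => Xi (ys (W w) + delta *: u w)) ->
  is_cond_exp P G (fun w => coord_estimator (W w, u w, xi w))
    (fun w => gradient (smoothed delta f) (ys (W w)) ord0 i).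
Proof.
move=> sG mW lu iu lxi; have [sa GT] := sG.
have mfin (psi : R -> R) : measurable_fun setT psi -> (forall t, 0 <= psi t) ->
    measurable_wrt G (fun w => fine (state_mean psi (W w))).
  move=> mp p0; apply: (measurable_wrt_comp (f := fun s => fine (state_mean psi s)) sa) => //.
  by apply: (measurableT_comp (f := fine)) => //; exact: measurable_state_mean.
split.
  apply: (measurable_wrt_comp (f := fun s => gradient (smoothed delta f) (ys s) ord0 i) sa) => //.
  rewrite (_ : (fun s => _) = fun s => smoothed_grad delta f (ys s) ord0 i); last first.
    by apply/funext => s; rewrite (smoothed_differentiable n0 L0 delta0 hLip (ys s)).2.
  apply: (measurableT_comp (measurable_coord (T := R) i)).
  exact: (measurableT_comp (measurable_smoothed_grad L0 delta0 hLip) mys).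
exists (fun w => fine (state_mean pos (W w))), (fun w => fine (state_mean neg (W w))).
split.
- exact: mfin.
- exact: mfin.
- by move=> w; split; apply/fine_ge0/state_mean_ge0.
- move=> A GA; split.
    under eq_integral do rewrite fineK ?state_mean_fin//.
    rewrite (integral_state_mean mpos pos0 sG mW lu iu lxi GA).
    by apply: eq_integral => w _; rewrite funeposE EFin_max.
  under eq_integral do rewrite fineK ?state_mean_fin//.
  rewrite (integral_state_mean mneg neg0 sG mW lu iu lxi GA).
  by apply: eq_integral => w _; rewrite funenegE EFin_max.
- by apply: aeW => w; exact: state_mean_gradient.
Qed.

End conditional_expectation.

End model.

Theorem lemma3p2 (R : realType) (d : nat) (hd : (0 < d)%N)
  (* oracle: distributions Xi x on Z, noisy values F x xi, mean f *)
  (dZ : measure_display) (Z : measurableType dZ)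
  (Xi : R.-pker 'rV[R]_d ~> Z) (F : 'rV[R]_d -> Z -> R) (f : 'rV[R]_d -> R)
  (L sigma delta : R) (hdelta : 0 < delta)
  (hF : measurable_fun setT (fun p : 'rV[R]_d * Z => F p.1 p.2))
  (hLip : euclidean_lipschitz L f)
  (hint : forall x, (Xi x).-integrable setT (EFin \o F x))
  (hmean : forall x, (\int[Xi x]_z (F x z)%:E)%E = (f x)%:E)
  (hvar : forall x,
    ((\int[Xi x]_z (`|F x z - f x| ^+ 2)%:E)%E <= (sigma ^+ 2)%:E)%E)
  (* probability space, and the sigma-algebras G2 = F_{t-2}, G1 = F_{t-1} *)
  (dO : measure_display) (Omega : measurableType dO) (P : probability Omega R)
  (G2 G1 : set (set Omega))
  (hG2 : sub_sigma_algebra_of G2) (hG1 : sub_sigma_algebra_of G1)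
  (hG21 : G2 `<=` G1)
  (* current iteration (y, u, xi), previous iteration (y', u', xi') *)
  (y u y' u' : {RV P >-> 'rV[R]_d}) (xi xi' : {RV P >-> Z})
  (hy'2 : measurable_wrt G2 y')
  (hu' : has_law P u' unif_sphere) (hindep' : indep_of P G2 u')
  (hxi' : has_cond_law P (sigma_join G2 u') xi'
            (fun w => Xi (y' w + delta *: u' w)))
  (hy : measurable_wrt G1 y) (hy' : measurable_wrt G1 y')
  (hu'1 : measurable_wrt G1 u') (hxi'1 : measurable_wrt G1 xi')
  (hu : has_law P u unif_sphere) (hindep : indep_of P G1 u)
  (hxi : has_cond_law P (sigma_join G1 u) xi
           (fun w => Xi (y w + delta *: u w))) :
  let g w := g_1pt delta F (y w) (u w) (xi w) (y' w) (u' w) (xi' w) in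
  [/\ forall x, differentiable (smoothed delta f) x,
      forall i : 'I_d, is_cond_exp P G1 (fun w => g w ord0 i)
        (fun w => gradient (smoothed delta f) (y w) ord0 i) &
      ('E_P[fun w => (enorm (g w) ^+ 2)%R] <=
        (6 * d%:R ^+ 2 * sigma ^+ 2 / delta ^+ 2
         + 144 * Num.sqrt (2 * pi) * d%:R * L ^+ 2)%R%:E
        + (6 * d%:R ^+ 2 * L ^+ 2 / delta ^+ 2)%R%:E
          * 'E_P[fun w => (enorm (y w - y' w) ^+ 2)%R])%E].
Proof.
have L0 := euclidean_lipschitz_ge0 hd hLip.
have [sG1 _] := hG1.
have mx' : measurable_wrt G1 (fun w => y' w + delta *: u' w).
  apply: (measurable_wrt_comp (f := fun p : 'rV[R]_d * 'rV[R]_d => p.1 + delta *: p.2)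
    (g := fun w => (y' w, u' w)) sG1); last exact: measurable_wrt_pair.
  by apply: measurable_query.
have mc : measurable_wrt G1 (fun w => F (y' w + delta *: u' w) (xi' w)).
  apply: (measurable_wrt_comp (f := fun p : 'rV[R]_d * Z => F p.1 p.2)
    (g := fun w => (y' w + delta *: u' w, xi' w)) sG1) => //.
  exact: measurable_wrt_pair.
split=> [x|i|].
- exact: (smoothed_differentiable hd L0 hdelta hLip x).1.
- have := conditional_gradient hd hdelta hF hLip hint hmean hvar
    (ys := fst) (cs := snd) measurable_fst measurable_snd i
    (W := fun w => (y w, F (y' w + delta *: u' w) (xi' w))) hG1
    (measurable_wrt_pair sG1 hy mc) hu hindep hxi.
  congr is_cond_exp; apply/funext => w.
  by rewrite /coord_estimator /g_1pt /= !mxE.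
- rewrite unlock.
  apply: le_trans (residual_second_moment hd hdelta hF hLip hvar hG2 hG1 hy'2
    hu' hindep' hxi' hy hy' hu'1 hu hindep hxi) _.
  apply: leeD => //; rewrite lee_fin lerD2l ler_wpM2r ?sqr_ge0// ler_wpM2r//.
  (* sqrt (2 pi) >= 2 because pi >= 2 *)
  have : Num.sqrt (2 ^+ 2) <= Num.sqrt (2 * pi) :> R.
    by rewrite ler_wsqrtr// expr2 ler_pM2l// pi_ge2.
  by rewrite sqrtr_sqr ger0_norm//; lra.
Qed.
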